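(* Let $d\ge2$. There exists $\beta'(d)>0$, depending only on $d$, such that for every real $\beta$ with $|\beta|\le\beta'(d)$, every increasing sequence $\Lambda_1\subseteq\Lambda_2\subseteq\cdots$ of finite subsets of $\mathbb Z^d$ with $\bigcup_j\Lambda_j=\mathbb Z^d$, and every loop sequence $(l_1,l_2,\dots,l_n)$, $$\lim_{N\to\infty}\frac{\langle W_{l_1}W_{l_2}\cdots W_{l_n}\rangle_{\Lambda_N,N,2\beta}}{N^n}=\lim_{N\to\infty}\frac{\langle W_{l_1}W_{l_2}\cdots W_{l_n}\rangle'_{\Lambda_N,N,\beta}}{N^n},$$ where $\langle\cdot\rangle_{\Lambda,N,2\beta}$ denotes expectation in $SU(N)$ lattice gauge theory on $\Lambda$ at inverse coupling strength $2\beta$ and $\langle\cdot\rangle'_{\Lambda,N,\beta}$ denotes expectation in $SO(N)$ lattice gauge theory on $\Lambda$ at inverse coupling strength $\beta$.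
   Context: **Loops.** Edges are directed nearest-neighbour edges $e=(u(e),v(e))$ of $\mathbb Z^d$, with $e^{-1}$ the reversed edge; $e$ is positively oriented if $u(e)$ is lexicographically smaller than $v(e)$. A loop is a class, modulo cyclic permutation, of closed paths $e_1\cdots e_n$ ($v(e_i)=u(e_{i+1})$, $v(e_n)=u(e_1)$) without backtracks, i.e. with $e_{i+1}\ne e_i^{-1}$ for all $i$ ($e_{n+1}:=e_1$); the null loop has no edges. A loop sequence is a finite sequence of loops (modulo inserting or deleting null loops). A plaquette is a closed path $e_1e_2e_3e_4$ with $e_i\neq e_j^{-1}$ for all $i,j$, up to cyclic equivalence; it is positively oriented if it has a representative for which $u(e_1)$ is lexicographically smallest and $u(e_2)$ second smallest among its vertices. **Gauge theory.** Let $G$ be $SU(N)$ or $SO(N)$, the groups of $N\times N$ unitary (resp. real orthogonal) matrices of determinant $1$. For finite $\Lambda\subset\mathbb Z^d$, $E^+_\Lambda$ is the set of positively oriented edges with both endpoints in $\Lambda$ and $\mathcal P^+_\Lambda$ the set of positively oriented plaquettes with all edges in $\Lambda$. A configuration is $Q=(Q_e)_{e\in E^+_\Lambda}$ with $Q_e\in G$, $Q_{e^{-1}}:=Q_e^{-1}=Q_e^*$. $G$ lattice gauge theory on $\Lambda$ at inverse coupling strength $\beta$ is the probability measure $$d\mu_{\Lambda,N,\beta}(Q)=Z_{\Lambda,N,\beta}^{-1}\exp\Bigl(N\beta\sum_{p\in\mathcal P^+_\Lambda}\mathrm{Re}\,\mathrm{Tr}(Q_p)\Bigr)\prod_{e\in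 E^+_\Lambda}d\sigma(Q_e),\qquad Q_p=Q_{e_1}Q_{e_2}Q_{e_3}Q_{e_4},$$ with $\sigma$ the normalized Haar measure on $G$. For a loop $l=e_1\cdots e_n$ with edges in $\Lambda$, $W_l=\mathrm{Tr}(Q_{e_1}\cdots Q_{e_n})$ (and $W_\emptyset=N$). *)

(* Defs.v *)
From HB Require Import structures.
From mathcomp Require Import all_boot all_order all_algebra.
From mathcomp Require Import finmap generic_quotient.
From mathcomp Require Import all_classical all_reals all_analysis.
From mathcomp Require Import complex.

Set Implicit Arguments.
Unset Strict Implicit.
Unset Printing Implicit Defensive.

Import Order.TTheory GRing.Theory Num.Theory.
Import numFieldNormedType.Exports.

Local Open Scope classical_set_scope.
Local Open Scope ring_scope.
Local Open Scope complex_scope.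
Local Open Scope quotient_scope.

(* [tuplelexi] carries the lexicographic order. *)
Definition site (d : nat) := (d.-tuplelexi int)%type.

HB.instance Definition _ d := Order.Total.on (site d).

Section Lattice.
Variable d : nat.

(* A directed edge [e] is encoded by the pair [(u(e), v(e))]; that its
   endpoints are nearest neighbours is the predicate [is_edge]. *)
Definition edge := (site d * site d)%type.
Implicit Types (e f : edge) (s t : seq edge).

Definition is_edge e : bool :=
  (\sum_(i < d) `|tnth e.1 i - tnth e.2 i|%N == 1)%N.
Definition rev_edge e : edge := (e.2, e.1).
Definition pos_edge e : bool := (e.1 < e.2)%O.

Definition closed_path s : bool :=
  all is_edge s && cycle (fun e f => e.2 == f.1) s.
Definition no_backtrack s : bool := cycle (fun e f => f != rev_edge e) s.

Definition cpath := {s : seq edge | closed_path s && no_backtrack s}.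
Implicit Types p q : cpath.

Definition cyc_equiv p q : bool :=
  [exists k : 'I_(size (val p)).+1, rot k (val p) == val q].

Lemma cyc_equivP p q : reflect (exists k, rot k (val p) = val q) (cyc_equiv p q).
Proof.
apply: (iffP existsP) => [[k /eqP <-]|[k <-]]; first by exists k.
have [lek|ltk] := leqP k (size (val p)).
  by exists (Ordinal (lek : (k < (size (val p)).+1)%N)).
by exists ord_max; rewrite rot_size rot_oversize// ltnW.
Qed.

Lemma cyc_equiv_refl : reflexive cyc_equiv.
Proof. by move=> p; apply/cyc_equivP; exists 0%N; rewrite rot0. Qed.

Lemma cyc_equiv_sym : symmetric cyc_equiv.
Proof.
suff sub p q : cyc_equiv p q -> cyc_equiv q p.
  by move=> p q; apply/idP/idP; exact: sub.
move=> /cyc_equivP[k E]; apply/cyc_equivP; exists (size (val q) - k)%N.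
by rewrite -E -[LHS]/(rotr k (rot k (val p))) rotK.
Qed.

Lemma cyc_equiv_trans : transitive cyc_equiv.
Proof.
move=> q p r /existsP[k /eqP E] /existsP[m /eqP F].
apply/cyc_equivP; have le1 : (k <= size (val p))%N by rewrite -ltnS ltn_ord.
have : (m <= size (val q))%N by rewrite -ltnS ltn_ord.
move: (nat_of_ord m) F => {}m F le2.
by rewrite -E size_rot in le2; rewrite -F -E rot_add_mod//; eexists.
Qed.

Canonical cyc_equiv_rel :=
  EquivRel cyc_equiv cyc_equiv_refl cyc_equiv_sym cyc_equiv_trans.

Definition loop := {eq_quot cyc_equiv}.
HB.instance Definition _ := Choice.on loop.
HB.instance Definition _ := EqQuotient.on loop.

(* Members of P^+_Lambda are loops, i.e. cyclic classes; the orientation only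
   asks for one representative in the required form. *)
Definition plaquette_path s : bool :=
  [&& (size s == 4)%N, closed_path s
    & all (fun e => all (fun f => e != rev_edge f) s) s].

Definition pos_plaquette_path s : bool :=
  plaquette_path s &&
  (if [seq e.1 | e <- s] is [:: u1, u2 & us]
   then (u1 < u2)%O && all (fun u => (u2 < u)%O) us else false).

Definition edge_in (L : {fset site d}) e : bool := (e.1 \in L) && (e.2 \in L).

Definition pos_edges (L : {fset site d}) : {fset edge} :=
  [fset e in L `*` L | is_edge e && pos_edge e]%fset.

Definition pos_plaquettes (L : {fset site d}) : set loop :=
  [set \pi_loop p | p in [set p : cpath |
     pos_plaquette_path (val p) && all (edge_in L) (val p)]].

Lemma finite_pos_plaquettes L : finite_set (pos_plaquettes L).
Proof.
apply: finite_image.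
pose E := enum_fset (L `*` L)%fset.
pose S2 := [seq [:: e; f] | e <- E, f <- E].
pose S4 : seq (seq edge) := [seq s ++ t | s <- S2, t <- S2].
pose S : seq cpath := pmap insub S4.
apply: (@sub_finite_set _ _ [set` S]); last exact: finite_seq.
move=> p /= /andP[/andP[/and3P[/eqP sz _ _] _] inL].
suff : val p \in S4 by rewrite mem_pmap_sub.
move: sz inL; case: p => s _ /=.
case: s => [|e1 [|e2 [|e3 [|e4 [|e5 t]]]]] //= _.
rewrite andbT => /and4P[h1 h2 h3 h4].
have inE' e : edge_in L e -> e \in E by rewrite in_fsetM.
apply/allpairsP; exists ([:: e1; e2], [:: e3; e4]); split=> //=.
- by apply/allpairsP; exists (e1, e2); split=> //=; exact: inE'.
- by apply/allpairsP; exists (e3, e4); split=> //=; exact: inE'.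
Qed.

End Lattice.

(* Topology of the modulus. *)
HB.instance Definition _ (R : rcfType) := PseudoPointedMetric.copy R[i] R[i]^o.
HB.instance Definition _ (R : rcfType) := NormedModule.copy R[i] R[i]^o.

Record unitary_group (R : realType) (N : nat) := UnitaryGroup {
  ugset :> set 'M[R[i]]_N ;
  ug_unitary : forall A, ugset A -> A \is unitarymx ;
  ug1 : ugset 1%:M ;
  ugM : forall A B, ugset A -> ugset B -> ugset (A *m B) ;
  ugV : forall A, ugset A -> ugset (A ^t* )%sesqui }.

Definition uelt (R : realType) N (G : unitary_group R N) := set_type G.

Section UnitaryGroupElements.
Context (R : realType) (N : nat) (G : unitary_group R N).
Implicit Types x y : uelt G.

HB.instance Definition _ := Choice.on (uelt G).
HB.instance Definition _ := SubType.on (uelt G).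

Definition mk_uelt A (GA : ugset G A) : uelt G := exist _ A (mem_set GA).
Definition uelt_one : uelt G := mk_uelt (ug1 G).
Definition uelt_mul x y : uelt G :=
  mk_uelt (ugM (set_mem (valP x)) (set_mem (valP y))).
Definition uelt_inv x : uelt G := mk_uelt (ugV (set_mem (valP x))).

Lemma uelt_mulA : associative uelt_mul.
Proof. by move=> x y z; apply/val_inj; rewrite /= mulmxA. Qed.
Lemma uelt_mul1 : left_id uelt_one uelt_mul.
Proof. by move=> x; apply/val_inj; rewrite /= mul1mx. Qed.
Lemma uelt_1mul : right_id uelt_one uelt_mul.
Proof. by move=> x; apply/val_inj; rewrite /= mulmx1. Qed.
Lemma uelt_mulV : right_inverse uelt_one uelt_inv uelt_mul.
Proof.
move=> x; apply/val_inj => /=; apply/eqP.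
by have /ug_unitary/unitarymxP-> := set_mem (valP x).
Qed.
Lemma uelt_Vmul : left_inverse uelt_one uelt_inv uelt_mul.
Proof.
move=> x; apply/val_inj => /=; apply: mulmx1C.
by have /ug_unitary/unitarymxP-> := set_mem (valP x).
Qed.

HB.instance Definition _ := isGroup.Build (uelt G)
  uelt_mulA uelt_mul1 uelt_1mul uelt_Vmul uelt_mulV.

HB.instance Definition _ := isPointed.Build (uelt G) uelt_one.
HB.instance Definition _ := Topological.copy (uelt G) (set_type G).

HB.instance Definition _ := @isMeasurable.Build (sigma_display (@open (uelt G)))
  (uelt G) <<s open >> (@sigma_algebra0 _ setT open) (@sigma_algebraC _ open)
  (@sigma_algebra_bigcup _ setT open).

(* On a compact group left invariance characterizes the Haar measure among
   Borel probability measures. *)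
Definition is_haar (sigma : probability (uelt G) R) : Prop :=
  forall x (B : set (uelt G)), measurable B ->
    sigma [set y | B (x * y)%g] = sigma B.

End UnitaryGroupElements.

Section SUSO.
Context (R : realType) (N : nat).

Definition SU_set : set 'M[R[i]]_N :=
  [set A | A \is unitarymx /\ \det A = 1].

(* Real special orthogonal matrices, seen as complex matrices so that both
   gauge groups are subgroups of U(N) and share the definitions below. *)
Definition SO_real : set 'M[R]_N :=
  [set A | A *m A^T = 1%:M /\ \det A = 1].
Definition SO_set : set 'M[R[i]]_N :=
  [set map_mx (real_complex R) A | A in SO_real].

Lemma SU_unitary A : SU_set A -> A \is unitarymx. Proof. by case. Qed.
Lemma SU_1 : SU_set 1%:M.
Proof.
split; last exact: det1.
by apply/unitarymxP; rewrite trmx1 map_mx1 mulmx1.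
Qed.
Lemma SU_M A B : SU_set A -> SU_set B -> SU_set (A *m B).
Proof.
move=> [uA dA] [uB dB]; split; first exact: mul_unitarymx.
by rewrite det_mulmx dA dB mulr1.
Qed.
Lemma SU_V A : SU_set A -> SU_set (A ^t* )%sesqui.
Proof.
move=> [uA dA]; split; first by rewrite trmxC_unitary.
by rewrite det_map_mx det_tr dA rmorph1.
Qed.
Definition SU := UnitaryGroup SU_unitary SU_1 SU_M SU_V.

Lemma SO_adj (A : 'M[R]_N) :
  ((map_mx (real_complex R) A) ^t* )%sesqui = map_mx (real_complex R) A^T.
Proof.
by apply/matrixP => i j; rewrite !mxE; exact: conjc_real.
Qed.
Lemma SO_unitary A : SO_set A -> A \is unitarymx.
Proof.
move=> [B [oB _] <-]; apply/unitarymxP.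
by rewrite SO_adj -map_mxM oB map_mx1.
Qed.
Lemma SO_1 : SO_set 1%:M.
Proof.
exists 1%:M; last exact: map_mx1.
by split; rewrite ?det1// trmx1 mulmx1.
Qed.
Lemma SO_M A B : SO_set A -> SO_set B -> SO_set (A *m B).
Proof.
move=> [A' [oA dA] <-] [B' [oB dB] <-]; exists (A' *m B'); last exact: map_mxM.
split; last by rewrite det_mulmx dA dB mulr1.
by rewrite trmx_mul mulmxA -(mulmxA A') oB mulmx1.
Qed.
Lemma SO_V A : SO_set A -> SO_set (A ^t* )%sesqui.
Proof.
move=> [A' [oA dA] <-]; exists A'^T; last by rewrite SO_adj.
by split; rewrite ?det_tr// trmxK; exact: mulmx1C.
Qed.
Definition SO := UnitaryGroup SO_unitary SO_1 SO_M SO_V.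

End SUSO.

Section PowerProbability.
Context (dT : measure_display) (T : measurableType dT) (R : realType).
Variable P : probability T R.

Definition tcons n (x : T * n.-tuple T) : n.+1.-tuple T :=
  [tuple of x.1 :: x.2].

Lemma measurable_tcons n : measurable_fun setT (@tcons n).
Proof. exact: measurable_cons. Qed.
HB.instance Definition _ n :=
  @isMeasurableFun.Build _ _ _ _ (@tcons n) (@measurable_tcons n).

Fixpoint power_prob n : probability (n.-tuple T) R :=
  if n is n'.+1 then distribution (P \x power_prob n')%E (@tcons n')
  else dirac [tuple].

Lemma power_probE n (A : 'I_n -> set T) : (forall i, measurable (A i)) ->
  power_prob n [set x | forall i, A i (tnth x i)] = (\prod_(i < n) P (A i))%E.
Proof.
elim: n A => [|n IH] A mA.
  rewrite big_ord0 /= diracE mem_set//= => -[]//.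
rewrite big_ord_recl /= /distribution /pushforward /=.
rewrite (_ : _ @^-1` _ = A ord0 `*`
  [set x | forall i, A (lift ord0 i) (tnth x i)]); last first.
  apply/seteqP; split=> [[x t] /= h|[x t] /= [h0 h] i].
    by split=> [|i]; [have := h ord0|have := h (lift ord0 i); rewrite tnthS].
  by case: (unliftP ord0 i) => [j|] ->; rewrite ?tnthS.
rewrite product_measure1E//; first by congr (_ * _)%E; exact: (IH (fun i => A (lift ord0 i))).
rewrite (_ : [set x | _] = \bigcap_(i in [set: 'I_n])
  (fun x : n.-tuple T => tnth x i) @^-1` A (lift ord0 i)); last first.
  by apply/seteqP; split=> x /= h i; [move=> _; exact: h|exact: h].
apply: fin_bigcap_measurable => // i _.
by rewrite -[X in measurable X]setTI; exact: measurable_tnth.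
Qed.

End PowerProbability.

Section Gauge.
Context (R : realType) (d N : nat) (G : unitary_group R N).
Variables (sigma : probability (uelt G) R) (L : {fset site d}) (beta : R).

(* The coordinate attached to the edge [e] of E^+_Lambda is the one of rank
   [index e (pos_edges L)]. *)
Definition config := #|` pos_edges L|.-tuple (uelt G).
Implicit Type Q : config.

(* Q_e; edges that do not lie in Lambda get the junk value 1. *)
Definition link Q (e : edge d) : uelt G :=
  if e \in pos_edges L then nth 1%g Q (index e (pos_edges L))
  else ((nth 1%g Q (index (rev_edge e) (pos_edges L)))^-1)%g.

Definition holonomy Q (s : seq (edge d)) : uelt G := (\prod_(e <- s) link Q e)%g.

Definition wilson Q (l : loop d) : R[i] :=
  \tr (\val (holonomy Q (\val (repr l)))).

(* [wilson] does not depend on the representative of the cyclic class. *)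
Lemma wilsonE Q (p : cpath d) :
  wilson Q (\pi_(loop d) p) = \tr (\val (holonomy Q (\val p))).
Proof.
rewrite /wilson; case: piP => q /eqmodP/cyc_equivP[k E].
rewrite -E /holonomy /rot big_cat /= -[in RHS](cat_take_drop k (val p)) big_cat /=.
exact: mxtrace_mulC.
Qed.

Definition gauge_weight Q : R :=
  expR (N%:R * beta * \sum_(p \in pos_plaquettes L) complex.Re (wilson Q p)).

Definition config_haar : probability config R := power_prob sigma #|` pos_edges L|.

Definition partition_function : R := \int[config_haar]_Q gauge_weight Q.

(* Integral against Z^-1 gauge_weight dsigma^E, taken separately on the real
   and imaginary parts. *)
Definition gauge_expect (f : config -> R[i]) : R[i] :=
  (partition_function^-1 *
     \int[config_haar]_Q (complex.Re (f Q) * gauge_weight Q)) +i*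
  (partition_function^-1 *
     \int[config_haar]_Q (complex.Im (f Q) * gauge_weight Q)).

End Gauge.

(* Main.v *)
Require Import Defs.
From HB Require Import structures.
From mathcomp Require Import all_boot all_order all_algebra.
From mathcomp Require Import finmap perm generic_quotient.
From mathcomp Require Import all_classical all_reals all_analysis.
From mathcomp Require Import measurable_realfun.
From mathcomp Require Import complex ring lra zify.

Set Implicit Arguments.
Unset Strict Implicit.
Unset Printing Implicit Defensive.

Import Order.TTheory GRing.Theory Num.Theory.
Import numFieldNormedType.Exports.
Import Normc.

Local Open Scope classical_set_scope.
Local Open Scope ring_scope.
Local Open Scope complex_scope.

(** Write [phi ws] for the expectation of a product of Wilson loops divided by
    the corresponding power of N.  For SU(N) at coupling 2 beta and for SO(N) at
    coupling beta these numbers satisfy one and the same linear equation up to an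
    error O(1/N), and for small beta that equation is a contraction; hence both
    families converge, and to the same limit.

    The equation is a Schwinger-Dyson identity.  Left multiplication of the link
    variable of an edge by a curve in the group, tangent at 1 to a Lie algebra
    element X, preserves the Haar measure, so the derivative of any observable
    along it integrates to zero ([schwinger_dyson]).  Take the observable
    tr(X Q_f Q_b) W(ws), with the Gibbs weight included, and sum over generators
    of the Lie algebra.  The Casimir tensor of su(N) or so(N) is minus the flip of
    the two tensor factors plus a remainder.  When the derivative falls on the
    first letter of f :: b the flip reproduces - N W(f :: b); on another letter
    f or f^-1 of b it splits the word in two; on ws it merges two words, which is
    of lower order; on the weight it deforms the word by a plaquette through f.
    This is [approximate_loop_equation].

    The remainder is the transposition for so(N) and the identity divided by N for
    su(N).  It is negligible except in the plaquette terms, where it accounts for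
    two differences between the groups.  For so(N) it makes every plaquette act
    together with its inverse, which doubles the coupling
    ([so_plaquette_rule]).  For su(N) it leaves the terms
    beta (phi(w, p) - phi(w, p^-1)), which do not tend to zero term by term; the
    equation keeps them, and for SO(N) they cancel identically because a real
    orthogonal matrix and its inverse have the same trace.

    The equation holds for arbitrary words of edges, closed or not, so no
    reduction of backtracks is ever needed beyond erasing the pair f, f^-1 at
    which a word is cut.  The contraction is measured with the weight
    prod wt(|w|), where wt n = 64^(n-1) / n^2: sums over all ways of cutting a
    word are controlled by the convolution inequality
    sum_(0 < y < n) wt(y) wt(n - y) <= wt(n) / 8, although the number of cuts grows
    with the word, and the plaquette terms carry a factor beta
    ([seq_contraction], [common_limit]). *)

(** * Haar measure on a group of unitary matrices *)

Section BorelGroup.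
Context (R : realType) (N : nat) (G : unitary_group R N).

(** Real and imaginary parts are 1-Lipschitz for the modulus, which is the norm
    defining the topology of the complex numbers. *)
Lemma contracting_continuous (f : R[i] -> R) :
  (forall z w, f (z - w) = f z - f w) -> (forall z, `|f z|%:C <= `|z|) ->
  continuous f.
Proof.
move=> fB lef z A /nbhs_ballP[e /= e0 sA].
have e0' : 0 < e%:C by rewrite ltcR.
have H := @nbhsx_ballx _ _ z _ e0'.
apply: (@filterS _ (nbhs z) _ _ _ _ H) => w; rewrite /ball /= => h.
apply: sA; rewrite /ball /= -fB -ltcR.
exact: le_lt_trans (lef _) h.
Qed.

Lemma Re_continuous : continuous (fun z : R[i] => complex.Re z).
Proof.
apply: contracting_continuous => [z w|z]; last exact: normc_ge_Re.
by case: z w => [a b] [c d].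
Qed.

Lemma Im_continuous : continuous (fun z : R[i] => complex.Im z).
Proof.
apply: contracting_continuous => [z w|z]; first by case: z w => [a b] [c d].
have := normc_ge_Re (z * 'i%C); rewrite ReiNIm normrN => /le_trans; apply.
by rewrite normrM [X in _ * X]normc_def /= expr0n expr1n add0r sqrtr1 mulr1.
Qed.

Lemma val_continuous : continuous (\val : uelt G -> 'M[R[i]]_N).
Proof. exact: initial_continuous. Qed.

Lemma continuous_mx (T : topologicalType) (F : T -> 'M[R[i]]_N) :
  (forall i j, continuous (fun x => F x i j)) -> continuous F.
Proof.
move=> cF x A [P nP sPA]; rewrite /nbhs /=.
have H : \forall y \near x, forall ij : 'I_N * 'I_N, P ij.1 ij.2 (F y ij.1 ij.2).
  apply: filter_forall => -[i j] /=.
  exact: (cF i j x _ (nP i j)).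
by apply: filterS H => y Hy; apply: sPA => i j; exact: (Hy (i, j)).
Qed.

Lemma entry_continuous i j : continuous (fun x : uelt G => val x i j).
Proof.
move=> x; apply: (@continuous_comp _ _ _ (\val : uelt G -> 'M[R[i]]_N) (fun M : 'M[R[i]]_N => M i j)).
  exact: val_continuous.
exact: coord_continuous.
Qed.

Lemma mulg_left_continuous (x : uelt G) : continuous (fun y : uelt G => (x * y)%g).
Proof.
have cE i j : continuous (fun y : uelt G => \sum_k val x i k * val y k j).
  apply: (@continuous_big R[i]^o 'I_N +%R 0 xpredT (@add_continuous R[i]^o)) => k _ z.
  apply: (@continuous_comp _ _ _ (fun y : uelt G => val y k j) (fun w : R[i] => val x i k * w)).
    exact: entry_continuous.
  exact: mulrl_continuous.
apply: continuous_comp_initial; apply: continuous_mx => i j.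
have -> : (fun y => (\val \o (fun y : uelt G => (x * y)%g)) y i j) =
   (fun y : uelt G => \sum_k val x i k * val y k j).
  by apply/funext => z; rewrite /= mxE.
exact: cE.
Qed.

(** The sigma-algebra of the group is generated by its open sets, whereas that of
    the reals is generated by open intervals: continuity transports one to the
    other. *)
Lemma borel_continuous (f : uelt G -> R) : continuous f -> measurable_fun setT f.
Proof.
move=> cf; apply: (measurability _ (measurable_realfun.RGenOpens.measurableE R)).
move=> _ [_ [a [b ->]] <-]; rewrite setTI; apply: sub_sigma_algebra.
by move/continuousP: cf; apply; exact: interval_open.
Qed.

Lemma measurable_mulg_left (x : uelt G) :
  measurable_fun setT (fun y : uelt G => (x * y)%g).
Proof.
apply: (@measurability _ _ _ (uelt G) setT _ open) => //.
move=> _ [A oA <-]; rewrite setTI; apply: sub_sigma_algebra.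
by move/continuousP: (@mulg_left_continuous x); apply.
Qed.

Lemma measurable_Re_entry i j :
  measurable_fun setT (fun x : uelt G => complex.Re (val x i j)).
Proof.
apply: borel_continuous => x.
apply: (@continuous_comp _ _ _ (fun x : uelt G => val x i j) (@complex.Re R)).
  exact: entry_continuous.
exact: Re_continuous.
Qed.

Lemma measurable_Im_entry i j :
  measurable_fun setT (fun x : uelt G => complex.Im (val x i j)).
Proof.
apply: borel_continuous => x.
apply: (@continuous_comp _ _ _ (fun x : uelt G => val x i j) (@complex.Im R)).
  exact: entry_continuous.
exact: Im_continuous.
Qed.

End BorelGroup.

(** The product measure is invariant under left multiplication of a single
    coordinate. *)
Section Shift.
Context (R : realType) (N : nat) (G : unitary_group R N).
Variable sigma : probability (uelt G) R.
Hypothesis haar : is_haar sigma.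

Lemma haar_integral (x : uelt G) (h : uelt G -> \bar R) :
  measurable_fun [set: uelt G] h -> (forall y, (0 <= h y)%E) ->
  (\int[sigma]_y h (x * y)%g = \int[sigma]_y h y)%E.
Proof.
move=> mh h0.
have mx := measurable_mulg_left x.
transitivity (\int[pushforward sigma (fun y : uelt G => (x * y)%g)]_y h y)%E.
  by rewrite ge0_integral_pushforward // => y _; exact: h0.
apply: eq_measure_integral => A mA _.
by rewrite /pushforward; exact: haar.
Qed.

Definition tshift n (k : nat) (x : uelt G) (t : n.-tuple (uelt G)) :
    n.-tuple (uelt G) :=
  [tuple if i == k :> nat then (x * tnth t i)%g else tnth t i | i < n].

Lemma measurable_tshift n k x : measurable_fun setT (@tshift n k x).
Proof.
apply/measurable_fun_tnthP => i; rewrite /comp.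
under eq_fun do rewrite tnth_mktuple.
case: eqP => _; last exact: measurable_tnth.
by apply: measurableT_comp; [exact: measurable_mulg_left|exact: measurable_tnth].
Qed.

Lemma tshift_tcons0 n x (u : uelt G * n.-tuple (uelt G)) :
  tshift 0 x (tcons u) = tcons ((x * u.1)%g, u.2).
Proof.
apply: eq_from_tnth => i; rewrite tnth_mktuple.
by case: (unliftP ord0 i) => [j|] ->; rewrite ?tnthS.
Qed.

Lemma tshift_tconsS n k x (u : uelt G * n.-tuple (uelt G)) :
  tshift k.+1 x (tcons u) = tcons (u.1, tshift k x u.2).
Proof.
apply: eq_from_tnth => i; rewrite tnth_mktuple.
case: (unliftP ord0 i) => [j|] ->; rewrite ?tnthS ?tnth_mktuple //=.
Qed.

(** Induction on the recursive construction of the product: the shift acts either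
    on the first factor, where invariance of sigma applies to the measure of the
    sections, or inside each section. *)
Lemma power_prob_shift n k x (A : set (n.-tuple (uelt G))) : measurable A ->
  power_prob sigma n (tshift k x @^-1` A) = power_prob sigma n A.
Proof.
elim: n k A => [|n IH] k A mA.
  congr (power_prob sigma 0 _).
  by apply/seteqP; split=> t /=; rewrite !(tuple0 t) (tuple0 (tshift _ _ _)).
have mB : measurable (@tcons _ _ n @^-1` A).
  by rewrite -[X in measurable X]setTI; exact: measurable_tcons.
rewrite /= /distribution /pushforward /= /product_measure1.
case: k => [|k].
  rewrite -[RHS](@haar_integral x); [|exact: measurable_fun_xsection|by []].
  apply: eq_integral => y _ /=; congr (power_prob _ _ _).
  by rewrite !xsectionE; apply/seteqP; split=> t /=; rewrite tshift_tcons0.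
apply: eq_integral => y _ /=; rewrite -[RHS](IH k).
  congr (power_prob _ _ _).
  by rewrite !xsectionE; apply/seteqP; split=> t /=; rewrite tshift_tconsS.
exact: measurable_xsection.
Qed.

End Shift.

(** * Bounded measurable complex functions *)

Section NormC.
Context (R : realType).
Implicit Types z w : R[i].

Lemma normcD z w : normc (z + w) <= normc z + normc w.
Proof. exact: le_normcD. Qed.

Lemma normcB z w : normc (z - w) <= normc z + normc w.
Proof. by rewrite -(normcN w); exact: le_normcD. Qed.

Lemma normc_ge0 z : 0 <= normc z.
Proof. by case: z => a b; exact: sqrtr_ge0. Qed.

Lemma normc_real (x : R) : normc x%:C = `|x|.
Proof. by rewrite /normc /= expr0n /= addr0 sqrtr_sqr. Qed.

Lemma normcEn z : `|z| = (normc z)%:C.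
Proof. by rewrite normc_def; case: z. Qed.

Lemma Re_mulc z w : complex.Re (z * w) =
  complex.Re z * complex.Re w - complex.Im z * complex.Im w.
Proof. by case: z w => [a b] [c d]. Qed.

Lemma Im_mulc z w : complex.Im (z * w) =
  complex.Re z * complex.Im w + complex.Im z * complex.Re w.
Proof. by case: z w => [a b] [c d]. Qed.

Lemma Re_addc z w : complex.Re (z + w) = complex.Re z + complex.Re w.
Proof. by case: z w => [a b] [c d]. Qed.

Lemma Im_addc z w : complex.Im (z + w) = complex.Im z + complex.Im w.
Proof. by case: z w => [a b] [c d]. Qed.

Lemma Re_le_normc z : `|complex.Re z| <= normc z.
Proof. by case: z => a b /=; rewrite -sqrtr_sqr ler_wsqrtr // lerDl sqr_ge0. Qed.

Lemma Im_le_normc z : `|complex.Im z| <= normc z.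
Proof. by case: z => a b /=; rewrite -sqrtr_sqr ler_wsqrtr // lerDr sqr_ge0. Qed.

Lemma normc_le_ReIm z : normc z <= `|complex.Re z| + `|complex.Im z|.
Proof.
case: z => a b /=; have h : 0 <= `|a| + `|b| by rewrite addr_ge0.
rewrite -(ger0_norm h) -sqrtr_sqr ler_wsqrtr //.
rewrite sqrrD !real_normK ?num_real // addrAC lerDl mulrn_wge0 //.
Qed.

Lemma normc_conj z : normc z^* = normc z.
Proof. by case: z => a b /=; rewrite sqrrN. Qed.

Lemma normc_nat n : normc (n%:R : R[i]) = n%:R.
Proof. by rewrite -(rmorph_nat (real_complex R)) normc_real ger0_norm. Qed.

Lemma normc_sum (I : Type) (r : seq I) (P : pred I) (F : I -> R[i]) :
  normc (\sum_(i <- r | P i) F i) <= \sum_(i <- r | P i) normc (F i).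
Proof.
elim/big_ind2: _ => [|x1 x2 y1 y2 h1 h2|//]; first by rewrite normc0.
by apply: le_trans (normcD _ _) _; exact: lerD.
Qed.

End NormC.

Section ComplexIntegral.
Context {d : measure_display} {T : measurableType d} {R : realType}.
Variable mu : probability T R.
Implicit Types (f g : T -> R[i]) (c : R[i]).

(** Every observable below is a polynomial in matrix entries times the Gibbs
    weight, hence bounded and measurable.  This class is closed under the ring
    operations, and on it the integral is linear with no integrability side
    condition. *)
Definition bmeas f := [/\ measurable_fun setT (fun x => complex.Re (f x)),
  measurable_fun setT (fun x => complex.Im (f x)) &
  exists K : R, forall x, normc (f x) <= K].

Definition cint f : R[i] :=
  (\int[mu]_x complex.Re (f x)) +i* (\int[mu]_x complex.Im (f x)).

Lemma eq_cint f g : f =1 g -> cint f = cint g.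
Proof. by move=> fg; congr cint; apply/funext. Qed.

Lemma bmeas_cst c : bmeas (fun=> c).
Proof. by split; [exact: measurable_cst|exact: measurable_cst|exists (normc c)]. Qed.

Lemma bmeasD f g : bmeas f -> bmeas g -> bmeas (fun x => f x + g x).
Proof.
move=> [f1 f2 [K fK]] [g1 g2 [L gL]]; split.
- by under eq_fun do rewrite Re_addc; exact: measurable_funD.
- by under eq_fun do rewrite Im_addc; exact: measurable_funD.
exists (K + L) => x; apply: le_trans (normcD _ _) _; exact: lerD.
Qed.

Lemma bmeasM f g : bmeas f -> bmeas g -> bmeas (fun x => f x * g x).
Proof.
move=> [f1 f2 [K fK]] [g1 g2 [L gL]]; split.
- under eq_fun do rewrite Re_mulc; apply: measurable_funB; exact: measurable_funM.
- under eq_fun do rewrite Im_mulc; apply: measurable_funD; exact: measurable_funM.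
by exists (K * L) => x; rewrite normcM ler_pM // normc_ge0.
Qed.

Lemma bmeasZ c f : bmeas f -> bmeas (fun x => c * f x).
Proof. by move=> nf; apply: bmeasM => //; exact: bmeas_cst. Qed.

Lemma bmeasN f : bmeas f -> bmeas (fun x => - f x).
Proof. by move=> nf; under eq_fun do rewrite -mulN1r; exact: bmeasZ. Qed.

Lemma bmeasB f g : bmeas f -> bmeas g -> bmeas (fun x => f x - g x).
Proof. by move=> nf ng; apply: bmeasD => //; exact: bmeasN. Qed.

Lemma bmeas_sum (I : Type) (r : seq I) (P : pred I) (F : I -> T -> R[i]) :
  (forall i, P i -> bmeas (F i)) -> bmeas (fun x => \sum_(i <- r | P i) F i x).
Proof.
move=> nF; elim: r => [|a r IH].
  rewrite (_ : (fun _ => _) = (fun=> 0)); first exact: bmeas_cst.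
  by apply/funext => x; rewrite big_nil.
have [Pa|Pa] := boolP (P a).
  rewrite (_ : (fun _ => _) = fun x => F a x + \sum_(i <- r | P i) F i x).
    by apply: bmeasD => //; exact: nF.
  by apply/funext => x; rewrite big_cons Pa.
rewrite (_ : (fun _ => _) = fun x => \sum_(i <- r | P i) F i x) //.
by apply/funext => x; rewrite big_cons (negbTE Pa).
Qed.

Lemma bmeas_prod (I : Type) (r : seq I) (P : pred I) (F : I -> T -> R[i]) :
  (forall i, P i -> bmeas (F i)) -> bmeas (fun x => \prod_(i <- r | P i) F i x).
Proof.
move=> nF; elim: r => [|a r IH].
  rewrite (_ : (fun _ => _) = (fun=> 1)); first exact: bmeas_cst.
  by apply/funext => x; rewrite big_nil.
have [Pa|Pa] := boolP (P a).
  rewrite (_ : (fun _ => _) = fun x => F a x * \prod_(i <- r | P i) F i x).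
    by apply: bmeasM => //; exact: nF.
  by apply/funext => x; rewrite big_cons Pa.
rewrite (_ : (fun _ => _) = fun x => \prod_(i <- r | P i) F i x) //.
by apply/funext => x; rewrite big_cons (negbTE Pa).
Qed.

Lemma bmeas_real (h : T -> R) (K : R) : measurable_fun setT h ->
  (forall x, `|h x| <= K) -> bmeas (fun x => (h x)%:C).
Proof.
move=> mh hK; split; [exact: mh|exact: measurable_cst|].
by exists K => x; rewrite normc_real.
Qed.

Lemma bounded_integrable (h : T -> R) (K : R) : measurable_fun setT h ->
  (forall x, `|h x| <= K) -> mu.-integrable setT (EFin \o h).
Proof.
move=> mh hK.
have ic : mu.-integrable setT (EFin \o cst K) by exact: finite_measure_integrable_cst.
apply: (le_integrable measurableT _ _ ic) => //; first exact/measurable_EFinP.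
by move=> x _ /=; rewrite lee_fin; apply: le_trans (hK x) _; exact: ler_norm.
Qed.

Lemma bmeas_integrable f : bmeas f ->
  mu.-integrable setT (EFin \o (fun x => complex.Re (f x))) /\
  mu.-integrable setT (EFin \o (fun x => complex.Im (f x))).
Proof.
move=> [f1 f2 [K fK]]; split; apply: (@bounded_integrable _ K) => // x.
  exact: le_trans (Re_le_normc _) (fK x).
exact: le_trans (Im_le_normc _) (fK x).
Qed.

Lemma cintD f g : bmeas f -> bmeas g -> cint (fun x => f x + g x) = cint f + cint g.
Proof.
move=> /bmeas_integrable[f1 f2] /bmeas_integrable[g1 g2].
rewrite /cint; under eq_Rintegral do rewrite Re_addc.
under [X in _ +i* X]eq_Rintegral do rewrite Im_addc.
by rewrite !RintegralD.
Qed.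

Lemma cintZ c f : bmeas f -> cint (fun x => c * f x) = c * cint f.
Proof.
move=> /bmeas_integrable[f1 f2].
have H (a : R) (h : T -> R) : mu.-integrable setT (EFin \o h) ->
    mu.-integrable setT (EFin \o (fun x => a * h x)).
  by move=> ih; exact: (integrableZl measurableT a ih).
rewrite /cint; under eq_Rintegral do rewrite Re_mulc.
under [X in _ +i* X]eq_Rintegral do rewrite Im_mulc.
rewrite RintegralB ?RintegralD ?RintegralZl //; try exact: H.
by case: c.
Qed.

Lemma cint_cst c : cint (fun=> c) = c.
Proof.
rewrite /cint !Rintegral_cst //= probability_setT /= !mulr1.
by case: c.
Qed.

Lemma cint_sum (I : Type) (r : seq I) (P : pred I) (F : I -> T -> R[i]) :
  (forall i, P i -> bmeas (F i)) ->
  cint (fun x => \sum_(i <- r | P i) F i x) = \sum_(i <- r | P i) cint (F i).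
Proof.
move=> nF; elim: r => [|a r IH].
  rewrite big_nil -[RHS](cint_cst 0); congr cint; apply/funext => x.
  by rewrite big_nil.
rewrite big_cons -IH.
case: ifPn => Pa; last first.
  by congr cint; apply/funext => x; rewrite big_cons (negbTE Pa).
rewrite -cintD; [|exact: nF|exact: bmeas_sum].
by congr cint; apply/funext => x; rewrite big_cons Pa.
Qed.

(** The factor 2 comes from bounding real and imaginary parts separately; the
    argument only needs a bound that is uniform in N. *)
Lemma cint_bound f K : bmeas f -> (forall x, normc (f x) <= K) ->
  normc (cint f) <= 2 * K.
Proof.
move=> nf fK; have [i1 i2] := bmeas_integrable nf.
have H (h : T -> R) : mu.-integrable setT (EFin \o h) ->
    (forall x, `|h x| <= K) -> `|\int[mu]_x h x| <= K.
  move=> ih hK; apply: le_trans (le_normr_Rintegral _ ih) _ => //.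
  have -> : K = \int[mu]_x cst K x.
    by rewrite Rintegral_cst //= probability_setT /= mulr1.
  apply: le_Rintegral => //.
  - exact: integrable_norm.
  - exact: finite_measure_integrable_cst.
apply: le_trans (normc_le_ReIm _) _.
rewrite mulrDl mul1r; apply: lerD; apply: H => //= x.
  exact: le_trans (Re_le_normc _) (fK x).
exact: le_trans (Im_le_normc _) (fK x).
Qed.

Lemma cint_invariant (phi : T -> T) f : measurable_fun setT phi ->
  (forall A, measurable A -> mu (phi @^-1` A) = mu A) -> bmeas f ->
  bmeas (fun x => f (phi x)) /\ cint (fun x => f (phi x)) = cint f.
Proof.
move=> mphi inv nf.
have nf' : bmeas (fun x => f (phi x)).
  case: nf => f1 f2 [K fK]; split; last by exists K => x.
    exact: (measurableT_comp f1 mphi).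
  exact: (measurableT_comp f2 mphi).
split => //.
have H (h : T -> R) : measurable_fun setT h ->
    mu.-integrable setT (EFin \o (fun x => h (phi x))) ->
    \int[mu]_x h (phi x) = \int[mu]_x h x.
  move=> mh ih; rewrite /Rintegral; congr fine.
  rewrite -(@integral_pushforward _ _ _ _ _ _ mphi mu setT (EFin \o h)) //.
    by apply: eq_measure_integral => A mA _; rewrite /pushforward; exact: inv.
  exact/measurable_EFinP.
have [i1 i2] := bmeas_integrable nf'; case: nf => f1 f2 _.
rewrite /cint; congr (_ +i* _).
  exact: (H (fun x => complex.Re (f x))).
exact: (H (fun x => complex.Im (f x))).
Qed.

End ComplexIntegral.

(** * First order expansions, uniform in the configuration *)

Section Expansion.
Context {R : realType} {T : Type}.
Implicit Types (F G : R -> T -> R[i]) (f g : T -> R[i]).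

(** [F t] has derivative [f'] at t = 0, with base value [f] and a quadratic
    remainder that is uniform in the configuration.  Stating it this way makes
    the product and exponential rules elementary and allows the expansion to be
    integrated without any theorem on differentiation under the integral.  One
    constant K serves for all bounds and for the range of t. *)
Definition expands F f f' := exists2 K : R, 1 <= K &
  forall t x, 0 <= t -> t * K <= 1 ->
    [/\ normc (f x) <= K, normc (f' x) <= K &
        normc (F t x - f x - t%:C * f' x) <= K * t ^+ 2].

Lemma expands_cst f K : (forall x, normc (f x) <= K) ->
  expands (fun=> f) f (fun=> 0).
Proof.
move=> fK; exists (1 + `|K|); first by rewrite lerDl.
move=> t x t0 _; split.
- by apply: le_trans (fK x) _; apply: le_trans (ler_norm _) _; rewrite lerDr.
- by rewrite normc0 addr_ge0.
- by rewrite subrr mulr0 subr0 normc0 mulr_ge0 ?sqr_ge0 // addr_ge0.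
Qed.

Lemma expandsD F f f' G g g' : expands F f f' -> expands G g g' ->
  expands (fun t x => F t x + G t x) (fun x => f x + g x) (fun x => f' x + g' x).
Proof.
move=> [K K1 HF] [L L1 HG]; exists (K + L); first by lra.
move=> t x t0; rewrite mulrDr => tKL.
have tK0 : 0 <= t * K by rewrite mulr_ge0 //; lra.
have tL0 : 0 <= t * L by rewrite mulr_ge0 //; lra.
have [|f1 f2 f3] := HF t x t0; first by lra.
have [|g1 g2 g3] := HG t x t0; first by lra.
split; try by apply: le_trans (normcD _ _) _; exact: lerD.
rewrite mulrDl; apply: le_trans (lerD f3 g3).
apply: le_trans (normcD _ _); rewrite le_eqVlt; apply/orP; left; apply/eqP.
congr normc; ring.
Qed.

Lemma expandsM F f f' G g g' : expands F f f' -> expands G g g' ->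
  expands (fun t x => F t x * G t x) (fun x => f x * g x)
    (fun x => f' x * g x + f x * g' x).
Proof.
move=> [K K1 HF] [L L1 HG]; exists (4 * K * L + 2 * K + L); first by nra.
move=> t x t0 tM.
have tK0 : 0 <= t * K by rewrite mulr_ge0 //; lra.
have tL0 : 0 <= t * L by rewrite mulr_ge0 //; lra.
have KL : K * 1 <= K * L by rewrite ler_wpM2l //; lra.
have LK : 1 * L <= K * L by rewrite ler_wpM2r //; lra.
have tKL : 0 <= t * (K * L) by rewrite !mulr_ge0 //; lra.
have [|f1 f2 f3] := HF t x t0; first by nra.
have [|g1 g2 g3] := HG t x t0; first by nra.
have t1 : t <= 1 by nra.
have fn := normc_ge0 (f x); have fn' := normc_ge0 (f' x).
have gn := normc_ge0 (g x); have gn' := normc_ge0 (g' x).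
split.
- by rewrite normcM; apply: le_trans (ler_pM fn gn f1 g1) _; nra.
- apply: le_trans (normcD _ _) _; rewrite !normcM.
  have := ler_pM fn' gn f2 g1; have := ler_pM fn gn' f1 g2; nra.
set r := F t x - f x - t%:C * f' x in f3 *.
set s := G t x - g x - t%:C * g' x in g3 *.
have -> : F t x * G t x - f x * g x - t%:C * (f' x * g x + f x * g' x) =
   t%:C * t%:C * (f' x * g' x) + (f x + t%:C * f' x) * s + r * (g x + t%:C * g' x + s).
  rewrite /r /s; ring.
have nt : normc t%:C = t by rewrite normc_real ger0_norm.
have sn := normc_ge0 s; have rn := normc_ge0 r.
have e1 : normc (t%:C * t%:C * (f' x * g' x)) <= t ^+ 2 * (K * L).
  rewrite !normcM nt -expr2 ler_wpM2l ?sqr_ge0 //; exact: ler_pM.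
have e2 : normc ((f x + t%:C * f' x) * s) <= (K + 1) * (L * t ^+ 2).
  rewrite normcM ler_pM ?normc_ge0 //; apply: le_trans (normcD _ _) _.
  rewrite normcM nt; apply: lerD => //.
  by apply: le_trans (ler_wpM2l t0 f2) _; nra.
have tt : t ^+ 2 <= t by rewrite expr2; nra.
have e3 : normc (r * (g x + t%:C * g' x + s)) <= (K * t ^+ 2) * (L + 1 + 1).
  rewrite normcM ler_pM ?normc_ge0 //; apply: le_trans (normcD _ _) _.
  apply: lerD.
    apply: le_trans (normcD _ _) _; rewrite normcM nt; apply: lerD => //.
    by apply: le_trans (ler_wpM2l t0 g2) _; nra.
  by apply: le_trans g3 _; nra.
apply: le_trans (normcD _ _) _.
apply: le_trans (lerD (normcD _ _) (lexx _)) _.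
have t2 := sqr_ge0 t.
apply: le_trans (lerD (lerD e1 e2) e3) _.
have : 0 <= t ^+ 2 * (K * L) by rewrite !mulr_ge0 //; lra.
have : 0 <= t ^+ 2 * K by rewrite !mulr_ge0 //; lra.
lra.
Qed.

Lemma expands_ext F f f' G g g' : (forall t x, F t x = G t x) -> f =1 g ->
  f' =1 g' -> expands F f f' -> expands G g g'.
Proof.
move=> FG fg fg' [K K1 H]; exists K => // t x t0 tK; rewrite -FG -fg -fg'; exact: H.
Qed.

Lemma expands_sum (I : Type) (r : seq I) (F : I -> R -> T -> R[i])
    (f f' : I -> T -> R[i]) :
  (forall i, expands (F i) (f i) (f' i)) ->
  expands (fun t x => \sum_(i <- r) F i t x) (fun x => \sum_(i <- r) f i x)
    (fun x => \sum_(i <- r) f' i x).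
Proof.
move=> HF; elim: r => [|a r IH].
  apply: (@expands_ext (fun=> (fun=> 0)) (fun=> 0) (fun=> 0)).
  - by move=> t x; rewrite big_nil.
  - by move=> x; rewrite big_nil.
  - by move=> x; rewrite big_nil.
  by apply: (@expands_cst _ 0) => x; rewrite normc0.
apply: expands_ext (expandsD (HF a) IH).
- by move=> t x; rewrite big_cons.
- by move=> x; rewrite big_cons.
- by move=> x; rewrite big_cons.
Qed.

(** Both bounds come from 1 + u <= exp u, applied at u and at - u. *)
Lemma expR_quadratic (u : R) : `|u| <= 1/2 -> `|expR u - 1 - u| <= 2 * u ^+ 2.
Proof.
rewrite ler_norml => /andP[u1 u2].
have h1 := expR_ge1Dx u.
have h2 := expR_ge1Dx (- u).
have e0 := expR_gt0 u.
have eN : expR (- u) * expR u = 1 by rewrite mulrC expRxMexpNx_1.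
rewrite ger0_norm; last by lra.
have h3 : (1 - u) * expR u <= 1 by rewrite -[leRHS]eN ler_wpM2r // ltW.
rewrite expr2; nra.
Qed.

(** Write h t = h0 + u: then |u| <= 2 t K, and exp u = 1 + u + O(u ^ 2). *)
Lemma expands_expR (h : R -> T -> R) (h0 : T -> R) (h' : T -> R) :
  expands (fun t x => (h t x)%:C) (fun x => (h0 x)%:C) (fun x => (h' x)%:C) ->
  expands (fun t x => (expR (h t x))%:C) (fun x => (expR (h0 x))%:C)
    (fun x => (h' x)%:C * (expR (h0 x))%:C).
Proof.
move=> [K K1 H]; pose M := expR K * (8 * K ^+ 2 + K) + 4 * K.
have eK : 1 <= expR K.
  by apply: le_trans (expR_ge1Dx K); lra.
have K2 : K <= K ^+ 2 by rewrite expr2; nra.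
have eM : expR K * K <= expR K * (8 * K ^+ 2 + K).
  by apply: ler_wpM2l; [lra|nra].
exists M; first by rewrite /M; nra.
move=> t x t0 tM.
have tK0 : 0 <= t * K by rewrite mulr_ge0 //; lra.
have te : 0 <= t * (expR K * (8 * K ^+ 2 + K)) by rewrite !mulr_ge0 //; nra.
have tK4 : 4 * (t * K) <= 1 by move: tM; rewrite /M mulrDr; lra.
have [|f1 f2 f3] := H t x t0; first by lra.
rewrite !normc_real in f1 f2.
have e0K : expR (h0 x) <= expR K by rewrite ler_expR; apply: le_trans (ler_norm _) f1.
have e0 := expR_gt0 (h0 x).
split.
- by rewrite normc_real gtr0_norm // /M; nra.
- rewrite normcM !normc_real (gtr0_norm e0).
  apply: le_trans (ler_pM (normr_ge0 _) (ltW e0) f2 e0K) _.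
  by rewrite /M; lra.
pose u := h t x - h0 x.
have uE : h t x = h0 x + u by rewrite /u; ring.
have f3' : `|u - t * h' x| <= K * t ^+ 2.
  by move: f3; rewrite -rmorphB -rmorphM -rmorphB normc_real.
have ub : `|u| <= 2 * (t * K).
  have -> : u = (u - t * h' x) + t * h' x by ring.
  apply: le_trans (ler_normD _ _) _; rewrite normrM (ger0_norm t0).
  have := ler_wpM2l t0 f2.
  have : K * t ^+ 2 <= t * K by rewrite expr2; nra.
  lra.
have q := expR_quadratic (le_trans ub _ : `|u| <= 1/2).
have {q} q : `|expR u - 1 - u| <= 2 * u ^+ 2 by apply: q; lra.
have -> : (expR (h t x))%:C - (expR (h0 x))%:C - t%:C * ((h' x)%:C * (expR (h0 x))%:C)
  = (expR (h0 x) * ((expR u - 1 - u) + (u - t * h' x)))%:C.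
  by rewrite -!rmorphM -!rmorphB uE expRD; congr (_%:C); ring.
rewrite normc_real normrM (gtr0_norm e0).
have u2 : u ^+ 2 <= 4 * K ^+ 2 * t ^+ 2.
  rewrite -real_normK ?num_real //.
  have -> : 4 * K ^+ 2 * t ^+ 2 = (2 * (t * K)) ^+ 2 by ring.
  by rewrite lerXn2r // nnegrE //; lra.
have b : `|(expR u - 1 - u) + (u - t * h' x)| <= (8 * K ^+ 2 + K) * t ^+ 2.
  by apply: le_trans (ler_normD _ _) _; lra.
apply: le_trans (ler_pM (ltW e0) (normr_ge0 _) e0K b) _.
rewrite mulrA /M [leRHS]mulrDl lerDl !mulr_ge0 ?sqr_ge0 //; lra.
Qed.

End Expansion.

(** If the integral of [F t] does not depend on t then t times the integral of
    [f'] is the integral of a remainder of size t ^ 2, for all small t. *)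
Lemma derivative_integral0 d (T : measurableType d) (R : realType)
    (mu : probability T R) (F : R -> T -> R[i]) (f f' : T -> R[i]) :
  expands F f f' -> bmeas f -> bmeas f' ->
  (forall t, bmeas (F t) /\ cint mu (F t) = cint mu f) -> cint mu f' = 0.
Proof.
move=> [K K1 H] nf nf' nF.
have bd t : 0 < t -> t * K <= 1 -> normc (cint mu f') <= 2 * K * t.
  move=> t0 tK; have [nFt cFt] := nF t.
  have nr : bmeas (fun x => F t x - f x - t%:C * f' x).
    by apply: bmeasB; [exact: bmeasB|exact: bmeasZ].
  have := @cint_bound _ _ _ mu _ (K * t ^+ 2) nr.
  have -> : cint mu (fun x => F t x - f x - t%:C * f' x) = - (t%:C * cint mu f').
    have E : (fun x => F t x - f x - t%:C * f' x) =
        (fun x => (F t x + (-1) * f x) + (- t%:C) * f' x).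
      by apply/funext => x; ring.
    rewrite E cintD ?cintD ?cintZ ?cFt //; try by ring.
    - exact: bmeasZ.
    - by apply: bmeasD => //; exact: bmeasZ.
    - exact: bmeasZ.
  rewrite normcN normcM normc_real gtr0_norm // => B.
  have {B} := B (fun x => let: And3 _ _ h := H t x (ltW t0) tK in h).
  have -> : 2 * (K * t ^+ 2) = t * (2 * K * t) by ring.
  by rewrite ler_pM2l.
apply: eq0_normc; apply/eqP; rewrite eq_le normc_ge0 andbT.
apply/ler_addgt0Pr => e e0; rewrite add0r.
have K0 : 0 < K by lra.
pose t := Num.min K^-1 (e / (2 * K)).
have t0 : 0 < t by rewrite lt_min invr_gt0 K0 divr_gt0 // mulr_gt0.
have t1 : t * K <= 1 by rewrite -ler_pdivlMr // mul1r ge_min lexx.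
apply: le_trans (bd t t0 t1) _.
have : t <= e / (2 * K) by rewrite ge_min lexx orbT.
by rewrite ler_pdivlMr ?mulr_gt0 // mulrC.
Qed.

(** * Words of edges *)

Section Words.
Context {d : nat}.
Implicit Types (e f : edge d) (w v : seq (edge d)).

(** All ways of writing w = pre ++ e :: post, as triples (pre, e, post).  Sums
    over positions of a letter become sums over this list, which needs no index
    and no default letter. *)
Fixpoint splits w : seq (seq (edge d) * edge d * seq (edge d)) :=
  if w is e :: w' then
    ([::], e, w') :: [seq (e :: x.1.1, x.1.2, x.2) | x <- splits w']
  else [::].

Definition invw w := rev [seq rev_edge e | e <- w].

Lemma rev_edgeK : involutive (@rev_edge d).
Proof. by case. Qed.

Lemma invw_cons e w : invw (e :: w) = rcons (invw w) (rev_edge e).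
Proof. by rewrite /invw /= rev_cons. Qed.

Lemma invw_cat v w : invw (v ++ w) = invw w ++ invw v.
Proof. by rewrite /invw map_cat rev_cat. Qed.

Lemma invwK : involutive invw.
Proof.
move=> w; rewrite /invw map_rev revK -map_comp -[RHS]map_id.
by apply: eq_map => e /=; rewrite rev_edgeK.
Qed.

Lemma size_invw w : size (invw w) = size w.
Proof. by rewrite size_rev size_map. Qed.

Lemma size_splits w : size (splits w) = size w.
Proof. by elim: w => //= e w <-; rewrite size_map. Qed.

Lemma splitsP w x : x \in splits w -> w = x.1.1 ++ x.1.2 :: x.2.
Proof.
elim: w x => //= e w IH x; rewrite inE => /orP[/eqP ->//|].
by move=> /mapP[y /IH {1}-> ->].
Qed.

Lemma splits_rcons w e : splits (rcons w e) =
  rcons [seq (x.1.1, x.1.2, rcons x.2 e) | x <- splits w] (w, e, [::]).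
Proof.
elim: w => //= a w ->; rewrite map_rcons /=; congr (_ :: rcons _ _).
by rewrite -!map_comp; apply: eq_map.
Qed.

(** Reversing a word exchanges the two sides of each cut and inverts the letter:
    this is what turns a sum over an inverse plaquette into a sum over the
    plaquette itself. *)
Lemma splits_invw w : splits (invw w) =
  rev [seq (invw x.2, rev_edge x.1.2, invw x.1.1) | x <- splits w].
Proof.
elim: w => //= e w IH; rewrite invw_cons splits_rcons rev_cons IH.
rewrite map_rev -!map_comp; congr (rcons (rev _) _); apply: eq_map => -[[a b] c] /=.
by rewrite invw_cons.
Qed.

Lemma sum_splits_size (V : nmodType) w (F : nat -> nat -> V) :
  \sum_(x <- splits w) F (size x.1.1) (size x.2) =
  \sum_(j < size w) F j (size w - j.+1)%N.
Proof.
elim: w F => [|e w IH] F /=; first by rewrite big_nil big_ord0.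
rewrite big_cons big_map big_ord_recl /= subn1 /=; congr (_ + _).
exact: (IH (fun a b => F a.+1 b)).
Qed.

End Words.

(** * Holonomies and their variation *)

Section Holonomy.
Context {d : nat} {R : realType} {N : nat}.
Local Notation C := R[i].
Local Notation M := 'M[C]_N.
Implicit Types (m dm : edge d -> M) (e f : edge d) (w v b : seq (edge d)).

Definition hol m w : M := foldr (fun e A => m e *m A) 1%:M w.

(** The derivative of [hol] when the letter e varies with speed [dm e]. *)
Fixpoint dhol m dm w : M :=
  if w is e :: w' then dm e *m hol m w' + m e *m dhol m dm w' else 0.

Definition adj (A : M) : M := (A ^t*)%sesqui.

Lemma adjE A i j : adj A i j = (A j i)^*.
Proof. by rewrite /adj !mxE. Qed.

Lemma adjM A B : adj (A *m B) = adj B *m adj A.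
Proof. by rewrite /adj trmx_mul map_mxM. Qed.

Lemma adjD A B : adj (A + B) = adj A + adj B.
Proof. by rewrite /adj raddfD /= map_mxD. Qed.

Lemma adj_one : adj 1%:M = 1%:M.
Proof. by rewrite /adj trmx1 map_mx1. Qed.

Lemma adj_zero : adj 0 = 0.
Proof. by rewrite /adj trmx0 map_mx0. Qed.

Lemma tr_adj A : \tr (adj A) = (\tr A)^*.
Proof.
rewrite /mxtrace rmorph_sum; apply: eq_bigr => i _; rewrite !mxE.
by [].
Qed.

Lemma hol_cat m v w : hol m (v ++ w) = hol m v *m hol m w.
Proof. by elim: v => [|e v IH] /=; rewrite ?mul1mx // IH mulmxA. Qed.

Lemma hol_rcons m w e : hol m (rcons w e) = hol m w *m m e.
Proof. by rewrite -cats1 hol_cat /= mulmx1. Qed.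

Lemma trace_holC m v w : \tr (hol m (v ++ w)) = \tr (hol m (w ++ v)).
Proof. by rewrite !hol_cat mxtrace_mulC. Qed.

Lemma dhol_splits m dm w : dhol m dm w =
  \sum_(x <- splits w) hol m x.1.1 *m dm x.1.2 *m hol m x.2.
Proof.
elim: w => [|e w IH] /=; first by rewrite big_nil.
rewrite big_cons big_map /= mul1mx IH mulmx_sumr; congr (_ + _).
by apply: eq_bigr => x _; rewrite !mulmxA.
Qed.

Lemma dhol_cat m dm v w :
  dhol m dm (v ++ w) = dhol m dm v *m hol m w + hol m v *m dhol m dm w.
Proof.
elim: v => [|e v IH] /=; first by rewrite mul0mx mul1mx add0r.
by rewrite IH hol_cat !mulmxDl !mulmxDr !mulmxA addrA.
Qed.

Lemma hol_invw_adj m w : (forall e, m (rev_edge e) = adj (m e)) ->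
  hol m (invw w) = adj (hol m w).
Proof.
move=> mV; elim: w => [|e w IH]; first by rewrite /= adj_one.
by rewrite invw_cons hol_rcons IH mV /= adjM.
Qed.

(** When inverse letters carry adjoint matrices, the derivatives along a word and
    along its inverse are adjoint to each other, so that the derivative of the
    real part of a trace is half the sum of the two. *)
Lemma dhol_invw_adj m dm w : (forall e, m (rev_edge e) = adj (m e)) ->
  (forall e, dm (rev_edge e) = adj (dm e)) ->
  dhol m dm (invw w) = adj (dhol m dm w).
Proof.
move=> mV dmV; elim: w => [|e w IH]; first by rewrite /= adj_zero.
rewrite invw_cons -cats1 dhol_cat IH /= mulmx0 addr0 mulmx1 adjD !adjM.
by rewrite mulmx1 (hol_invw_adj _ mV) mV dmV addrC.
Qed.

End Holonomy.

Section Variation.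
Context {d : nat} {R : realType} {N : nat}.
Local Notation M := 'M[R[i]]_N.
Variables (m : edge d -> M) (f : edge d).
Hypothesis mV : forall e, m e *m m (rev_edge e) = 1%:M.
Implicit Types (X A B : M) (b w p : seq (edge d)).

(** The velocity of the matrix of the letter f when the link variable of its
    positively oriented edge is multiplied on the left by a curve tangent to X:
    X A if f is positive, - A X if f is the reversed edge.  With this convention
    both orientations satisfy the same identities, because the flip part of the
    Casimir tensor does not see on which side X is inserted. *)
Definition lvar X A : M := if pos_edge f then X *m A else - (A *m X).

(** The velocity of every letter, expressed through that of f; the formula for
    the inverse letter is the derivative of the matrix inverse. *)
Definition link_var X (e : edge d) : M :=
  if e == f then lvar X (m f)
  else if e == rev_edge f then - (m (rev_edge f) *m lvar X (m f) *m m (rev_edge f))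
  else 0.

Context {K : finType} (c : K -> R[i]) (X : K -> M) (R1 : M -> M)
  (R2 : M -> M -> R[i]).
Hypothesis casimir1 : forall A,
  \sum_k c k *: (X k *m A *m X k) = R1 A - (\tr A)%:M.
Hypothesis casimir2 : forall A B,
  \sum_k c k * (\tr (X k *m A) * \tr (X k *m B)) = R2 A B - \tr (A *m B).

Local Notation U := (m f).
Local Notation V := (m (rev_edge f)).

Let VU : V *m U = 1%:M.
Proof. by have := mV (rev_edge f); rewrite rev_edgeK. Qed.

(** Contributions of the remainders R1 and R2 of the two contracted forms of the
    Casimir tensor; they are of order N, one order below the flip. *)
Definition rho1 A B : R[i] :=
  if pos_edge f then \tr (R1 (U *m A) *m (U *m B))
  else \tr (R1 (A *m U) *m (B *m U)).
Definition rho2 A B : R[i] :=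
  if pos_edge f then R2 (U *m A) (U *m B) else R2 (A *m U) (B *m U).

Lemma casimir1_tr A B : \sum_k c k * \tr (X k *m A *m X k *m B) =
  \tr (R1 A *m B) - \tr A * \tr B.
Proof.
transitivity (\tr ((\sum_k c k *: (X k *m A *m X k)) *m B)).
  rewrite mulmx_suml raddf_sum /=; apply: eq_bigr => k _.
  by rewrite -scalemxAl linearZ.
by rewrite casimir1 mulmxBl raddfB /= mul_scalar_mx linearZ.
Qed.

Lemma lvar2_sum A B : \sum_k c k * \tr (lvar (X k) U *m A *m lvar (X k) U *m B)
  = rho1 A B - \tr (U *m A) * \tr (U *m B).
Proof.
rewrite /lvar /rho1; case: ifP => _.
  by rewrite -casimir1_tr; apply: eq_bigr => k _; rewrite !mulmxA.
rewrite (mxtrace_mulC U A) (mxtrace_mulC U B) -casimir1_tr.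
apply: eq_bigr => k _; congr (_ * _).
rewrite !mulNmx mulmxN mulNmx opprK -!mulmxA mxtrace_mulC !mulmxA.
by rewrite -!mulmxA mulmxA.
Qed.

Lemma lvar_sum A B : \sum_k c k * (\tr (lvar (X k) U *m A) * \tr (lvar (X k) U *m B))
  = rho2 A B - \tr (U *m A *m U *m B).
Proof.
rewrite /lvar /rho2; case: ifP => _.
  by rewrite -!mulmxA (mulmxA U) -casimir2; apply: eq_bigr => k _; rewrite !mulmxA.
have -> : \tr (U *m A *m U *m B) = \tr ((A *m U) *m (B *m U)).
  by rewrite -!mulmxA mxtrace_mulC !mulmxA.
rewrite -casimir2; apply: eq_bigr => k _; congr (_ * _).
rewrite !mulNmx !raddfN /= mulrNN.
by rewrite -!(mulmxA U) !(mxtrace_mulC U) !mulmxA.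
Qed.

(** The Casimir operator acts on the fundamental representation as the scalar
    r - N. *)
Lemma lvar_lvar_sum r B : R1 1%:M = r%:M ->
  \sum_k c k * \tr (lvar (X k) (lvar (X k) U) *m B) = (r - N%:R) * \tr (U *m B).
Proof.
move=> R11; have E : \sum_k c k *: (X k *m X k) = (r - N%:R)%:M.
  transitivity (\sum_k c k *: (X k *m 1%:M *m X k)).
    by apply: eq_bigr => k _; rewrite mulmx1.
  by rewrite casimir1 R11 mxtrace1 raddfB.
rewrite /lvar; case: (pos_edge f).
  transitivity (\tr ((\sum_k c k *: (X k *m X k)) *m (U *m B))).
    rewrite mulmx_suml raddf_sum /=; apply: eq_bigr => k _.
    by rewrite -scalemxAl linearZ /= !mulmxA.
  by rewrite E mul_scalar_mx linearZ.
transitivity (\tr (U *m (\sum_k c k *: (X k *m X k)) *m B)); last first.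
  by rewrite E mul_mx_scalar -scalemxAl linearZ.
rewrite mulmx_sumr mulmx_suml raddf_sum /=; apply: eq_bigr => k _.
by rewrite -scalemxAr -scalemxAl linearZ /= !(mulNmx, mulmxN) !opprK !mulmxA.
Qed.

(** Variation of a letter of the word itself.  An occurrence of f cuts the word
    into two words that both start with f; at an occurrence of f^-1 the two
    copies of f and f^-1 cancel and leave the two pieces between them. *)
Lemma splitting_sum b :
  \sum_k c k * \tr (lvar (X k) U *m dhol m (link_var (X k)) b) =
  \sum_(x <- splits b)
    if x.1.2 == f then rho1 (hol m x.1.1) (hol m x.2)
       - \tr (hol m (f :: x.1.1)) * \tr (hol m (f :: x.2))
    else if x.1.2 == rev_edge f then
      \tr (hol m x.1.1) * \tr (hol m x.2) - rho1 (hol m x.1.1 *m V) (V *m hol m x.2)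
    else 0.
Proof.
under eq_bigr do rewrite dhol_splits mulmx_sumr raddf_sum mulr_sumr.
rewrite exchange_big /=; apply: eq_bigr => -[[pre e] post] _ /=.
rewrite /link_var; have [_|_] := eqVneq e f.
  by rewrite -lvar2_sum; apply: eq_bigr => k _; rewrite !mulmxA.
have [_|_] := eqVneq e (rev_edge f); last first.
  by rewrite big1 // => k _; rewrite mulmx0 mul0mx mulmx0 raddf0 mulr0.
have -> : \tr (hol m pre) = \tr (U *m (hol m pre *m V)).
  by rewrite mulmxA mxtrace_mulC mulmxA VU mul1mx.
have -> : \tr (hol m post) = \tr (U *m (V *m hol m post)).
  by rewrite mulmxA mV mul1mx.
rewrite -[RHS]opprB -lvar2_sum -sumrN; apply: eq_bigr => k _.
by rewrite mulmxN mulNmx mulmxN raddfN mulrN !mulmxA.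
Qed.

(** Variation of a letter of another word p: the flip joins the two traces into
    one, along the occurrence of f or f^-1. *)
Lemma merging_sum b p :
  \sum_k c k * (\tr (lvar (X k) U *m hol m b) * \tr (dhol m (link_var (X k)) p)) =
  \sum_(x <- splits p)
    if x.1.2 == f then rho2 (hol m b) (hol m (x.2 ++ x.1.1))
       - \tr (hol m ((f :: b) ++ f :: x.2 ++ x.1.1))
    else if x.1.2 == rev_edge f then
      \tr (hol m (b ++ x.2 ++ x.1.1)) - rho2 (hol m b) (V *m hol m (x.2 ++ x.1.1) *m V)
    else 0.
Proof.
under eq_bigr do rewrite dhol_splits raddf_sum mulr_sumr mulr_sumr.
rewrite exchange_big /=; apply: eq_bigr => -[[pre e] post] _ /=.
rewrite /link_var; have [_|_] := eqVneq e f.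
  have -> : \tr (U *m hol m (b ++ f :: post ++ pre)) = \tr (U *m hol m b *m U *m hol m (post ++ pre)).
    by rewrite hol_cat /= !mulmxA.
  rewrite -lvar_sum; apply: eq_bigr => k _; congr (_ * (_ * _)).
  by rewrite -mulmxA mxtrace_mulC -mulmxA -hol_cat.
have [_|_] := eqVneq e (rev_edge f); last first.
  by rewrite big1 // => k _; rewrite mulmx0 mul0mx raddf0 !mulr0.
have -> : \tr (hol m (b ++ post ++ pre)) =
    \tr (U *m hol m b *m U *m (V *m hol m (post ++ pre) *m V)).
  rewrite !mulmxA -(mulmxA _ U V) mV mulmx1 mxtrace_mulC !mulmxA.
  by rewrite VU mul1mx -hol_cat.
rewrite -[RHS]opprB -lvar_sum -sumrN; apply: eq_bigr => k _.
rewrite mulmxN mulNmx raddfN /= !mulrN; congr (- (_ * (_ * _))).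
transitivity (\tr (V *m lvar (X k) U *m V *m (hol m post *m hol m pre))).
  by rewrite -mulmxA mxtrace_mulC !mulmxA.
by rewrite -hol_cat -!mulmxA mxtrace_mulC !mulmxA.
Qed.

End Variation.

(** * Matrix valued observables *)

Section MatrixFunctions.
Context {R : realType} {N : nat}.
Local Notation M := 'M[R[i]]_N.

Section MatrixExpansion.
Context {T : Type}.
Implicit Types (F G : R -> T -> M) (f g : T -> M).

Definition mexpands F f f' := forall i j,
  expands (fun t x => F t x i j) (fun x => f x i j) (fun x => f' x i j).

Lemma mexpandsM F f f' G g g' : mexpands F f f' -> mexpands G g g' ->
  mexpands (fun t x => F t x *m G t x) (fun x => f x *m g x)
    (fun x => f' x *m g x + f x *m g' x).
Proof.
move=> HF HG i j.
apply: (expands_ext _ _ _ (expands_sum (index_enum 'I_N)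
   (fun k => expandsM (HF i k) (HG k j)))).
- by move=> t x; rewrite mxE.
- by move=> x; rewrite mxE.
- by move=> x; rewrite !mxE -big_split.
Qed.

Lemma mexpands_tr F f f' : mexpands F f f' ->
  expands (fun t x => \tr (F t x)) (fun x => \tr (f x)) (fun x => \tr (f' x)).
Proof. by move=> HF; exact: (expands_sum _ (fun k => HF k k)). Qed.

Lemma mexpands_ext F f f' G g g' : (forall t x, F t x = G t x) -> f =1 g ->
  f' =1 g' -> mexpands F f f' -> mexpands G g g'.
Proof.
move=> FG fg fg' H i j; apply: expands_ext (H i j).
- by move=> t x; rewrite FG.
- by move=> x; rewrite fg.
- by move=> x; rewrite fg'.
Qed.

Lemma mexpands_cst f K : (forall x i j, normc (f x i j) <= K) ->
  mexpands (fun=> f) f (fun=> 0).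
Proof.
move=> fK i j; apply: expands_ext (@expands_cst _ _ (fun x => f x i j) K _) => //.
by move=> x; rewrite mxE.
Qed.

Lemma mexpands_hol d (m : R -> T -> edge d -> M) (m0 dm : T -> edge d -> M) w :
  (forall e, mexpands (fun t x => m t x e) (fun x => m0 x e) (fun x => dm x e)) ->
  mexpands (fun t x => hol (m t x) w) (fun x => hol (m0 x) w)
    (fun x => dhol (m0 x) (dm x) w).
Proof.
move=> H; elim: w => [|e w IH] /=; last exact: mexpandsM.
apply: (@mexpands_cst (fun=> 1%:M) 1) => _ i j; rewrite mxE.
by case: eqP => _; rewrite ?normc1 ?normc0.
Qed.

Lemma expands_Re (F : R -> T -> R[i]) (f f' : T -> R[i]) : expands F f f' ->
  expands (fun t x => (complex.Re (F t x))%:C) (fun x => (complex.Re (f x))%:C)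
    (fun x => (complex.Re (f' x))%:C).
Proof.
move=> [K K1 H]; exists K => // t x t0 tK; have [h1 h2 h3] := H t x t0 tK.
split; rewrite ?normc_real; try by apply: le_trans (Re_le_normc _) _.
apply: le_trans h3; rewrite -!rmorphM -!rmorphB normc_real.
apply: le_trans (Re_le_normc _); rewrite le_eqVlt; apply/orP; left; apply/eqP.
congr `|_|; case: (F t x) (f x) (f' x) => [a a'] [b b'] [e e'] /=.
by rewrite mul0r subr0.
Qed.

End MatrixExpansion.

Section MatrixMeasurable.
Context {d : measure_display} {T : measurableType d}.
Implicit Types (f g : T -> M).

Definition mbmeas f := forall i j, @bmeas _ _ R (fun x => f x i j).

Lemma mbmeasM f g : mbmeas f -> mbmeas g -> mbmeas (fun x => f x *m g x).
Proof.
move=> nf ng i j; rewrite (_ : (fun _ => _) = fun x => \sum_k f x i k * g x k j).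
  by apply: bmeas_sum => k _; exact: bmeasM.
by apply/funext => x; rewrite mxE.
Qed.

Lemma mbmeasD f g : mbmeas f -> mbmeas g -> mbmeas (fun x => f x + g x).
Proof.
move=> nf ng i j; rewrite (_ : (fun _ => _) = fun x => f x i j + g x i j).
  exact: bmeasD.
by apply/funext => x; rewrite mxE.
Qed.

Lemma mbmeasN f : mbmeas f -> mbmeas (fun x => - f x).
Proof.
move=> nf i j; rewrite (_ : (fun _ => _) = fun x => - (f x i j)).
  exact: bmeasN.
by apply/funext => x; rewrite mxE.
Qed.

Lemma mbmeas_cst (A : M) : mbmeas (fun=> A).
Proof. by move=> i j; exact: bmeas_cst. Qed.

Lemma mbmeas_adj f : mbmeas f -> mbmeas (fun x => adj (f x)).
Proof.
move=> nf i j; have [h1 h2 h3] := nf j i.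
have E x : adj (f x) i j = (f x j i)^* by exact: adjE.
have Re_conj (z : R[i]) : complex.Re z^* = complex.Re z by case: z.
have Im_conj (z : R[i]) : complex.Im z^* = - complex.Im z by case: z.
split.
- by apply: eq_measurable_fun h1 => x _; rewrite E Re_conj.
- apply: (@eq_measurable_fun _ _ _ _ _ (fun x => - complex.Im (f x j i))).
    by move=> x _; rewrite E Im_conj.
  exact: measurableT_comp.
- by case: h3 => K hK; exists K => x; rewrite E normc_conj.
Qed.

Lemma bmeas_tr f : mbmeas f -> bmeas (fun x => \tr (f x)).
Proof. by move=> nf; apply: bmeas_sum => k _; exact: nf. Qed.

Lemma mbmeas_hol d' (m : T -> edge d' -> M) w :
  (forall e, mbmeas (fun x => m x e)) -> mbmeas (fun x => hol (m x) w).
Proof.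
move=> H; elim: w => [|e w IH] /=; first exact: mbmeas_cst.
exact: mbmeasM.
Qed.

Lemma mbmeas_dhol d' (m dm : T -> edge d' -> M) w :
  (forall e, mbmeas (fun x => m x e)) -> (forall e, mbmeas (fun x => dm x e)) ->
  mbmeas (fun x => dhol (m x) (dm x) w).
Proof.
move=> H H'; elim: w => [|e w IH] /=; first exact: mbmeas_cst.
by apply: mbmeasD; apply: mbmeasM => //; exact: mbmeas_hol.
Qed.

Lemma mbmeas_lvar d' (f : edge d') X (g : T -> M) :
  mbmeas g -> mbmeas (fun x => lvar f X (g x)).
Proof.
move=> ng; rewrite /lvar; case: (pos_edge f).
  by apply: mbmeasM => //; exact: mbmeas_cst.
by apply: mbmeasN; apply: mbmeasM => //; exact: mbmeas_cst.
Qed.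

Lemma mbmeas_link_var d' (f : edge d') X (m : T -> edge d' -> M) e :
  (forall e, mbmeas (fun x => m x e)) -> mbmeas (fun x => link_var (m x) f X e).
Proof.
move=> H; rewrite /link_var; case: (e == f); first exact: mbmeas_lvar.
case: (e == rev_edge f); last exact: mbmeas_cst.
by apply: mbmeasN; apply: mbmeasM => //; apply: mbmeasM => //; exact: mbmeas_lvar.
Qed.

End MatrixMeasurable.

End MatrixFunctions.

Section UnitaryBounds.
Context {R : realType} {N : nat} {G : unitary_group R N}.
Implicit Types x y : uelt G.

Lemma val_mulg x y : \val (x * y)%g = \val x *m \val y.
Proof. by []. Qed.

Lemma val_invg x : \val (x^-1)%g = adj (\val x).
Proof. by []. Qed.

Lemma unitary_entry (A : 'M[R[i]]_N) i j : A \is unitarymx -> normc (A i j) <= 1.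
Proof.
move=> /unitarymxP /matrixP /(_ i i); rewrite !mxE eqxx /= => H.
have {}H : \sum_k (normc (A i k)) ^+ 2 = 1.
  apply: (@complexI R); rewrite rmorph_sum rmorph1 -[RHS]H.
  apply: eq_bigr => k _; rewrite !mxE rmorphXn /= -normcEn.
  by rewrite normCK.
rewrite -(@ler_pXn2r _ 2) ?nnegrE ?normc_ge0 // expr1n -H (bigD1 j) //=.
by rewrite lerDl sumr_ge0 // => k _; exact: sqr_ge0.
Qed.

Lemma uelt_unitary x : \val x \is unitarymx.
Proof. exact: (ug_unitary (set_mem (valP x))). Qed.

Lemma uelt_entry x i j : normc (\val x i j) <= 1.
Proof. exact/unitary_entry/uelt_unitary. Qed.

Lemma normc_tr_unitary (A : 'M[R[i]]_N) : A \is unitarymx -> normc (\tr A) <= N%:R.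
Proof.
move=> uA; apply: le_trans (normc_sum _ _ _) _.
apply: le_trans (ler_sum _ (fun i _ => unitary_entry i i uA)) _.
by rewrite sumr_const card_ord.
Qed.

End UnitaryBounds.

(** * Link variables of a configuration *)

Section Links.
Context {R : realType} {d N : nat} {G : unitary_group R N}.
Context {L : {fset site d}}.
Implicit Types (Q : config G L) (e f : edge d) (w b : seq (edge d)).
Local Notation M := 'M[R[i]]_N.

Lemma pos_edgesP e : (e \in pos_edges L) = [&& edge_in L e, is_edge e & pos_edge e].
Proof.
by rewrite !inE /= /edge_in.
Qed.

Lemma pos_edge_rev e : pos_edge e -> ~~ pos_edge (rev_edge e).
Proof. by rewrite /pos_edge /= => h; rewrite -leNgt ltW. Qed.

Lemma pos_edges_rev e : e \in pos_edges L -> rev_edge e \notin pos_edges L.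
Proof.
rewrite !pos_edgesP => /and3P[_ _ /pos_edge_rev h]; apply/negP => /and3P[_ _].
exact/negP.
Qed.

(** This also holds for edges outside the volume, whose link variable is 1. *)
Lemma link_rev Q e : link Q (rev_edge e) = ((link Q e)^-1)%g.
Proof.
have ns x : x \notin pos_edges L ->
    nth 1%g Q (index x (enum_fset (pos_edges L))) = 1%g.
  by move=> h; rewrite nth_default // size_tuple leqNgt index_mem.
rewrite /link rev_edgeK; case: ifPn => h.
  by have := pos_edges_rev h; rewrite rev_edgeK => /negbTE ->; rewrite invgK.
by case: ifPn => h' //; rewrite !ns // !invg1.
Qed.

Definition mlink Q e : M := \val (link Q e).

Lemma mlink_adj Q e : mlink Q (rev_edge e) = adj (mlink Q e).
Proof. by rewrite /mlink link_rev val_invg. Qed.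

Lemma mlinkV Q e : mlink Q e *m mlink Q (rev_edge e) = 1%:M.
Proof. by rewrite /mlink link_rev -val_mulg mulgV. Qed.

Lemma hol_holonomy Q w : hol (mlink Q) w = \val (holonomy Q w).
Proof.
elim: w => [|e w IH]; first by rewrite /holonomy big_nil.
by rewrite /= IH /holonomy big_cons val_mulg.
Qed.

Lemma wilson_hol Q l : wilson Q l = \tr (hol (mlink Q) (\val (repr l))).
Proof. by rewrite hol_holonomy. Qed.

Lemma hol_in_group Q w : ugset G (hol (mlink Q) w).
Proof. rewrite hol_holonomy; exact: (set_mem (valP _)). Qed.

Lemma normc_tr_hol Q w : normc (\tr (hol (mlink Q) w)) <= N%:R.
Proof. exact/normc_tr_unitary/ug_unitary/hol_in_group. Qed.

Lemma mbmeas_mlink e : mbmeas (fun Q => mlink Q e).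
Proof.
have coord (k : nat) : mbmeas (fun Q => \val (nth 1%g Q k)).
  move=> i j; have [kn|nk] := ltnP k #|` pos_edges L|; last first.
    rewrite (_ : (fun _ => _) = fun=> (1%:M : M) i j); first exact: bmeas_cst.
    by apply/funext => Q; rewrite nth_default // size_tuple.
  rewrite (_ : (fun _ => _) = fun Q => \val (tnth Q (Ordinal kn)) i j); last first.
    by apply/funext => Q; rewrite (tnth_nth 1%g).
  split.
  - exact: (measurableT_comp (measurable_Re_entry i j) (measurable_tnth _)).
  - exact: (measurableT_comp (measurable_Im_entry i j) (measurable_tnth _)).
  - by exists 1 => Q; exact: uelt_entry.
rewrite /mlink /link; case: (e \in pos_edges L); first exact: coord.
have coordV (X : config G L -> uelt G) :
    mbmeas (fun Q => \val (X Q)) -> mbmeas (fun Q => \val ((X Q)^-1)%g).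
  by move=> H; exact: (mbmeas_adj H).
exact: (coordV (fun Q => nth 1%g Q _) (coord _)).
Qed.

Lemma link_tshift Q a g e : a \in pos_edges L ->
  link (tshift (index a (enum_fset (pos_edges L))) g Q : config G L) e =
  if e == a then (g * link Q e)%g
  else if e == rev_edge a then (link Q e * g^-1)%g else link Q e.
Proof.
move=> aL; set k := index a _; have ak : (k < #|` pos_edges L|)%N by rewrite index_mem.
have nE x : nth 1%g (tshift k g Q) (index x (enum_fset (pos_edges L))) =
    if x == a then (g * nth 1 Q (index x (enum_fset (pos_edges L))))%g
    else nth 1%g Q (index x (enum_fset (pos_edges L))).
  (* Edges outside the volume read past the end of the tuple, where the default
     value 1 is not affected by the shift. *)
  have [xL|xL] := boolP (x \in pos_edges L); last first.
    have sz : (#|` pos_edges L| <= index x (enum_fset (pos_edges L)))%N by rewrite leqNgt index_mem.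
    rewrite (@nth_default _ _ Q) ?size_tuple // (@nth_default _ _ (tshift k g Q)) ?size_tuple //.
    by case: eqP => // xa; rewrite xa aL in xL.
  have xk : (index x (enum_fset (pos_edges L)) < #|` pos_edges L|)%N by rewrite index_mem.
  have := tnth_nth 1%g (tshift k g Q) (Ordinal xk); rewrite /= => <-.
  have := tnth_nth 1%g Q (Ordinal xk); rewrite /= => <-.
  rewrite tnth_mktuple /=.
  have -> : (index x (enum_fset (pos_edges L)) == k) = (x == a); last by [].
  apply/eqP/eqP => [|-> //].
  by rewrite /k => /(congr1 (nth a (enum_fset (pos_edges L)))); rewrite !nth_index.
rewrite /link !nE; case: ifPn => eL.
  case: eqP => // _; case: eqP => // er.
  by move: eL; rewrite er (negbTE (pos_edges_rev aL)).
have -> : (e == a) = false by apply/negP => /eqP ea; rewrite ea aL in eL.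
have -> : (rev_edge e == a) = (e == rev_edge a).
  by apply/eqP/eqP => [<-|->]; rewrite rev_edgeK.
by case: ifP => // _; rewrite invgM.
Qed.

End Links.

(** * The Schwinger-Dyson identity *)

Section SchwingerDyson.
Context {R : realType} {d N : nat} {G : unitary_group R N}.
Variables (sigma : probability (uelt G) R) (L : {fset site d}).
Hypothesis haar : is_haar sigma.
Variables (B : R) (f : edge d).
Implicit Types (Q : config G L) (e : edge d) (w b : seq (edge d)).
Local Notation M := 'M[R[i]]_N.

Let a := if pos_edge f then f else rev_edge f.
Hypothesis aL : a \in pos_edges L.

Lemma rev_edge_neq : rev_edge f != f.
Proof.
have : pos_edge a by move: aL; rewrite pos_edgesP => /and3P[].
rewrite /a; case: ifP => [pf _|_ pf]; apply/eqP => E.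
  by have := pos_edge_rev pf; rewrite E pf.
by have := pos_edge_rev pf; rewrite rev_edgeK -E pf.
Qed.

(** In terms of the positively oriented edge a the velocities are X times the
    link of a and minus the link of a^-1 times X, whatever the orientation of f. *)
Lemma link_varE (m : edge d -> M) X e :
  (forall e, m e *m m (rev_edge e) = 1%:M) ->
  link_var m f X e = if e == a then X *m m e
    else if e == rev_edge a then - (m e *m X) else 0.
Proof.
move=> mV; have VU : m (rev_edge f) *m m f = 1%:M.
  by have := mV (rev_edge f); rewrite rev_edgeK.
rewrite /link_var /lvar /a; case: (pos_edge f).
  have [->//|_] := eqVneq e f; have [->|//] := eqVneq e (rev_edge f).
  by rewrite -mulmxA -(mulmxA X) mV mulmx1.
rewrite rev_edgeK; have [->|ef] := eqVneq e f.
  by rewrite eq_sym (negbTE rev_edge_neq).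
have [->|//] := eqVneq e (rev_edge f).
by rewrite mulmxN mulNmx opprK !mulmxA VU mul1mx.
Qed.

Definition shift_link (x : uelt G) Q : config G L :=
  tshift (index a (enum_fset (pos_edges L))) x Q.

Lemma mlink_shift x Q e : mlink (shift_link x Q) e =
  if e == a then \val x *m mlink Q e
  else if e == rev_edge a then mlink Q e *m adj (\val x) else mlink Q e.
Proof.
rewrite /mlink /shift_link link_tshift //.
by case: (e == a) => //; case: (e == rev_edge a).
Qed.

Lemma shift_link_invariant x (F : config G L -> R[i]) : bmeas F ->
  bmeas (fun Q => F (shift_link x Q)) /\
  cint (config_haar sigma L) (fun Q => F (shift_link x Q)) =
  cint (config_haar sigma L) F.
Proof.
move=> nF; apply: cint_invariant => //; first exact: measurable_tshift.
by move=> A mA; exact: power_prob_shift.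
Qed.

Section Curve.
Variables (g : R -> uelt G) (X : M).
Hypothesis gX : mexpands (fun t (_ : unit) => \val (g t)) (fun=> 1%:M) (fun=> X).
Hypothesis Xadj : adj X = - X.

Local Notation dm Q := (link_var (mlink Q) f X).
Local Notation mt t Q := (mlink (shift_link (g t) Q)).

Lemma mexpands_mlink e :
  mexpands (fun t Q => mt t Q e) (fun Q => mlink Q e) (fun Q => dm Q e).
Proof.
have cst : mexpands (fun (_ : R) Q => mlink Q e) (fun Q => mlink Q e) (fun=> 0).
  by apply: (@mexpands_cst _ _ _ _ 1) => Q i j; exact: uelt_entry.
have gX' : mexpands (fun t (_ : config G L) => \val (g t)) (fun=> 1%:M) (fun=> X).
  move=> i j; have [K K1 H] := gX i j; exists K => // t x t0 tK; exact: (H t tt t0 tK).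
have gV : mexpands (fun t (_ : config G L) => adj (\val (g t))) (fun=> 1%:M) (fun=> - X).
  move=> i j; have [K K1 H] := gX j i; exists K => // t x t0 tK.
  have [h1 h2 h3] := H t tt t0 tK; rewrite -Xadj.
  have -> : (1%:M : M) i j = ((1%:M : M) j i)^* by rewrite -adjE adj_one.
  rewrite !adjE; split.
  - by rewrite normc_conj.
  - by rewrite normc_conj.
  - rewrite -(conjc_real t) -rmorphM -!rmorphB normc_conj; exact: h3.
have [ea|ea] := boolP (e == a).
  apply: mexpands_ext (mexpandsM gX' cst).
  - by move=> t Q; rewrite mlink_shift ea.
  - by move=> Q; rewrite mul1mx.
  - move=> Q; rewrite link_varE ?ea ?mulmx0 ?addr0 //; exact: mlinkV.
have [er|er] := boolP (e == rev_edge a).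
  apply: mexpands_ext (mexpandsM cst gV).
  - by move=> t Q; rewrite mlink_shift (negbTE ea) er.
  - by move=> Q; rewrite mulmx1.
  - move=> Q; rewrite link_varE ?(negbTE ea) ?er ?mul0mx ?add0r ?mulmxN //.
    exact: mlinkV.
apply: mexpands_ext cst => //.
- by move=> t Q; rewrite mlink_shift (negbTE ea) (negbTE er).
- move=> Q; rewrite link_varE ?(negbTE ea) ?(negbTE er) //; exact: mlinkV.
Qed.

Lemma mbmeas_dm e : mbmeas (fun Q => dm Q e).
Proof. by apply: mbmeas_link_var => e'; exact: mbmeas_mlink. Qed.

Lemma mexpands_lvar : mexpands (fun t Q => lvar f X (mt t Q f))
  (fun Q => lvar f X (mlink Q f)) (fun Q => lvar f X (lvar f X (mlink Q f))).
Proof.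
have Xc : mexpands (fun (_ : R) (_ : config G L) => X) (fun=> X) (fun=> 0).
  by move=> i j; apply: expands_ext (@expands_cst _ _ (fun=> X i j) (normc (X i j)) _) => // x; rewrite mxE.
have NXc : mexpands (fun (_ : R) (_ : config G L) => - X) (fun=> - X) (fun=> 0).
  by move=> i j; apply: expands_ext (@expands_cst _ _ (fun=> (- X) i j) (normc ((- X) i j)) _) => // x; rewrite mxE.
have H := mexpands_mlink f.
have E Q : dm Q f = lvar f X (mlink Q f) by rewrite /link_var eqxx.
move: E; rewrite /lvar; case: (pos_edge f) => E.
  apply: mexpands_ext (mexpandsM Xc H) => // Q.
  by rewrite mul0mx add0r E.
apply: mexpands_ext (mexpandsM H NXc) => [t Q|Q|Q].
- by rewrite mulmxN.
- by rewrite mulmxN.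
- by rewrite mulmx0 addr0 E mulmxN.
Qed.

Definition trprod (m : edge d -> M) (ws : seq (seq (edge d))) : R[i] :=
  \prod_(w <- ws) \tr (hol m w).

Fixpoint dtrprod (m dm : edge d -> M) (ws : seq (seq (edge d))) : R[i] :=
  if ws is w :: ws' then
    \tr (dhol m dm w) * trprod m ws' + \tr (hol m w) * dtrprod m dm ws'
  else 0.

Lemma expands_trprod ws : expands (fun t Q => trprod (mt t Q) ws)
  (fun Q => trprod (mlink Q) ws) (fun Q => dtrprod (mlink Q) (dm Q) ws).
Proof.
elim: ws => [|w ws IH].
  apply: (expands_ext _ _ _ (@expands_cst _ _ (fun=> 1) 1 _)).
  - by move=> t Q; rewrite /trprod big_nil.
  - by move=> Q; rewrite /trprod big_nil.
  - by [].
  - by move=> Q; rewrite normc1.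
apply: (expands_ext _ _ _ (expandsM (mexpands_tr (mexpands_hol w mexpands_mlink)) IH)).
- by move=> t Q; rewrite /trprod big_cons.
- by move=> Q; rewrite /trprod big_cons.
- by [].
Qed.

Lemma bmeas_tr_hol w : bmeas (fun Q => \tr (hol (mlink Q) w)).
Proof. by apply: bmeas_tr; apply: mbmeas_hol => e; exact: mbmeas_mlink. Qed.

Lemma bmeas_tr_dhol w : bmeas (fun Q => \tr (dhol (mlink Q) (dm Q) w)).
Proof.
by apply: bmeas_tr; apply: mbmeas_dhol => e; [exact: mbmeas_mlink|exact: mbmeas_dm].
Qed.

Lemma bmeas_trprod ws : bmeas (fun Q => trprod (mlink Q) ws).
Proof. by apply: bmeas_prod => w _; exact: bmeas_tr_hol. Qed.

Lemma bmeas_dtrprod ws : bmeas (fun Q => dtrprod (mlink Q) (dm Q) ws).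
Proof.
elim: ws => [|w ws IH] /=; first exact: bmeas_cst.
apply: bmeasD; apply: bmeasM => //.
- exact: bmeas_tr_dhol.
- exact: bmeas_trprod.
- exact: bmeas_tr_hol.
Qed.

Definition plaquettes : seq (loop d) := fset_set (pos_plaquettes L).

Definition action Q : R :=
  \sum_(p <- plaquettes) complex.Re (\tr (hol (mlink Q) (\val (repr p)))).

Definition daction Q : R :=
  \sum_(p <- plaquettes) complex.Re (\tr (dhol (mlink Q) (dm Q) (\val (repr p)))).

Lemma gauge_weightE Q : gauge_weight B Q = expR (N%:R * B * action Q).
Proof.
rewrite /gauge_weight /action; congr (expR (_ * _)).
rewrite fsbig_finite /=; last exact: finite_pos_plaquettes.
by apply: eq_bigr => p _; rewrite wilson_hol.
Qed.

Lemma expands_weight :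
  expands (fun t Q => (gauge_weight B (shift_link (g t) Q))%:C)
    (fun Q => (gauge_weight B Q)%:C)
    (fun Q => (N%:R * B * daction Q)%:C * (gauge_weight B Q)%:C).
Proof.
have E : expands (fun t Q => (N%:R * B * action (shift_link (g t) Q))%:C)
    (fun Q => (N%:R * B * action Q)%:C) (fun Q => (N%:R * B * daction Q)%:C).
  apply: (expands_ext _ _ _ (expandsM (@expands_cst _ _ (fun=> (N%:R * B)%:C) _ (fun=> lexx _))
    (expands_sum plaquettes (fun p => expands_Re (mexpands_tr (mexpands_hol (\val (repr p)) mexpands_mlink)))))).
  - by move=> t Q; rewrite -rmorph_sum -rmorphM.
  - by move=> Q; rewrite -rmorph_sum -rmorphM.
  - by move=> Q; rewrite mul0r add0r -rmorph_sum -rmorphM.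
apply: (expands_ext _ _ _ (expands_expR E)).
- by move=> t Q; rewrite gauge_weightE.
- by move=> Q; rewrite gauge_weightE.
- by move=> Q; rewrite gauge_weightE.
Qed.

Lemma bmeas_Re (F : config G L -> R[i]) : bmeas F -> bmeas (fun Q => (complex.Re (F Q))%:C).
Proof.
move=> [h1 h2 [K hK]]; split; [exact: h1|exact: measurable_cst|].
exists K => Q; rewrite normc_real; exact: le_trans (Re_le_normc _) (hK Q).
Qed.

Lemma bmeas_action : bmeas (fun Q => (action Q)%:C).
Proof.
rewrite (_ : (fun _ => _) = fun Q => \sum_(p <- plaquettes) (complex.Re (\tr (hol (mlink Q) (\val (repr p)))))%:C).
  by apply: bmeas_sum => p _; apply: bmeas_Re; exact: bmeas_tr_hol.
by apply/funext => Q; rewrite rmorph_sum.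
Qed.

Lemma bmeas_daction : bmeas (fun Q => (daction Q)%:C).
Proof.
rewrite (_ : (fun _ => _) = fun Q => \sum_(p <- plaquettes) (complex.Re (\tr (dhol (mlink Q) (dm Q) (\val (repr p)))))%:C).
  by apply: bmeas_sum => p _; apply: bmeas_Re; exact: bmeas_tr_dhol.
by apply/funext => Q; rewrite rmorph_sum.
Qed.

Lemma bmeas_weight : bmeas (fun Q => (gauge_weight B Q)%:C).
Proof.
have [h1 h2 [K hK]] := bmeas_action.
apply: (@bmeas_real _ _ _ _ (expR (`|N%:R * B| * K))).
  apply: (eq_measurable_fun (fun Q => expR (N%:R * B * action Q))).
    by move=> Q _; rewrite gauge_weightE.
  apply: measurableT_comp; first exact: measurable_expR.
  by apply: measurable_funM => //; exact: measurable_cst.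
move=> Q; rewrite gauge_weightE ger0_norm ?expR_ge0 // ler_expR.
apply: le_trans (ler_norm _) _; rewrite normrM ler_wpM2l //.
by rewrite -normc_real.
Qed.

(** The derivative of the observable, divided by the Gibbs weight.  In order: the
    marked letter, which already carries one insertion of X, the other letters of
    the word, the other words, and the exponent of the weight. *)
Definition sd_term b ws Q : R[i] :=
  let m := mlink Q in
  (\tr (lvar f X (lvar f X (m f)) *m hol m b)
    + \tr (lvar f X (m f) *m dhol m (dm Q) b)) * trprod m ws
  + \tr (lvar f X (m f) *m hol m b) * dtrprod m (dm Q) ws
  + \tr (lvar f X (m f) *m hol m b) * trprod m ws * (N%:R * B * daction Q)%:C.

Lemma bmeas_sd_term b ws : bmeas (sd_term b ws).
Proof.
have nm e : mbmeas (fun Q => mlink Q e) := mbmeas_mlink e.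
have n1 : mbmeas (fun Q => lvar f X (mlink Q f)) by exact: mbmeas_lvar.
have nb : mbmeas (fun Q => hol (mlink Q) b) by exact: mbmeas_hol.
have nt : bmeas (fun Q => \tr (lvar f X (mlink Q f) *m hol (mlink Q) b)).
  by apply: bmeas_tr; exact: mbmeasM.
apply: bmeasD; first apply: bmeasD.
- apply: bmeasM; last exact: bmeas_trprod.
  apply: bmeasD; apply: bmeas_tr; apply: mbmeasM => //.
    exact: mbmeas_lvar.
  by apply: mbmeas_dhol => // e; exact: mbmeas_dm.
- by apply: bmeasM => //; exact: bmeas_dtrprod.
apply: bmeasM; first by apply: bmeasM => //; exact: bmeas_trprod.
rewrite (_ : (fun _ => _) = fun Q => (N%:R * B)%:C * (daction Q)%:C).
  by apply: bmeasZ; exact: bmeas_daction.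
by apply/funext => Q; rewrite rmorphM.
Qed.

(** The integral of the observable is unchanged when the link of f is moved along
    the curve, so its derivative has integral zero. *)
Theorem schwinger_dyson b ws :
  cint (config_haar sigma L) (fun Q => sd_term b ws Q * (gauge_weight B Q)%:C) = 0.
Proof.
pose F Q := \tr (lvar f X (mlink Q f) *m hol (mlink Q) b) * trprod (mlink Q) ws * (gauge_weight B Q)%:C.
have nF : bmeas F.
  apply: bmeasM; last exact: bmeas_weight.
  apply: bmeasM; last exact: bmeas_trprod.
  apply: bmeas_tr; apply: mbmeasM.
    by apply: mbmeas_lvar; exact: mbmeas_mlink.
  by apply: mbmeas_hol => e; exact: mbmeas_mlink.
apply: (@derivative_integral0 _ _ _ _ (fun t Q => F (shift_link (g t) Q)) F).
- have H := expandsM (expandsM (mexpands_tr (mexpandsM mexpands_lvar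
     (mexpands_hol b mexpands_mlink))) (expands_trprod ws)) expands_weight.
  apply: (expands_ext _ _ _ H) => // Q.
  by rewrite /sd_term /= linearD /=; ring.
- exact: nF.
- by apply: bmeasM; [exact: bmeas_sd_term|exact: bmeas_weight].
- by move=> t; exact: shift_link_invariant.
Qed.

End Curve.
End SchwingerDyson.

(** * The loop equation at finite N *)

Section LoopTerms.
Context {R : realType} {d : nat}.
Implicit Types (f : edge d) (b q : seq (edge d)) (ws : seq (seq (edge d))).
Local Notation terms := (seq (R * seq (seq (edge d)))).

(** The loop equation is kept as a formal linear combination of sequences of words,
    so that it can be evaluated on traces of one configuration, on expectations
    at finite N, and on Picard iterates. *)
Definition split_terms f b ws : terms :=
  flatten [seq if x.1.2 == f then [:: (-1, (f :: x.1.1) :: (f :: x.2) :: ws)]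
    else if x.1.2 == rev_edge f then [:: (1, x.1.1 :: x.2 :: ws)] else [::]
    | x <- splits b].

(** Each deformation of the word by q is paired with a term in which the word and
    q stay apart, coming from the trace part of the su(N) Casimir tensor. *)
Definition plaquette_terms (beta : R) f b ws q : terms :=
  flatten [seq if x.1.2 == f then
      [:: (- beta, ((f :: b) ++ f :: x.2 ++ x.1.1) :: ws); (beta, (f :: b) :: q :: ws)]
    else if x.1.2 == rev_edge f then
      [:: (beta, (b ++ x.2 ++ x.1.1) :: ws); (- beta, (f :: b) :: q :: ws)]
    else [::]
    | x <- splits q].

Definition loop_terms beta (pl : seq (loop d)) f b ws : terms :=
  split_terms f b ws ++
  flatten [seq plaquette_terms beta f b ws (\val (repr p)) ++
     plaquette_terms beta f b ws (invw (\val (repr p))) | p <- pl].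

Definition lincomb (phi : seq (seq (edge d)) -> R[i]) (ts : terms) : R[i] :=
  \sum_(t <- ts) t.1%:C * phi t.2.

Lemma lincomb_flatten I (r : seq I) (F : I -> terms) phi :
  lincomb phi (flatten [seq F i | i <- r]) = \sum_(i <- r) lincomb phi (F i).
Proof. by rewrite /lincomb big_flatten big_map. Qed.

Lemma lincomb_cat phi ts ts' : lincomb phi (ts ++ ts') = lincomb phi ts + lincomb phi ts'.
Proof. by rewrite /lincomb big_cat. Qed.

Lemma lincomb_nil phi : lincomb phi [::] = 0.
Proof. by rewrite /lincomb big_nil. Qed.

Lemma lincomb_cons phi t ts : lincomb phi (t :: ts) = t.1%:C * phi t.2 + lincomb phi ts.
Proof. by rewrite /lincomb big_cons. Qed.

End LoopTerms.

Section LoopEquation.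
Context {R : realType} {d N : nat} {G : unitary_group R N}.
Variables (sigma : probability (uelt G) R) (L : {fset site d}).
Variable B : R.
Implicit Types (Q : config G L) (e f : edge d) (w b p : seq (edge d)) (ws : seq (seq (edge d))).
Local Notation M := 'M[R[i]]_N.
Local Notation mu := (config_haar sigma L).

Lemma gauge_expectE (F : config G L -> R[i]) :
  gauge_expect sigma B F = ((partition_function sigma L B)^-1)%:C *
    cint mu (fun Q => F Q * (gauge_weight B Q)%:C).
Proof.
have E1 : \int[mu]_Q complex.Re (F Q * (gauge_weight B Q)%:C) =
    \int[mu]_Q (complex.Re (F Q) * gauge_weight B Q).
  by apply: eq_Rintegral => Q _; rewrite Re_mulc /= mulr0 subr0.
have E2 : \int[mu]_Q complex.Im (F Q * (gauge_weight B Q)%:C) =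
    \int[mu]_Q (complex.Im (F Q) * gauge_weight B Q).
  by apply: eq_Rintegral => Q _; rewrite Im_mulc /= mulr0 add0r.
rewrite /gauge_expect /cint E1 E2; apply/eqP; rewrite eq_complex /=.
by rewrite !mul0r subr0 addr0 !eqxx.
Qed.

Lemma bmeas_gauge_weight : bmeas (fun Q => (gauge_weight B Q)%:C).
Proof. exact: bmeas_weight. Qed.

Lemma weight_integrable : mu.-integrable setT (EFin \o (@gauge_weight R d N G L B)).
Proof. by have [] := bmeas_integrable mu bmeas_gauge_weight. Qed.

(** The exponent is bounded, so the weight is bounded below by a positive
    constant. *)
Lemma partition_function_gt0 : 0 < partition_function sigma L B.
Proof.
have [_ _ [K hK]] := @bmeas_action R d N G L.
have lb Q : expR (- (`|N%:R * B| * K)) <= gauge_weight B Q.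
  rewrite gauge_weightE ler_expR lerNl; apply: le_trans (ler_norm _) _.
  rewrite normrN normrM ler_wpM2l //; by rewrite -normc_real.
apply: lt_le_trans (expR_gt0 (- (`|N%:R * B| * K))) _.
rewrite /partition_function -[leLHS]mulr1 -[X in _ * X <= _](_ : fine (mu setT) = 1); last first.
  by rewrite probability_setT.
rewrite -Rintegral_cst //; apply: le_Rintegral => //.
- exact: finite_measure_integrable_cst.
- exact: weight_integrable.
Qed.

Lemma gauge_expect_bound (F : config G L -> R[i]) K : bmeas F ->
  (forall Q, normc (F Q) <= K) -> normc (gauge_expect sigma B F) <= 2 * K.
Proof.
move=> nF FK; have Z0 := partition_function_gt0.
have nFw : bmeas (fun Q => F Q * (gauge_weight B Q)%:C).
  by apply: bmeasM => //; exact: bmeas_gauge_weight.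
have w0 Q : 0 <= gauge_weight B Q by exact: expR_ge0.
have H (h : config G L -> R) :
    mu.-integrable setT (EFin \o (fun Q => h Q * gauge_weight B Q)) ->
    (forall Q, `|h Q| <= K) ->
    `|\int[mu]_Q (h Q * gauge_weight B Q)| <= K * partition_function sigma L B.
  move=> ih hK; apply: le_trans (le_normr_Rintegral _ ih) _ => //.
  rewrite /partition_function -RintegralZl //; last exact: weight_integrable.
  apply: le_Rintegral => //.
  - exact: integrable_norm.
  - exact: (integrableZl measurableT K weight_integrable).
  - by move=> Q _; rewrite normrM (ger0_norm (w0 Q)) ler_wpM2r.
have [i1 i2] := bmeas_integrable mu nFw.
apply: le_trans (normc_le_ReIm _) _; rewrite /gauge_expect /=.
have i1' : mu.-integrable setT (EFin \o (fun Q => complex.Re (F Q) * gauge_weight B Q)).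
  by apply: eq_integrable i1 => // Q _ /=; rewrite Re_mulc /= mulr0 subr0.
have i2' : mu.-integrable setT (EFin \o (fun Q => complex.Im (F Q) * gauge_weight B Q)).
  by apply: eq_integrable i2 => // Q _ /=; rewrite Im_mulc /= mulr0 add0r.
rewrite mulrDl mul1r !normrM; apply: lerD;
  rewrite (ger0_norm (ltW _)) ?invr_gt0 // mulrC ler_pdivrMr //; apply: H => // Q.
  exact: le_trans (Re_le_normc _) (FK Q).
exact: le_trans (Im_le_normc _) (FK Q).
Qed.

Lemma gauge_expectD (F F' : config G L -> R[i]) : bmeas F -> bmeas F' ->
  gauge_expect sigma B (fun Q => F Q + F' Q) =
  gauge_expect sigma B F + gauge_expect sigma B F'.
Proof.
move=> nF nF'; rewrite !gauge_expectE -mulrDr -cintD.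
- by congr (_ * _); apply: eq_cint => Q; rewrite mulrDl.
- by apply: bmeasM => //; exact: bmeas_gauge_weight.
- by apply: bmeasM => //; exact: bmeas_gauge_weight.
Qed.

Lemma gauge_expectZ c (F : config G L -> R[i]) : bmeas F ->
  gauge_expect sigma B (fun Q => c * F Q) = c * gauge_expect sigma B F.
Proof.
move=> nF; rewrite !gauge_expectE mulrCA -(@cintZ _ _ _ _ c); last first.
  by apply: bmeasM => //; exact: bmeas_gauge_weight.
by congr (_ * _); apply: eq_cint => Q; rewrite mulrA.
Qed.

Lemma gauge_expect_sum (I : Type) (r : seq I) (F : I -> config G L -> R[i]) :
  (forall i, bmeas (F i)) ->
  gauge_expect sigma B (fun Q => \sum_(i <- r) F i Q) =
  \sum_(i <- r) gauge_expect sigma B (F i).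
Proof.
move=> nF; rewrite gauge_expectE.
transitivity (((partition_function sigma L B)^-1)%:C *
   cint mu (fun Q => \sum_(i <- r) F i Q * (gauge_weight B Q)%:C)).
  by congr (_ * _); apply: eq_cint => Q; rewrite mulr_suml.
rewrite cint_sum ?mulr_sumr => [|i _]; last first.
  by apply: bmeasM => //; exact: bmeas_gauge_weight.
by apply: eq_bigr => i _; rewrite gauge_expectE.
Qed.

(** Normalized traces have modulus at most 1, so products of any number of them
    are bounded independently of N. *)
Definition uprod Q ws : R[i] := \prod_(w <- ws) (\tr (hol (mlink Q) w) / N%:R).

Definition phi ws : R[i] := gauge_expect sigma B (fun Q => uprod Q ws).

Lemma bmeas_uprod ws : bmeas (fun Q => uprod Q ws).
Proof.
apply: bmeas_prod => w _; apply: bmeasM; last exact: bmeas_cst.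
exact: bmeas_tr_hol.
Qed.

Lemma normc_uprod Q ws : normc (uprod Q ws) <= 1.
Proof.
rewrite /uprod; elim: ws => [|w ws IH]; first by rewrite big_nil normc1.
rewrite big_cons normcM -[leRHS]mulr1 ler_pM ?normc_ge0 //.
rewrite normcM normcV normc_nat; have [N0|N0] := posnP N.
  by rewrite [X in X^-1](_ : _ = 0) ?invr0 ?mulr0 // {1}N0.
by rewrite ler_pdivrMr ?ltr0n // mul1r normc_tr_hol.
Qed.

Lemma phi_bound ws : normc (phi ws) <= 2.
Proof.
rewrite -[leRHS]mulr1; apply: gauge_expect_bound; first exact: bmeas_uprod.
by move=> Q; exact: normc_uprod.
Qed.

Lemma trprod_uprod Q ws : (N > 0)%N ->
  trprod (mlink Q) ws = N%:R ^+ size ws * uprod Q ws.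
Proof.
move=> N0; have nN : (N%:R : R[i]) != 0 by rewrite pnatr_eq0 -lt0n.
rewrite /uprod /trprod; elim: ws => [|w ws IH]; first by rewrite !big_nil expr0 mulr1.
rewrite !big_cons IH exprS /=; field.
exact: nN.
Qed.

Lemma normc_trprod Q ws : normc (trprod (mlink Q) ws) <= N%:R ^+ size ws.
Proof.
rewrite /trprod; elim: ws => [|w ws IH]; first by rewrite big_nil normc1.
by rewrite big_cons normcM exprS ler_pM ?normc_ge0 // normc_tr_hol.
Qed.

End LoopEquation.

(** The hypotheses below are those that differ between the two groups: the
    generators X with their coefficients c, the remainders R1 and R2 of the
    Casimir tensor, and the rule for plaquettes, which relates the coupling B of
    the measure to the beta of the common equation. *)
Section Pointwise.
Context {R : realType} {d N : nat} {G : unitary_group R N}.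
Context {L : {fset site d}}.
Implicit Types (Q : config G L) (e : edge d) (w b p q : seq (edge d)) (ws : seq (seq (edge d))).
Local Notation M := 'M[R[i]]_N.
Variables (B beta : R) (f : edge d).
Hypothesis N_gt0 : (0 < N)%N.
Hypothesis fL : (if pos_edge f then f else rev_edge f) \in pos_edges L.

Context {K : finType} {c : K -> R[i]} {X : K -> M} {R1 : M -> M}
  {R2 : M -> M -> R[i]} {r : R[i]}.
Hypothesis casimir1 : forall A,
  \sum_k c k *: (X k *m A *m X k) = R1 A - (\tr A)%:M.
Hypothesis casimir2 : forall A A',
  \sum_k c k * (\tr (X k *m A) * \tr (X k *m A')) = R2 A A' - \tr (A *m A').
Hypothesis Xadj : forall k, adj (X k) = - X k.
Hypothesis R1_one : R1 1%:M = r%:M.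
Hypothesis r_le1 : normc r <= 1.
Hypothesis R1_bound : forall A A', ugset G A -> ugset G A' ->
  normc (\tr (R1 A *m A')) <= N%:R.
Hypothesis R2_bound : forall A A', ugset G A -> ugset G A' ->
  normc (R2 A A') <= N%:R.

Definition merging Q b p : R[i] :=
  \sum_k c k * (\tr (lvar f (X k) (mlink Q f) *m hol (mlink Q) b) *
    \tr (dhol (mlink Q) (link_var (mlink Q) f (X k)) p)).

Definition plaquette_sum Q b q : R[i] := \sum_(x <- splits q)
  if x.1.2 == f then
    - \tr (hol (mlink Q) ((f :: b) ++ f :: x.2 ++ x.1.1))
    + N%:R^-1 * (\tr (hol (mlink Q) (f :: b)) * \tr (hol (mlink Q) q))
  else if x.1.2 == rev_edge f then
    \tr (hol (mlink Q) (b ++ x.2 ++ x.1.1))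
    - N%:R^-1 * (\tr (hol (mlink Q) (f :: b)) * \tr (hol (mlink Q) q))
  else 0.

Hypothesis plaquette_rule : forall Q b p,
  (B / 2)%:C * (merging Q b p + merging Q b (invw p)) =
  beta%:C * (plaquette_sum Q b p + plaquette_sum Q b (invw p)).

Definition rho_sum Q b : R[i] := \sum_(x <- splits b)
  let m := mlink Q in
  if x.1.2 == f then rho1 m f R1 (hol m x.1.1) (hol m x.2)
  else if x.1.2 == rev_edge f then
    - rho1 m f R1 (hol m x.1.1 *m m (rev_edge f)) (m (rev_edge f) *m hol m x.2)
  else 0.

Definition merging_prod Q b ws : R[i] :=
  \sum_k c k * (\tr (lvar f (X k) (mlink Q f) *m hol (mlink Q) b) *
    dtrprod (mlink Q) (link_var (mlink Q) f (X k)) ws).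

(** Everything that vanishes relative to the leading order N ^ (n + 2), where n is
    the number of words in ws: the remainder in the Casimir scalar, the remainders
    of the splittings, and the mergers of f :: b with another word. *)
Definition loop_error Q b ws : R[i] :=
  (r * \tr (hol (mlink Q) (f :: b)) + rho_sum Q b) * trprod (mlink Q) ws
  + merging_prod Q b ws.

Lemma mlink_in_group Q e : ugset G (mlink Q e).
Proof. exact: (set_mem (valP _)). Qed.

Lemma rho1_bound Q A A' : ugset G A -> ugset G A' ->
  normc (rho1 (mlink Q) f R1 A A') <= N%:R.
Proof.
move=> GA GA'; rewrite /rho1; case: (pos_edge f); apply: R1_bound; apply: ugM => //;
  exact: mlink_in_group.
Qed.

Lemma rho2_bound Q A A' : ugset G A -> ugset G A' ->
  normc (rho2 (mlink Q) f R2 A A') <= N%:R.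
Proof.
move=> GA GA'; rewrite /rho2; case: (pos_edge f); apply: R2_bound; apply: ugM => //;
  exact: mlink_in_group.
Qed.

Lemma normc_sum_splits w (F : _ -> R[i]) (E : R) :
  (forall x, x \in splits w -> normc (F x) <= E) ->
  normc (\sum_(x <- splits w) F x) <= (size w)%:R * E.
Proof.
move=> FE; apply: le_trans (normc_sum _ _ _) _.
rewrite big_seq; apply: le_trans (ler_sum _ FE) _.
by rewrite -big_seq big_const_seq count_predT size_splits iter_addr_0 mulr_natl.
Qed.

Lemma rho_sum_bound Q b : normc (rho_sum Q b) <= (size b)%:R * N%:R.
Proof.
apply: normc_sum_splits => x _ /=; case: ifP => _.
  by apply: rho1_bound; exact: hol_in_group.
case: ifP => _; last by rewrite normc0.
rewrite normcN; apply: rho1_bound; apply: ugM;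
  by [exact: hol_in_group|exact: mlink_in_group].
Qed.

Lemma merging_bound Q b p : normc (merging Q b p) <= (size p)%:R * (2 * N%:R).
Proof.
rewrite /merging (merging_sum f (mlinkV Q) casimir2).
apply: normc_sum_splits => x _ /=.
have E : 2 * N%:R = N%:R + N%:R :> R by ring.
rewrite E; case: ifP => _.
  apply: le_trans (normcB _ _) _; apply: lerD; last exact: (normc_tr_hol Q (_ :: _)).
  by apply: rho2_bound; exact: hol_in_group.
case: ifP => _; last by rewrite normc0 addr_ge0.
apply: le_trans (normcB _ _) _; apply: lerD; first exact: normc_tr_hol.
apply: rho2_bound; first exact: hol_in_group.
apply: ugM; last exact: mlink_in_group.
by apply: ugM; [exact: mlink_in_group|exact: hol_in_group].
Qed.

Lemma merging_prod_bound Q b ws :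
  normc (merging_prod Q b ws) <= 2 * (\sum_(w <- ws) size w)%N%:R * N%:R ^+ (size ws).+1.
Proof.
have N1 : 1 <= N%:R :> R by rewrite ler1n.
rewrite /merging_prod; elim: ws => [|w ws IH].
  by rewrite big1 ?normc0 ?big_nil ?mulr0 ?mul0r // => k _; rewrite /= !mulr0.
have -> : \sum_k c k * (\tr (lvar f (X k) (mlink Q f) *m hol (mlink Q) b) *
    dtrprod (mlink Q) (link_var (mlink Q) f (X k)) (w :: ws)) =
  merging Q b w * trprod (mlink Q) ws + \tr (hol (mlink Q) w) *
  (\sum_k c k * (\tr (lvar f (X k) (mlink Q f) *m hol (mlink Q) b) *
    dtrprod (mlink Q) (link_var (mlink Q) f (X k)) ws)).
  rewrite mulr_suml mulr_sumr -big_split; apply: eq_bigr => k _ /=; ring.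
apply: le_trans (normcD _ _) _; rewrite !normcM.
have h1 := ler_pM (normc_ge0 _) (normc_ge0 _) (merging_bound Q b w) (normc_trprod Q ws).
have h2 := ler_pM (normc_ge0 _) (normc_ge0 _) (normc_tr_hol Q w) IH.
apply: le_trans (lerD h1 h2) _; rewrite big_cons natrD /= !exprS.
set s := (size w)%:R; set S := (\sum_(_ <- ws) _)%:R; set P := _ ^+ size ws.
have P0 : 0 <= P by exact: exprn_ge0.
have s0 : 0 <= s :> R by rewrite /s.
have : s * N%:R * P <= s * (N%:R * N%:R) * P.
  rewrite ler_wpM2r // ler_wpM2l // -[leLHS]mulr1 ler_wpM2l //.
lra.
Qed.

(** The traces in the error are at most N in modulus, and each term has one trace
    less, or one factor N less, than the leading terms. *)
Lemma loop_error_bound Q b ws : normc (loop_error Q b ws) <=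
  (1 + (size b)%:R + 2 * (\sum_(w <- ws) size w)%N%:R) * N%:R ^+ (size ws).+1.
Proof.
apply: le_trans (normcD _ _) _; rewrite [leRHS]mulrDl.
apply: lerD; last exact: merging_prod_bound.
rewrite normcM exprS mulrA ler_pM ?normc_ge0 //; last exact: normc_trprod.
apply: le_trans (normcD _ _) _; rewrite [leRHS]mulrDl mul1r; apply: lerD.
  rewrite normcM -[leRHS]mul1r ler_pM ?normc_ge0 //; exact: (normc_tr_hol Q (_ :: _)).
exact: rho_sum_bound.
Qed.

Lemma link_var_adj Q k e : link_var (mlink Q) f (X k) (rev_edge e) =
  adj (link_var (mlink Q) f (X k) e).
Proof.
rewrite !(link_varE fL) ?mlinkV //; try exact: mlinkV.
have := fL; set a := (if pos_edge f then f else _) => aL.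
have an : rev_edge a != a.
  by apply/eqP => E; have := pos_edges_rev aL; rewrite E aL.
have rE : (rev_edge e == a) = (e == rev_edge a).
  by apply/eqP/eqP => [<-|->]; rewrite rev_edgeK.
have rE' : (rev_edge e == rev_edge a) = (e == a).
  by apply/eqP/eqP => [/(congr1 (@rev_edge d))|->//]; rewrite !rev_edgeK.
rewrite rE rE'; have [->|ea] := eqVneq e a.
  by rewrite eq_sym (negbTE an) adjM Xadj -mlink_adj mulmxN.
case: ifP => _; last by rewrite adj_zero.
rewrite mlink_adj; have -> : - (mlink Q e *m X k) = mlink Q e *m adj (X k).
  by rewrite Xadj mulmxN.
rewrite adjM; congr (_ *m _); apply/matrixP => i j; rewrite !adjE.
by rewrite conjcK.
Qed.

(** The real part of the trace of a plaquette is the half sum over its two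
    orientations, which is where both [p] and [invw p] enter. *)
Lemma daction_sum Q b :
  \sum_k c k * (\tr (lvar f (X k) (mlink Q f) *m hol (mlink Q) b) *
    (B * daction f (X k) Q)%:C) =
  beta%:C * \sum_(p <- plaquettes L)
    (plaquette_sum Q b (\val (repr p)) + plaquette_sum Q b (invw (\val (repr p)))).
Proof.
rewrite mulr_sumr; under [RHS]eq_bigr do rewrite -plaquette_rule /merging.
rewrite /daction.
have hB : (B / 2)%:C = B%:C / 2 by rewrite rmorphM fmorphV rmorph_nat.
transitivity (\sum_k \sum_(p <- plaquettes L) (B / 2)%:C *
   (c k * (\tr (lvar f (X k) (mlink Q f) *m hol (mlink Q) b) *
    (\tr (dhol (mlink Q) (link_var (mlink Q) f (X k)) (\val (repr p))) +
     \tr (dhol (mlink Q) (link_var (mlink Q) f (X k)) (invw (\val (repr p)))))))).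
  apply: eq_bigr => k _; rewrite rmorphM rmorph_sum !mulr_sumr; apply: eq_bigr => p _.
  rewrite (dhol_invw_adj _ (mlink_adj Q) (link_var_adj Q k)) tr_adj /=.
  by rewrite ReJ_add hB; ring.
rewrite exchange_big; apply: eq_bigr => p _ /=; rewrite -big_split mulr_sumr.
by apply: eq_bigr => k _ /=; ring.
Qed.

Lemma uprod_cons Q w ws :
  uprod Q (w :: ws) = \tr (hol (mlink Q) w) / N%:R * uprod Q ws.
Proof. by rewrite /uprod big_cons. Qed.

Let N_neq0 : (N%:R : R[i]) != 0.
Proof. by rewrite pnatr_eq0 -lt0n. Qed.

Lemma lincomb_split Q b ws :
  N%:R ^+ (size ws).+2 * lincomb (uprod Q) (split_terms f b ws) =
  (\sum_(x <- splits b)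
    if x.1.2 == f then
      - (\tr (hol (mlink Q) (f :: x.1.1)) * \tr (hol (mlink Q) (f :: x.2)))
    else if x.1.2 == rev_edge f then
      \tr (hol (mlink Q) x.1.1) * \tr (hol (mlink Q) x.2) else 0) *
  trprod (mlink Q) ws.
Proof.
rewrite /split_terms lincomb_flatten mulr_sumr mulr_suml trprod_uprod //.
apply: eq_bigr => x _; rewrite !exprS.
case: ifP => _; last case: ifP => _.
- rewrite lincomb_cons lincomb_nil /= !uprod_cons rmorphN rmorph1 /=.
  by field.
- rewrite lincomb_cons lincomb_nil /= !uprod_cons rmorph1 /=.
  by field.
- by rewrite lincomb_nil !(mulr0, mul0r).
Qed.

Lemma lincomb_plaquette Q b ws q :
  N%:R ^+ (size ws).+2 * lincomb (uprod Q) (plaquette_terms beta f b ws q) =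
  N%:R * (beta%:C * plaquette_sum Q b q) * trprod (mlink Q) ws.
Proof.
have -> : N%:R * (beta%:C * plaquette_sum Q b q) * trprod (mlink Q) ws =
    N%:R * beta%:C * trprod (mlink Q) ws * plaquette_sum Q b q by ring.
rewrite /plaquette_terms lincomb_flatten mulr_sumr [RHS]mulr_sumr trprod_uprod //.
apply: eq_bigr => x _; rewrite !exprS.
case: ifP => _; last case: ifP => _.
- rewrite !lincomb_cons lincomb_nil /= !uprod_cons rmorphN /=.
  by field.
- rewrite !lincomb_cons lincomb_nil /= !uprod_cons rmorphN /=.
  by field.
- by rewrite lincomb_nil !(mulr0, mul0r).
Qed.

(** Summed over the generators, the Schwinger-Dyson integrand is the loop equation
    for normalized traces, before integration, up to the error term. *)
Lemma casimir_sd_term Q b ws : \sum_k c k * sd_term B f (X k) b ws Q =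
  N%:R ^+ (size ws).+2 *
    (lincomb (uprod Q) (loop_terms beta (plaquettes L) f b ws) - uprod Q ((f :: b) :: ws))
  + loop_error Q b ws.
Proof.
set P := trprod (mlink Q) ws.
have E1 : \sum_k c k * sd_term B f (X k) b ws Q =
  (\sum_k c k * \tr (lvar f (X k) (lvar f (X k) (mlink Q f)) *m hol (mlink Q) b)
   + \sum_k c k * \tr (lvar f (X k) (mlink Q f) *m dhol (mlink Q) (link_var (mlink Q) f (X k)) b)) * P
  + merging_prod Q b ws
  + N%:R * (\sum_k c k * (\tr (lvar f (X k) (mlink Q f) *m hol (mlink Q) b) *
    (B * daction f (X k) Q)%:C)) * P.
  rewrite mulrDl !mulr_suml mulr_sumr mulr_suml -!big_split; apply: eq_bigr => k _ /=.
  rewrite /sd_term -/P !rmorphM rmorph_nat /=; ring.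
rewrite E1 (lvar_lvar_sum _ _ casimir1 _ R1_one) (splitting_sum f (mlinkV Q) casimir1).
rewrite daction_sum /loop_error -/P.
have -> : \sum_(x <- splits b)
    (if x.1.2 == f then rho1 (mlink Q) f R1 (hol (mlink Q) x.1.1) (hol (mlink Q) x.2)
       - \tr (hol (mlink Q) (f :: x.1.1)) * \tr (hol (mlink Q) (f :: x.2))
    else if x.1.2 == rev_edge f then
      \tr (hol (mlink Q) x.1.1) * \tr (hol (mlink Q) x.2) -
      rho1 (mlink Q) f R1 (hol (mlink Q) x.1.1 *m mlink Q (rev_edge f))
        (mlink Q (rev_edge f) *m hol (mlink Q) x.2)
    else 0) =
  rho_sum Q b + \sum_(x <- splits b)
    (if x.1.2 == f then
      - (\tr (hol (mlink Q) (f :: x.1.1)) * \tr (hol (mlink Q) (f :: x.2)))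
    else if x.1.2 == rev_edge f then
      \tr (hol (mlink Q) x.1.1) * \tr (hol (mlink Q) x.2) else 0).
  rewrite -big_split; apply: eq_bigr => x _ /=.
  by case: ifP => _ //; case: ifP => _; rewrite ?addr0 // addrC.
rewrite mulrBr {1}/loop_terms lincomb_cat mulrDr lincomb_split -/P.
rewrite lincomb_flatten [X in _ + X - _]mulr_sumr.
have -> : \sum_(p <- plaquettes L) N%:R ^+ (size ws).+2 * lincomb (uprod Q)
     (plaquette_terms beta f b ws (\val (repr p)) ++
      plaquette_terms beta f b ws (invw (\val (repr p)))) =
   N%:R * (beta%:C * \sum_(p <- plaquettes L)
    (plaquette_sum Q b (\val (repr p)) + plaquette_sum Q b (invw (\val (repr p))))) * P.
  rewrite !mulr_sumr mulr_suml; apply: eq_bigr => p _.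
  by rewrite lincomb_cat mulrDr !lincomb_plaquette -/P; ring.
have -> : N%:R ^+ (size ws).+2 * uprod Q ((f :: b) :: ws) =
    N%:R * \tr (hol (mlink Q) (f :: b)) * P.
  by rewrite /P trprod_uprod // uprod_cons !exprS; field.
rewrite /=; ring.
Qed.

Variable sigma : probability (uelt G) R.
Hypothesis haar : is_haar sigma.
Variable g : K -> R -> uelt G.
Hypothesis gX : forall k,
  mexpands (fun t (_ : unit) => \val (g k t)) (fun=> 1%:M) (fun=> X k).

(** Integrating the previous identity gives zero on the left; dividing by
    N ^ (n + 2) leaves an error of order 1/N. *)
Theorem approximate_loop_equation b ws :
  normc (phi sigma L B ((f :: b) :: ws) -
    lincomb (phi sigma L B) (loop_terms beta (plaquettes L) f b ws)) <=
  2 * (1 + (size b)%:R + 2 * (\sum_(w <- ws) size w)%N%:R) / N%:R.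
Proof.
set C := 1 + _ + _; set ts := loop_terms _ _ _ _ _.
pose E (F : config G L -> R[i]) := gauge_expect sigma B F.
pose S Q := \sum_k c k * sd_term B f (X k) b ws Q.
pose D Q := lincomb (uprod Q) ts - uprod Q ((f :: b) :: ws).
have nS : bmeas S.
  by apply: bmeas_sum => k _; apply: bmeasZ; exact: bmeas_sd_term.
have nl : bmeas (fun Q => lincomb (uprod Q) ts).
  by apply: bmeas_sum => t _; apply: bmeasZ; exact: bmeas_uprod.
have nD : bmeas D by apply: bmeasB => //; exact: bmeas_uprod.
have errE Q : loop_error Q b ws = S Q + (- N%:R ^+ (size ws).+2) * D Q.
  by rewrite /S casimir_sd_term /D; ring.
have nerr : bmeas (fun Q => loop_error Q b ws).
  under eq_fun do rewrite errE.
  by apply: bmeasD => //; exact: bmeasZ.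
have ES : E S = 0.
  rewrite /E gauge_expect_sum; last first.
    by move=> k; apply: bmeasZ; exact: bmeas_sd_term.
  rewrite big1 // => k _; rewrite gauge_expectZ; last exact: bmeas_sd_term.
  by rewrite gauge_expectE (schwinger_dyson haar B fL (gX k) (Xadj k)) !mulr0.
have ED : E D = lincomb (phi sigma L B) ts - phi sigma L B ((f :: b) :: ws).
  have -> : D = fun Q => lincomb (uprod Q) ts + (-1) * uprod Q ((f :: b) :: ws).
    by apply/funext => Q; rewrite /D mulN1r.
  rewrite /E gauge_expectD //; last by apply: bmeasZ; exact: bmeas_uprod.
  rewrite gauge_expectZ ?mulN1r; last exact: bmeas_uprod.
  congr (_ - _); rewrite gauge_expect_sum.
    by apply: eq_bigr => t _; rewrite gauge_expectZ //; exact: bmeas_uprod.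
  by move=> t; apply: bmeasZ; exact: bmeas_uprod.
have Eerr : E (fun Q => loop_error Q b ws) =
    N%:R ^+ (size ws).+2 * (phi sigma L B ((f :: b) :: ws) - lincomb (phi sigma L B) ts).
  have -> : (fun Q => loop_error Q b ws) = fun Q => S Q + (- N%:R ^+ (size ws).+2) * D Q.
    by apply/funext => Q; exact: errE.
  rewrite /E gauge_expectD //; last exact: bmeasZ.
  by rewrite gauge_expectZ // -/(E S) -/(E D) ES ED; ring.
have := gauge_expect_bound sigma B nerr (fun Q => loop_error_bound Q b ws).
rewrite -/(E _) Eerr normcM -/C => H.
have N0 : 0 < N%:R :> R by rewrite ltr0n.
have NE : normc (N%:R ^+ (size ws).+2 : R[i]) = N%:R * N%:R ^+ (size ws).+1.
  by rewrite -natrX normc_nat natrX exprS.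
rewrite ler_pdivlMr // -(@ler_pM2r _ (N%:R ^+ (size ws).+1)) ?exprn_gt0 //.
by move: H; rewrite NE; lra.
Qed.

End Pointwise.

(** * One-parameter curves in the two groups *)

Section Rotation.
Context {F : comNzRingType} {N : nat}.
Implicit Types (X k : 'M[F]_N) (s u : F).

(** If X ^ 3 = - X then 1 + sin(t) X - (cos(t) - 1) X ^ 2 is exp(tX): here s stands
    for the sine and u for cos - 1. *)
Definition rotation X s u : 'M[F]_N := 1%:M + s *: X - u *: (X *m X).

Lemma rotationN X s u : X *m X *m X = - X -> 2 * u + u ^+ 2 + s ^+ 2 = 0 ->
  rotation X s u *m rotation X (- s) u = 1%:M.
Proof.
move=> X3 su; rewrite /rotation; set Y := X *m X.
have XY : X *m Y = - X by rewrite /Y mulmxA X3.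
have YX : Y *m X = - X by [].
have YY : Y *m Y = - Y by rewrite {2}/Y mulmxA YX mulNmx.
rewrite !(mulmxDl, mulmxDr, mul1mx, mulmx1, mulNmx, mulmxN).
rewrite -!(scalemxAl, scalemxAr) XY YX YY -/Y.
rewrite -[RHS]addr0 -(scale0r Y) -oppr0 -su.
apply/matrixP => i j; rewrite !mxE; ring.
Qed.

Lemma rotation_conj X k s u : k *m X = - (X *m k) ->
  k *m rotation X s u = rotation X (- s) u *m k.
Proof.
move=> kX; have kY : k *m (X *m X) = X *m X *m k.
  by rewrite mulmxA kX mulNmx -[X *m k *m X]mulmxA kX mulmxN opprK mulmxA.
rewrite /rotation !(mulmxDl, mulmxDr, mul1mx, mulmx1, mulNmx, mulmxN).
by rewrite -!(scalemxAl, scalemxAr) kX kY scaleNr scalerN.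
Qed.

Lemma rotation_tr X s u : X^T = - X -> (rotation X s u)^T = rotation X (- s) u.
Proof.
move=> XT; rewrite /rotation linearB linearD !linearZ /= trmx1 trmx_mul XT.
by rewrite mulmxN mulNmx opprK !scalerN scaleNr.
Qed.

(** A rotation that is conjugate to its inverse has determinant 1 or - 1, so its
    square has determinant 1; this avoids computing any determinant. *)
Lemma det_rotation_sqr X k s u : X *m X *m X = - X -> 2 * u + u ^+ 2 + s ^+ 2 = 0 ->
  GRing.lreg (\det k) -> k *m X = - (X *m k) ->
  \det (rotation X s u *m rotation X s u) = 1.
Proof.
move=> X3 su kreg kX; have := congr1 determinant (rotationN X3 su).
have := congr1 determinant (rotation_conj s u kX).
rewrite !det_mulmx det1 [RHS]mulrC => /kreg <-.
by [].
Qed.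

End Rotation.

Section Curve.
Context {R : realType} {N : nat}.
Local Notation M := 'M[R[i]]_N.
Implicit Types (X : M) (t : R).

(** Sine and cosine minus 1 of an angle t / 2 + O(t ^ 3), in the rational
    parametrization of the circle by tan of the half angle, t / 4.  Only
    the tangent at t = 0 matters, and rational functions make the remainder
    explicit. *)
Definition rsin t : R := (t / 2) / (1 + (t / 4) ^+ 2).
Definition rvers t : R := - (2 * (t / 4) ^+ 2) / (1 + (t / 4) ^+ 2).

Let den_gt0 t : 0 < 1 + (t / 4) ^+ 2.
Proof. by rewrite ltr_pwDl // sqr_ge0. Qed.

Lemma rsin_rvers t : 2 * rvers t + rvers t ^+ 2 + rsin t ^+ 2 = 0.
Proof.
rewrite /rsin /rvers; field.
by rewrite lt0r_neq0 //; have := sqr_ge0 t; rewrite expr2; lra.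
Qed.

Lemma rvers_bound t : `|rvers t| <= t ^+ 2.
Proof.
have h := den_gt0 t; rewrite /rvers normrM normfV (gtr0_norm h) ler_pdivrMr //.
rewrite normrN ger0_norm; last by rewrite mulr_ge0 // sqr_ge0.
have h2 := sqr_ge0 t; have : 0 <= t ^+ 2 * (t / 4) ^+ 2 by rewrite mulr_ge0 // sqr_ge0.
rewrite exprMn; lra.
Qed.

Lemma rsin_bound t : 0 <= t -> t <= 1 -> `|rsin t - t / 2| <= t ^+ 2.
Proof.
move=> t0 t1; have h := den_gt0 t.
have -> : rsin t - t / 2 = - (t / 2 * (t / 4) ^+ 2) / (1 + (t / 4) ^+ 2).
  rewrite /rsin; field.
  by rewrite lt0r_neq0 //; have := sqr_ge0 t; rewrite expr2; lra.
rewrite normrM normfV (gtr0_norm h) ler_pdivrMr // normrN ger0_norm; last first.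
  by rewrite mulr_ge0 ?divr_ge0 // sqr_ge0.
have h2 := sqr_ge0 t; have : 0 <= t ^+ 2 * (t / 4) ^+ 2 by rewrite mulr_ge0 // sqr_ge0.
rewrite exprMn; have : t * t ^+ 2 <= t ^+ 2 by rewrite ler_piMl.
lra.
Qed.

(** The curve is the square of a rotation by half the angle, so that its
    determinant is 1. *)
Definition half_curve X t : M := rotation X (rsin t)%:C (rvers t)%:C.
Definition curve X t : M := half_curve X t *m half_curve X t.

Lemma mexpands_half_curve X : mexpands (fun t (_ : unit) => half_curve X t)
  (fun=> 1%:M) (fun=> (2^-1)%:C *: X).
Proof.
move=> i j; set Y := X *m X; set x := normc (X i j); set y := normc (Y i j).
have x0 : 0 <= x := normc_ge0 _; have y0 : 0 <= y := normc_ge0 _.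
exists (1 + x + y); first lra.
move=> t _ t0 tK; have t1 : t <= 1 by nra.
split.
- rewrite mxE; case: eqP => _; rewrite ?normc1 ?normc0; lra.
- rewrite mxE normcM normc_real -/x ger0_norm ?invr_ge0 //; lra.
rewrite /half_curve /rotation !mxE.
have -> : (i == j)%:R + (rsin t)%:C * X i j - (rvers t)%:C * (\sum_k X i k * X k j)
   - (i == j)%:R - t%:C * ((2^-1)%:C * X i j) =
   (rsin t - t / 2)%:C * X i j - (rvers t)%:C * Y i j.
  have -> : (rsin t - t / 2)%:C = (rsin t)%:C - t%:C * (2^-1)%:C.
    by rewrite rmorphB (rmorphM _ t).
  have -> : Y i j = \sum_k X i k * X k j by rewrite mxE.
  by ring.
apply: le_trans (normcB _ _) _; rewrite !normcM !normc_real -/x -/y.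
have h1 := ler_wpM2r x0 (rsin_bound t0 t1).
have h2 := ler_wpM2r y0 (rvers_bound t).
have := sqr_ge0 t; lra.
Qed.

Lemma mexpands_curve X :
  mexpands (fun t (_ : unit) => curve X t) (fun=> 1%:M) (fun=> X).
Proof.
apply: mexpands_ext (mexpandsM (mexpands_half_curve X) (mexpands_half_curve X)) => //.
- by move=> x; rewrite mulmx1.
- move=> x; rewrite mulmx1 mul1mx -scalerDl -rmorphD.
  by rewrite (_ : 2^-1 + 2^-1 = 1) ?scale1r //; lra.
Qed.

Lemma adj_half_curve X t : adj X = - X -> adj (half_curve X t) =
  rotation X (- (rsin t)%:C) (rvers t)%:C.
Proof.
move=> aX; rewrite /half_curve /rotation adjD adjD adj_one.
have aZ (a : R) (A : M) : adj (a%:C *: A) = a%:C *: adj A.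
  apply/matrixP => i j; rewrite adjE [RHS]mxE adjE mxE rmorphM.
  by congr (_ * _); exact: conjc_real.
have aN (A : M) : adj (- A) = - adj A.
  by apply/matrixP => i j; rewrite adjE [RHS]mxE adjE mxE rmorphN.
by rewrite aN !aZ adjM aX scalerN scaleNr mulmxN mulNmx opprK.
Qed.

Lemma curve_unitary X t : X *m X *m X = - X -> adj X = - X ->
  curve X t \is unitarymx.
Proof.
move=> X3 aX; apply/unitarymxP; rewrite -/(adj _) /curve adjM adj_half_curve //.
have su : 2 * (rvers t)%:C + (rvers t)%:C ^+ 2 + (rsin t)%:C ^+ 2 = 0.
  by rewrite -(rmorph_nat (real_complex R)) -!rmorphXn -!rmorphM -!rmorphD rsin_rvers.
have : half_curve X t *m rotation X (- (rsin t)%:C) (rvers t)%:C = 1%:M.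
  exact: rotationN X3 su.
move: (half_curve X t) (rotation _ _ _) => h h' hh.
by rewrite mulmxA -(mulmxA h) hh mulmx1.
Qed.

End Curve.

Lemma tr_delta_mulmx {F : comNzRingType} {N : nat} (i j : 'I_N) (A : 'M[F]_N) :
  \tr (delta_mx i j *m A) = A j i.
Proof.
rewrite /mxtrace (bigD1 i) //= [X in _ + X]big1 ?addr0 => [|k ki].
  rewrite mxE (bigD1 j) //= big1 ?addr0 => [|l lj]; rewrite mxE ?eqxx ?mul1r //=.
  by rewrite (negbTE lj) mul0r.
by rewrite mxE big1 // => l _; rewrite mxE (negbTE ki) mul0r.
Qed.

(** The contraction of X A X follows from that of tr(X A) tr(X B), by taking
    matrix units for A and B. *)
Lemma casimir_square {R : realType} {N : nat} (K : finType) (c : K -> R[i])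
    (X : K -> 'M[R[i]]_N) (R2 : 'M[R[i]]_N -> 'M[R[i]]_N -> R[i]) :
  (forall A B, \sum_k c k * (\tr (X k *m A) * \tr (X k *m B)) =
     R2 A B - \tr (A *m B)) ->
  forall A, \sum_k c k *: (X k *m A *m X k) =
    \matrix_(i, j) (\sum_p \sum_q A p q * R2 (delta_mx p i) (delta_mx j q))
    - (\tr A)%:M.
Proof.
move=> H A; apply/matrixP => i j; rewrite summxE.
have tE p q (B : 'M[R[i]]_N) : \tr (B *m delta_mx p q) = B q p.
  by rewrite mxtrace_mulC tr_delta_mulmx.
transitivity (\sum_p \sum_q A p q *
    \sum_k c k * (\tr (X k *m delta_mx p i) * \tr (X k *m delta_mx j q))).
  transitivity (\sum_k \sum_p \sum_q A p q * (c k * (X k i p * X k q j))).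
    apply: eq_bigr => k _; rewrite mxE mxE exchange_big mulr_sumr /=.
    apply: eq_bigr => q _; rewrite mxE mulr_suml mulr_sumr; apply: eq_bigr => p _; ring.
  rewrite exchange_big; apply: eq_bigr => p _; rewrite exchange_big.
  apply: eq_bigr => q _; rewrite mulr_sumr; apply: eq_bigr => k _.
  by rewrite !tE.
transitivity (\sum_p \sum_q (A p q * R2 (delta_mx p i) (delta_mx j q) -
    A p q * (\tr (delta_mx p i *m (delta_mx j q : 'M[R[i]]_N))))).
  by apply: eq_bigr => p _; apply: eq_bigr => q _; rewrite H mulrBr.
rewrite !mxE; under eq_bigr do rewrite sumrB; rewrite sumrB; congr (_ - _).
rewrite -sumrMnl; apply: eq_bigr => p _.
rewrite (bigD1 p) //= big1 ?addr0 => [|q qp]; rewrite tE mxE.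
  by rewrite eqxx /= eq_sym mulr_natr.
by rewrite (negbTE qp) mulr0.
Qed.

(** * The orthogonal case *)

Section Asym.
Context {F : comNzRingType} {N : nat}.
Implicit Types (i j : 'I_N).

Definition asym i j : 'M[F]_N := delta_mx i j - delta_mx j i.

Lemma asym_cube i j : asym i j *m asym i j *m asym i j = - asym i j.
Proof.
rewrite /asym; have [->|ij] := eqVneq i j; first by rewrite subrr !mul0mx oppr0.
have ji : (j == i) = false by rewrite eq_sym; apply/negbTE.
rewrite !(mulmxBl, mulmxBr) !mul_delta_mx_cond !(negbTE ij, ji, eqxx) /=.
rewrite !(mulr0n, mulr1n, sub0r, subr0, mulmxBl, mulmxBr, mulNmx, mul0mx).
rewrite !mul_delta_mx_cond !(negbTE ij, ji, eqxx) !(mulr0n, mulr1n) /=.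
by rewrite !(opprK, sub0r, subr0, oppr0, addr0, add0r) opprB addrC.
Qed.

Lemma asym_tr i j : (asym i j)^T = - asym i j.
Proof. by rewrite /asym linearB /= !trmx_delta opprB. Qed.

Lemma tr_asym_mulmx i j (A : 'M[F]_N) : \tr (asym i j *m A) = A j i - A i j.
Proof. by rewrite /asym mulmxBl raddfB /= !tr_delta_mulmx. Qed.

Lemma mxtrace_mulE (A A' : 'M[F]_N) : \tr (A *m A') = \sum_i \sum_j A i j * A' j i.
Proof. by apply: eq_bigr => i _; rewrite mxE. Qed.

End Asym.

Section SOGenerators.
Context {R : realType} {N : nat}.
Local Notation M := 'M[R[i]]_N.
Local Notation G := (SO R N).

(** Both orders of each pair of indices are counted, hence the coefficient 1/2;
    the diagonal pairs contribute zero. *)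
Definition so_gen (k : 'I_N * 'I_N) : M := asym k.1 k.2.
Definition so_coef (k : 'I_N * 'I_N) : R[i] := 2^-1.
Definition so_form (A B : M) : R[i] := \tr (A^T *m B).

Lemma so_gen_map (k : 'I_N * 'I_N) :
  so_gen k = map_mx (real_complex R) (asym k.1 k.2).
Proof. by rewrite map_mxB !map_delta_mx. Qed.

Lemma curve_SO k t : ugset G (curve (so_gen k) t).
Proof.
pose h : 'M[R]_N := rotation (asym k.1 k.2) (rsin t) (rvers t).
have hT : h^T = rotation (asym k.1 k.2) (- rsin t) (rvers t).
  exact/rotation_tr/asym_tr.
have hh : h *m h^T = 1%:M by rewrite hT rotationN ?asym_cube ?rsin_rvers.
exists (h *m h); first split.
- by rewrite trmx_mul mulmxA -(mulmxA h) hh mulmx1.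
- by rewrite det_mulmx -{2}(det_tr h) -det_mulmx hh det1.
rewrite map_mxM /curve; congr (_ *m _); rewrite so_gen_map /half_curve /h /rotation;
  by rewrite map_mxB map_mxD map_mx1 !map_mxZ map_mxM.
Qed.

Definition so_curve k t : uelt G := mk_uelt (curve_SO k t).

Lemma so_gen_adj k : adj (so_gen k) = - so_gen k.
Proof.
rewrite so_gen_map /adj SO_adj asym_tr.
by rewrite map_mxN.
Qed.

(** The Casimir tensor of so(N): the transposition minus the flip. *)
Lemma so_casimir (A B : M) :
  \sum_k so_coef k * (\tr (so_gen k *m A) * \tr (so_gen k *m B)) =
  so_form A B - \tr (A *m B).
Proof.
rewrite -(pair_bigA _ (fun i j => so_coef (i, j) *
  (\tr (so_gen (i, j) *m A) * \tr (so_gen (i, j) *m B)))) /=.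
pose S1 := \sum_i \sum_j (A i j * B i j); pose S2 := \sum_i \sum_j (A i j * B j i).
have E1 : so_form A B = S1.
  rewrite /so_form mxtrace_mulE exchange_big /S1; apply: eq_bigr => i _.
  by apply: eq_bigr => j _; rewrite mxE.
have E1' : so_form A B = \sum_i \sum_j A j i * B j i.
  by rewrite E1 /S1 exchange_big.
have E2 : \tr (A *m B) = S2 by rewrite mxtrace_mulE.
have E2' : \tr (A *m B) = \sum_i \sum_j A j i * B i j.
  by rewrite mxtrace_mulC mxtrace_mulE; apply: eq_bigr => i _; apply: eq_bigr => j _; rewrite mulrC.
have -> : so_form A B - \tr (A *m B) =
   2^-1 * (\sum_i \sum_j A j i * B j i + S1 - (S2 + \sum_i \sum_j A j i * B i j)).
  by rewrite -E1 -E1' -E2 -E2'; field.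
rewrite /S1 /S2 -!big_split -sumrB mulr_sumr; apply: eq_bigr => i _ /=.
rewrite -!big_split -sumrB mulr_sumr; apply: eq_bigr => j _ /=.
by rewrite !tr_asym_mulmx /so_coef; ring.
Qed.

Definition so_square (A : M) : M :=
  \matrix_(i, j) (\sum_p \sum_q A p q * so_form (delta_mx p i) (delta_mx j q)).

Lemma so_squareE A : so_square A = A^T.
Proof.
apply/matrixP => i j; rewrite !mxE.
rewrite (bigD1 j) //= [X in _ + X]big1 ?addr0 => [|p pj].
  rewrite (bigD1 i) //= big1 ?addr0 => [|q qi].
    by rewrite /so_form trmx_delta tr_delta_mulmx mxE !eqxx mulr1.
  by rewrite /so_form trmx_delta tr_delta_mulmx mxE eqxx (eq_sym i) (negbTE qi) mulr0.
by rewrite big1 // => q _; rewrite /so_form trmx_delta tr_delta_mulmx mxE (negbTE pj) mulr0.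
Qed.

Lemma SO_trmx A : ugset G A -> A^T = adj A.
Proof. by move=> [A' _ <-]; rewrite /adj SO_adj map_trmx. Qed.

Lemma so_form_bound A A' : ugset G A -> ugset G A' -> normc (so_form A A') <= N%:R.
Proof.
move=> GA GA'; rewrite /so_form SO_trmx //; apply: normc_tr_unitary.
by apply: (ug_unitary (u := G)); apply: ugM => //; exact: ugV.
Qed.

Lemma so_square_bound A A' : ugset G A -> ugset G A' ->
  normc (\tr (so_square A *m A')) <= N%:R.
Proof. by rewrite so_squareE; exact: so_form_bound. Qed.

Lemma so_square_one : so_square 1%:M = 1%:M.
Proof. by rewrite so_squareE trmx1. Qed.

End SOGenerators.

Section SOPlaquette.
Context {R : realType} {d N : nat} {L : {fset site d}}.
Variables (beta : R) (f : edge d).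
Local Notation G := (SO R N).
Implicit Types (Q : config G L) (b p q : seq (edge d)).

Lemma SO_trace_inv Q w : \tr (hol (mlink Q) (invw w)) = \tr (hol (mlink Q) w).
Proof.
rewrite (hol_invw_adj _ (mlink_adj Q)) -SO_trmx ?mxtrace_tr //.
exact: hol_in_group.
Qed.

Lemma SO_trace_inv_cat Q v w : \tr (hol (mlink Q) (v ++ invw w)) =
  so_form (hol (mlink Q) v) (hol (mlink Q) w).
Proof.
rewrite /so_form hol_cat (hol_invw_adj _ (mlink_adj Q)) -SO_trmx; last exact: hol_in_group.
by rewrite -[LHS]mxtrace_tr trmx_mul trmxK mxtrace_mulC.
Qed.

Lemma so_form_mull Q A A' e : so_form (mlink Q e *m A) (mlink Q e *m A') = so_form A A'.
Proof.
have VU : adj (mlink Q e) *m mlink Q e = 1%:M.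
  by have := mlinkV Q (rev_edge e); rewrite rev_edgeK mlink_adj.
rewrite /so_form trmx_mul (SO_trmx (mlink_in_group Q e)).
by rewrite -mulmxA (mulmxA (adj _)) VU mul1mx.
Qed.

Lemma so_form_mulr Q A A' e : so_form (A *m mlink Q e) (A' *m mlink Q e) = so_form A A'.
Proof.
rewrite /so_form trmx_mul (SO_trmx (mlink_in_group Q e)) -mlink_adj.
by rewrite -mulmxA mxtrace_mulC -!mulmxA mlinkV mulmx1.
Qed.

(* The two parts of the action of the plaquette q on the word f :: b: [direct]
   comes from the flip, [twisted] from the transposition. *)
Let direct Q b q : R[i] := \sum_(x <- splits q)
  if x.1.2 == f then - \tr (hol (mlink Q) ((f :: b) ++ f :: x.2 ++ x.1.1))
  else if x.1.2 == rev_edge f then \tr (hol (mlink Q) (b ++ x.2 ++ x.1.1)) else 0.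

Let twisted Q b q : R[i] := \sum_(x <- splits q)
  if x.1.2 == f then \tr (hol (mlink Q) (b ++ invw (x.2 ++ x.1.1)))
  else if x.1.2 == rev_edge f then
    - \tr (hol (mlink Q) ((f :: b) ++ f :: invw (x.2 ++ x.1.1))) else 0.

Hypothesis fV : rev_edge f != f.

(** The transposition replaces the inserted word by its inverse, and inverting a
    plaquette also exchanges the letters f and f^-1: the two operations cancel. *)
Lemma twisted_invw Q b q : twisted Q b (invw q) = direct Q b q.
Proof.
rewrite /twisted /direct splits_invw big_rev big_map; apply: eq_bigr => -[[pre e] post] _ /=.
rewrite -invw_cat invwK.
have -> : (rev_edge e == f) = (e == rev_edge f).
  by apply/eqP/eqP => [<-|->]; rewrite rev_edgeK.
have -> : (rev_edge e == rev_edge f) = (e == f).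
  by apply/eqP/eqP => [/(congr1 (@rev_edge d))|->//]; rewrite !rev_edgeK.
by have [->|//] := eqVneq e f; rewrite eq_sym (negbTE fV).
Qed.

Lemma so_merging Q b q :
  merging f (c := so_coef) (X := so_gen) Q b q = direct Q b q + twisted Q b q.
Proof.
rewrite /merging (merging_sum f (mlinkV Q) so_casimir) /direct /twisted -big_split.
apply: eq_bigr => x _ /=; rewrite /rho2.
case: ifP => _.
  rewrite so_form_mull so_form_mulr if_same -SO_trace_inv_cat addrC.
  by [].
case: ifP => _; last by rewrite addr0.
congr (_ - _); rewrite so_form_mull so_form_mulr if_same.
set o := x.2 ++ x.1.1.
have inv_o : (f :: invw o) ++ [:: f] = invw (rev_edge f :: o ++ [:: rev_edge f]).
  by rewrite invw_cons invw_cat -cats1 /invw /= !rev_edgeK.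
have -> : \tr (mlink Q f *m hol (mlink Q) (b ++ f :: invw o)) =
    \tr (hol (mlink Q) (b ++ invw (rev_edge f :: o ++ [:: rev_edge f]))).
  by rewrite -inv_o catA -(trace_holC _ [:: f]).
by rewrite SO_trace_inv_cat /= hol_cat /= mulmx1 mulmxA.
Qed.

(** The terms in which the word and the plaquette stay apart have opposite
    signs for [p] and [invw p], and the two traces agree. *)
Lemma so_plaquette_sum Q b p :
  plaquette_sum f Q b p + plaquette_sum f Q b (invw p) = direct Q b p + direct Q b (invw p).
Proof.
pose E q := \sum_(x <- splits q) (N%:R^-1 * (\tr (hol (mlink Q) (f :: b)) * \tr (hol (mlink Q) p)))
   * (if x.1.2 == f then 1 else if x.1.2 == rev_edge f then -1 else 0).
have H q : \tr (hol (mlink Q) q) = \tr (hol (mlink Q) p) -> plaquette_sum f Q b q = direct Q b q + E q.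
  move=> qp; rewrite /plaquette_sum /direct /E -big_split; apply: eq_bigr => x _ /=.
  rewrite qp; case: ifP => _; last case: ifP => _; by ring.
have Einv : E (invw p) = - E p.
  rewrite /E splits_invw big_rev big_map -sumrN; apply: eq_bigr => -[[pre e] post] _ /=.
  have -> : (rev_edge e == f) = (e == rev_edge f).
    by apply/eqP/eqP => [<-|->]; rewrite rev_edgeK.
  have -> : (rev_edge e == rev_edge f) = (e == f).
    by apply/eqP/eqP => [/(congr1 (@rev_edge d))|->//]; rewrite !rev_edgeK.
  have [->|_] := eqVneq e f; first by rewrite eq_sym (negbTE fV) mulrN.
  by case: ifP => _; ring.
rewrite H // H ?SO_trace_inv // Einv; ring.
Qed.

(** By [twisted_invw] the twisted part of one orientation is the direct part of
    the other one, so the sum over both orientations counts every deformation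
    twice; this compensates the factor 1/2 of the real part. *)
Lemma so_plaquette_rule Q b p :
  (beta / 2)%:C * (merging f (c := so_coef) (X := so_gen) Q b p + merging f (c := so_coef) (X := so_gen) Q b (invw p)) =
  beta%:C * (plaquette_sum f Q b p + plaquette_sum f Q b (invw p)).
Proof.
rewrite !so_merging so_plaquette_sum twisted_invw -{2}(invwK p) twisted_invw.
have -> : (beta / 2)%:C = beta%:C / 2 by rewrite rmorphM fmorphV rmorph_nat.
by field.
Qed.

End SOPlaquette.

(** * The special unitary case *)

Section SUGenerators.
Context {R : realType} {N : nat}.
Local Notation M := 'M[R[i]]_N.
Local Notation G := (SU R N).
Implicit Types (i j : 'I_N).

Definition symm i j : M := delta_mx i j + delta_mx j i.
Definition dgnl i j : M := delta_mx i i - delta_mx j j.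

Lemma symm_cube i j : i != j -> symm i j *m symm i j *m symm i j = symm i j.
Proof.
move=> ij; have ji : (j == i) = false by rewrite eq_sym; apply/negbTE.
have -> : symm i j *m symm i j = delta_mx i i + delta_mx j j.
  rewrite /symm !(mulmxDl, mulmxDr) !mul_delta_mx_cond !(negbTE ij, ji, eqxx) /=.
  by rewrite !(mulr0n, mulr1n, add0r, addr0).
rewrite /symm !(mulmxDl, mulmxDr) !mul_delta_mx_cond.
by rewrite !(negbTE ij, ji, eqxx) !(mulr0n, mulr1n) /= !(addr0, add0r).
Qed.

Lemma dgnl_cube i j : i != j -> dgnl i j *m dgnl i j *m dgnl i j = dgnl i j.
Proof.
move=> ij; have ji : (j == i) = false by rewrite eq_sym; apply/negbTE.
have -> : dgnl i j *m dgnl i j = delta_mx i i + delta_mx j j.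
  rewrite /dgnl !(mulmxBl, mulmxBr) !mul_delta_mx_cond !(negbTE ij, ji, eqxx) /=.
  by rewrite !(mulr0n, mulr1n, sub0r, subr0, opprK).
rewrite /dgnl !(mulmxDl, mulmxBr) !mul_delta_mx_cond.
by rewrite !(negbTE ij, ji, eqxx) !(mulr0n, mulr1n) /= !(subr0, sub0r).
Qed.

(** For each pair of distinct indices: a real rotation, an imaginary rotation and
    a traceless diagonal element.  The diagonal elements are not independent; the
    whole family, with coefficient 1/(2N), gives the traceless part of the
    diagonal tensor.  The symmetric element is traceless only for distinct
    indices, hence the first test. *)
Definition su_gen (k : 'I_N * 'I_N * 'I_3) : M :=
  if k.1.1 == k.1.2 then 0
  else match val k.2 with
  | 0 => asym k.1.1 k.1.2
  | 1 => 'i *: symm k.1.1 k.1.2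
  | _ => 'i *: dgnl k.1.1 k.1.2
  end.

Definition su_coef (k : 'I_N * 'I_N * 'I_3) : R[i] :=
  if (val k.2 < 2)%N then 4^-1 else (2 * N%:R)^-1.

Definition su_form (A B : M) : R[i] := N%:R^-1 * (\tr A * \tr B).

Lemma scale_i_cube (A : M) : A *m A *m A = A ->
  ('i *: A) *m ('i *: A) *m ('i *: A) = - ('i *: A).
Proof.
move=> A3; rewrite -!(scalemxAl, scalemxAr) A3 !scalerA -scaleNr; congr (_ *: _).
by rewrite ?mulrA -expr2 sqr_i mulN1r.
Qed.

Lemma su_gen_cube k : su_gen k *m su_gen k *m su_gen k = - su_gen k.
Proof.
rewrite /su_gen; case: ifPn => ij; first by rewrite !mul0mx oppr0.
case: (val k.2) => [|[|_]]; first exact: asym_cube.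
- exact/scale_i_cube/symm_cube.
- exact/scale_i_cube/dgnl_cube.
Qed.

Lemma adj_scale_i (A : M) : adj A = A -> adj ('i *: A) = - ('i *: A).
Proof.
move=> aA; apply/matrixP => i j.
have aji : A i j = conjc (A j i) by rewrite -adjE aA.
rewrite adjE [RHS]mxE [X in - X]mxE mxE aji; case: (A j i) => x y.
by apply/eqP; rewrite eq_complex /=; apply/andP; split; apply/eqP; ring.
Qed.

Lemma adj_delta i j : adj (delta_mx i j : M) = delta_mx j i.
Proof.
apply/matrixP => p q; rewrite adjE !mxE rmorph_nat.
by rewrite andbC.
Qed.

Lemma su_gen_adj k : adj (su_gen k) = - su_gen k.
Proof.
have aN (A : M) : adj (- A) = - adj A.
  by apply/matrixP => i j; rewrite adjE [RHS]mxE adjE mxE rmorphN.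
rewrite /su_gen; case: ifPn => ij; first by rewrite adj_zero oppr0.
case: (val k.2) => [|[|_]].
- by rewrite /asym adjD aN !adj_delta opprB.
- by apply: adj_scale_i; rewrite /symm adjD !adj_delta addrC.
- by apply: adj_scale_i; rewrite /dgnl adjD aN !adj_delta.
Qed.

(** A reflection changes the sign of one coordinate, which reverses both kinds of
    rotation; a transposition reverses the diagonal element. *)
Lemma su_gen_flip k :
  exists F : M, GRing.lreg (\det F) /\ F *m su_gen k = - (su_gen k *m F).
Proof.
have lregF (F : M) : F *m F = 1%:M -> GRing.lreg (\det F).
  move=> FF; apply: mulfI; apply/eqP => d0.
  have := congr1 determinant FF; rewrite det_mulmx d0 mul0r det1.
  by move/eqP; rewrite eq_sym oner_eq0.
rewrite /su_gen; have [ij|ij] := eqVneq k.1.1 k.1.2.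
  exists 1%:M; rewrite det1 mulmx0 mul0mx oppr0; split => //.
  exact: lreg1.
set i := k.1.1 in ij *; set j := k.1.2 in ij *.
have ji : (j == i) = false by rewrite eq_sym; apply/negbTE.
pose D : M := 1%:M - 2 *: delta_mx i i.
have DD : D *m D = 1%:M.
  rewrite /D mulmxBl !mulmxBr !mul1mx mulmx1 -!(scalemxAl, scalemxAr).
  rewrite mul_delta_mx scalerA; apply/matrixP => p q; rewrite !mxE; ring.
have Dij : D *m delta_mx i j = - delta_mx i j.
  rewrite /D mulmxBl mul1mx -scalemxAl mul_delta_mx scaler_nat mulr2n.
  by rewrite opprD addrA subrr sub0r.
have ijD : delta_mx i j *m D = delta_mx i j.
  by rewrite /D mulmxBr mulmx1 -scalemxAr mul_delta_mx_cond ji mulr0n scaler0 subr0.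
have Dji : D *m delta_mx j i = delta_mx j i.
  by rewrite /D mulmxBl mul1mx -scalemxAl mul_delta_mx_cond (negbTE ij) mulr0n scaler0 subr0.
have jiD : delta_mx j i *m D = - delta_mx j i.
  rewrite /D mulmxBr mulmx1 -scalemxAr mul_delta_mx scaler_nat mulr2n.
  by rewrite opprD addrA subrr sub0r.
clearbody D; case: (val k.2) => [|[|_]].
- exists D; split; first exact: lregF.
  by rewrite /asym mulmxBl mulmxBr Dij ijD Dji jiD opprK opprD.
- exists D; split; first exact: lregF.
  rewrite -scalemxAl -scalemxAr -scalerN; congr (_ *: _).
  by rewrite /symm mulmxDl mulmxDr Dij ijD Dji jiD opprD opprK.
exists (tperm_mx i j); split.
  apply: lregF; rewrite -perm_mxM (_ : (tperm i j * tperm i j = 1)%g) ?perm_mx1 //.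
  by apply/permP => x; rewrite permM perm1 tpermK.
rewrite -scalemxAl -scalemxAr -scalerN; congr (_ *: _).
rewrite -xrowE -xcolE; apply/matrixP => p q; rewrite !mxE.
have e1 x : (tperm i j x == i) = (x == j) by rewrite -{2}(tpermR i j) (inj_eq perm_inj).
have e2 x : (tperm i j x == j) = (x == i) by rewrite -{2}(tpermL i j) (inj_eq perm_inj).
by rewrite !e1 !e2 opprB.
Qed.

Lemma curve_SU k t : ugset G (curve (su_gen k) t).
Proof.
have [F [regF FX]] := su_gen_flip k.
split; first exact: (curve_unitary t (su_gen_cube k) (su_gen_adj k)).
apply: (det_rotation_sqr (su_gen_cube k) _ regF FX).
by rewrite -(rmorph_nat (real_complex R)) -!rmorphXn -!rmorphM -!rmorphD rsin_rvers.
Qed.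

Definition su_curve k t : uelt G := mk_uelt (curve_SU k t).

Hypothesis N_gt0 : (0 < N)%N.

Let N_neq0 : (N%:R : R[i]) != 0.
Proof. by rewrite pnatr_eq0 -lt0n. Qed.

(** The Casimir tensor of su(N): the trace part, divided by N, minus the flip. *)
Lemma su_casimir (A B : M) :
  \sum_k su_coef k * (\tr (su_gen k *m A) * \tr (su_gen k *m B)) =
  su_form A B - \tr (A *m B).
Proof.
rewrite -(pair_bigA _ (fun ij l => su_coef (ij, l) *
  (\tr (su_gen (ij, l) *m A) * \tr (su_gen (ij, l) *m B)))) /=.
rewrite -(pair_bigA _ (fun i j => \sum_(l < 3) su_coef ((i, j), l) *
  (\tr (su_gen ((i, j), l) *m A) * \tr (su_gen ((i, j), l) *m B)))) /=.
have i2 : 'i * 'i = -1 :> R[i] by rewrite -expr2 sqr_i.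
have E i j : \sum_(l < 3) su_coef ((i, j), l) *
  (\tr (su_gen ((i, j), l) *m A) * \tr (su_gen ((i, j), l) *m B)) =
  - 2^-1 * (A j i * B i j + A i j * B j i) + (if i == j then A i j * B j i else 0)
  - (2 * N%:R)^-1 * ((A i i - A j j) * (B i i - B j j)).
  rewrite !big_ord_recl big_ord0 /su_gen /su_coef /=.
  have [->|ij] := eqVneq i j.
    rewrite !mul0mx !linear0; field; exact: N_neq0.
  have trB (A' : M) : \tr (('i *: symm i j) *m A') = 'i * (A' j i + A' i j).
    by rewrite -scalemxAl linearZ /= /symm mulmxDl raddfD /= !tr_delta_mulmx.
  have trC (A' : M) : \tr (('i *: dgnl i j) *m A') = 'i * (A' i i - A' j j).
    by rewrite -scalemxAl linearZ /= /dgnl mulmxBl raddfB /= !tr_delta_mulmx.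
  rewrite !tr_asym_mulmx !trB !trC.
  have iM x y : 'i * x * ('i * y) = - (x * y) :> R[i] by rewrite mulrACA i2 mulN1r.
  rewrite !iM; field; exact: N_neq0.
under eq_bigr => i _ do under eq_bigr => j _ do rewrite E.
pose S2 := \sum_i \sum_j (A i j * B j i).
pose Dg := \sum_i A i i * B i i.
have t1 : \sum_i \sum_j A j i * B i j = S2 by rewrite exchange_big.
have t2 : \sum_i \sum_j (if i == j then A i j * B j i else 0) = Dg.
  apply: eq_bigr => i _; rewrite -big_mkcond (big_pred1 i) // => j; exact: eq_sym.
have t3 : \sum_i \sum_j ((A i i - A j j) * (B i i - B j j)) =
    2 * N%:R * Dg - 2 * (\tr A * \tr B).
  have -> : \sum_i \sum_j ((A i i - A j j) * (B i i - B j j)) =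
     \sum_i \sum_(j < N) (A i i * B i i) + \sum_(i < N) \sum_j (A j j * B j j)
     - (\sum_i \sum_j (A i i * B j j) + \sum_i \sum_j (A j j * B i i)).
    rewrite -!big_split -sumrB; apply: eq_bigr => i _ /=.
    rewrite -!big_split -sumrB; apply: eq_bigr => j _ /=; ring.
  have -> : \sum_i \sum_j (A i i * B j j) = \tr A * \tr B.
    by rewrite mulr_suml; apply: eq_bigr => i _; rewrite mulr_sumr.
  have -> : \sum_i \sum_j (A j j * B i i) = \tr A * \tr B.
    by rewrite exchange_big mulr_suml; apply: eq_bigr => i _; rewrite mulr_sumr.
  have -> : \sum_i \sum_(j < N) (A i i * B i i) = N%:R * Dg.
    by rewrite mulr_sumr; apply: eq_bigr => i _; rewrite sumr_const card_ord mulr_natl.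
  have -> : \sum_(i < N) \sum_j (A j j * B j j) = N%:R * Dg.
    by rewrite sumr_const card_ord mulr_natl.
  ring.
have tS : \tr (A *m B) = S2 by rewrite mxtrace_mulE.
transitivity (- 2^-1 * (\sum_i \sum_j A j i * B i j + S2) + Dg
   - (2 * N%:R)^-1 * \sum_i \sum_j ((A i i - A j j) * (B i i - B j j))).
  rewrite -t2 /S2 -big_split !mulr_sumr -big_split -sumrB; apply: eq_bigr => i _ /=.
  by rewrite -big_split !mulr_sumr -big_split -sumrB; apply: eq_bigr => j _.
rewrite t1 t3 tS /su_form; field; exact: N_neq0.
Qed.

Definition su_square (A : M) : M :=
  \matrix_(i, j) (\sum_p \sum_q A p q * su_form (delta_mx p i) (delta_mx j q)).

Lemma su_squareE A : su_square A = N%:R^-1 *: A.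
Proof.
have tE p q : \tr (delta_mx p q : M) = (p == q)%:R.
  by rewrite -[delta_mx p q]mulmx1 tr_delta_mulmx mxE eq_sym.
apply/matrixP => i j; rewrite !mxE.
rewrite (bigD1 i) //= [X in _ + X]big1 ?addr0 => [|p pi].
  rewrite (bigD1 j) //= big1 ?addr0 => [|q qj].
    by rewrite /su_form !tE !eqxx !mulr1 mulrC.
  by rewrite /su_form !tE (eq_sym j) (negbTE qj) !mulr0.
by rewrite big1 // => q _; rewrite /su_form !tE (negbTE pi) mul0r !mulr0.
Qed.

Let invN : normc (N%:R^-1 : R[i]) = N%:R^-1.
Proof. by rewrite normcV normc_nat. Qed.

Let N_pos : 0 < N%:R :> R.
Proof. by rewrite ltr0n. Qed.

Lemma su_form_bound A A' : ugset G A -> ugset G A' -> normc (su_form A A') <= N%:R.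
Proof.
move=> GA GA'; rewrite /su_form !normcM invN mulrC ler_pdivrMr //.
by rewrite ler_pM ?normc_ge0 // normc_tr_unitary // (ug_unitary (u := G)).
Qed.

Lemma su_square_bound A A' : ugset G A -> ugset G A' ->
  normc (\tr (su_square A *m A')) <= N%:R.
Proof.
move=> GA GA'; rewrite su_squareE -scalemxAl linearZ /= normcM invN mulrC ler_pdivrMr //.
apply: (@le_trans _ _ N%:R); last by rewrite ler_peMr ?ler1n // ltW.
apply: normc_tr_unitary; apply: (ug_unitary (u := G)); exact: ugM.
Qed.

Lemma su_square_one : su_square 1%:M = N%:R^-1%:M.
Proof. by rewrite su_squareE scalemx1. Qed.

Lemma su_square_one_le1 : normc (N%:R^-1 : R[i]) <= 1.
Proof. by rewrite invN invf_le1 // ler1n. Qed.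

Section Plaquette.
Context {d : nat} {L : {fset site d}}.
Variables (beta : R) (f : edge d).
Implicit Types (Q : config G L) (b p q : seq (edge d)).

(** The trace part gives the product of the two traces divided by N, which is
    exactly the paired term of the loop equation. *)
Lemma su_merging Q b q :
  merging f (c := su_coef) (X := su_gen) Q b q = plaquette_sum f Q b q.
Proof.
rewrite /merging (merging_sum f (mlinkV Q) su_casimir) /plaquette_sum.
rewrite big_seq [RHS]big_seq; apply: eq_bigr => x /splitsP qE /=.
have rE A A' : rho2 (mlink Q) f su_form A A' =
    N%:R^-1 * (\tr (mlink Q f *m A) * \tr (mlink Q f *m A')).
  rewrite /rho2 /su_form; case: (pos_edge f) => //.
  by rewrite (mxtrace_mulC A) (mxtrace_mulC A').
rewrite !rE; case: ifP => [/eqP xf|_].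
  rewrite addrC; congr (_ + _ * (_ * _)).
  by rewrite qE xf (trace_holC _ x.1.1).
case: ifP => [/eqP xf|_] //.
congr (_ - _ * (_ * _)).
rewrite !mulmxA mlinkV mul1mx qE xf (trace_holC _ x.1.1) /= mxtrace_mulC.
by [].
Qed.

Lemma su_plaquette_rule Q b p :
  (2 * beta / 2)%:C * (merging f (c := su_coef) (X := su_gen) Q b p +
     merging f (c := su_coef) (X := su_gen) Q b (invw p)) =
  beta%:C * (plaquette_sum f Q b p + plaquette_sum f Q b (invw p)).
Proof.
by rewrite !su_merging (_ : 2 * beta / 2 = beta) //; field.
Qed.

End Plaquette.
End SUGenerators.

(** * Approximate solutions of a contracting equation *)

Section Eventually.

Lemma eventually_all (T : eqType) (l : seq T) (P : T -> nat -> Prop) :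
  (forall t, t \in l -> exists n0, forall n, (n0 <= n)%N -> P t n) ->
  exists n0, forall n, (n0 <= n)%N -> forall t, t \in l -> P t n.
Proof.
elim: l => [|a l IH] H; first by exists 0%N.
have [n1 h1] := H a (mem_head _ _).
have [|n2 h2] := IH; first by move=> t tl; apply: H; rewrite inE tl orbT.
exists (maxn n1 n2) => n; rewrite geq_max => /andP[le1 le2] t.
by rewrite inE => /orP[/eqP ->|tl]; [exact: h1|exact: h2].
Qed.

Lemma half_pow_small {R : realType} (e C : R) : 0 < e -> exists k, 2^-1 ^+ k * C <= e.
Proof.
move=> e0; pose x := `|C| / e; have x0 : 0 <= x by rewrite divr_ge0 // ltW.
exists (Num.bound x); set k := Num.bound x.
have xk : x < k%:R by exact: archi_boundP.
have kk : k%:R <= 2 ^+ k :> R by rewrite -natrX ler_nat ltnW // ltn_expl.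
rewrite exprVn mulrC ler_pdivrMr ?exprn_gt0 //.
apply: le_trans (ler_norm _) _; rewrite mulrC -ler_pdivrMr //.
exact: le_trans (ltW xk) kk.
Qed.

Lemma real_cauchy_limit {R : realType} (u : nat -> R) :
  (forall e : R, 0 < e -> exists n0, forall m n, (n0 <= m)%N -> (n0 <= n)%N ->
     `|u m - u n| <= e) ->
  exists w, forall e : R, 0 < e -> exists n0, forall n, (n0 <= n)%N -> `|u n - w| <= e.
Proof.
move=> H; have cu : cvg (u @ \oo).
  apply/cauchy_cvgP/cauchy_ballP => e e0.
  have e2 : 0 < e / 2 by rewrite divr_gt0.
  have [n0 h] := H _ e2.
  exists (u @` [set m | (n0 <= m)%N], u @` [set m | (n0 <= m)%N]) => /=.
    by split; exists n0 => // m mn; exists m.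
  move=> [_ _] /= [[m mn <-] [n nn <-]]; rewrite /ball /=.
  by apply: le_lt_trans (h _ _ mn nn) _; rewrite ltr_pdivrMr // ltr_pMr // ltr1n.
exists (lim (u @ \oo)) => e e0.
have /cvgrPdist_le /(_ e e0) [n0 _ h] := cu.
by exists n0 => n nn; rewrite distrC; exact: h.
Qed.

Lemma complex_cauchy_limit {R : realType} (u : nat -> R[i]) :
  (forall e : R, 0 < e -> exists n0, forall m n, (n0 <= m)%N -> (n0 <= n)%N ->
     normc (u m - u n) <= e) ->
  exists w, forall e : R, 0 < e -> exists n0, forall n, (n0 <= n)%N ->
    normc (u n - w) <= e.
Proof.
move=> H.
have ReB (z w : R[i]) : complex.Re (z - w) = complex.Re z - complex.Re w by case: z w => [? ?] [].
have ImB (z w : R[i]) : complex.Im (z - w) = complex.Im z - complex.Im w by case: z w => [? ?] [].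
have [|a ha] := @real_cauchy_limit R (fun n => complex.Re (u n)).
  move=> e /H [n0 h]; exists n0 => m n mn nn; rewrite -ReB.
  exact: le_trans (Re_le_normc _) (h _ _ mn nn).
have [|b hb] := @real_cauchy_limit R (fun n => complex.Im (u n)).
  move=> e /H [n0 h]; exists n0 => m n mn nn; rewrite -ImB.
  exact: le_trans (Im_le_normc _) (h _ _ mn nn).
exists (a +i* b) => e e0; have e2 : 0 < e / 2 by rewrite divr_gt0.
have [n1 h1] := ha _ e2; have [n2 h2] := hb _ e2.
exists (maxn n1 n2) => n; rewrite geq_max => /andP[/h1 k1 /h2 k2].
apply: le_trans (normc_le_ReIm _) _; rewrite ReB ImB /=; lra.
Qed.

End Eventually.

Section Contraction.
Context {R : realType} {d : nat}.
Local Notation S := (seq (seq (edge d))).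
Variables (good : S -> Prop) (cst : S -> R[i]) (terms : S -> seq (R * S)) (W : S -> R).

(** A family indexed by n that satisfies s = cst + sum of terms up to an error
    tending to zero for each fixed s, with no uniformity in s. *)
Definition approximate_solution (phi : nat -> S -> R[i]) := forall s, good s ->
  forall e : R, 0 < e -> exists n0, forall n, (n0 <= n)%N ->
    normc (phi n s - (cst s + lincomb (phi n) (terms s))) <= e.

Hypothesis W_ge1 : forall s, 1 <= W s.
Hypothesis terms_good : forall s, good s -> forall t, t \in terms s -> good t.2.
Hypothesis contraction : forall s, good s ->
  \sum_(t <- terms s) `|t.1| * W t.2 <= 2^-1 * W s.

Fixpoint picard k s : R[i] :=
  if k is k'.+1 then cst s + lincomb (picard k') (terms s) else 0.

(** Each use of the equation involves finitely many s', so the errors can be made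
    small simultaneously, and the contraction halves the weighted distance to the
    Picard iterates.  The iterates do not depend on the family. *)
Lemma picard_approx (phi : nat -> S -> R[i]) :
  approximate_solution phi -> (forall n s, normc (phi n s) <= 2) ->
  forall k s, good s -> forall e : R, 0 < e -> exists n0, forall n, (n0 <= n)%N ->
    normc (phi n s - picard k s) <= 2^-1 ^+ k * (2 * W s) + e.
Proof.
move=> sol phi2; elim=> [|k IH] s gs e e0.
  exists 0%N => n _; rewrite /= subr0 expr0 mul1r.
  apply: le_trans (phi2 _ _) _; have := W_ge1 s; lra.
pose c := 1 + \sum_(t <- terms s) `|t.1|.
have c1 : 1 <= c by rewrite lerDl sumr_ge0.
have e2 : 0 < e / 2 by rewrite divr_gt0.
have ec : 0 < e / (2 * c) by rewrite divr_gt0 // mulr_gt0 //; lra.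
have [n1 h1] := sol s gs _ e2.
have [n2 h2] := @eventually_all _ (terms s)
  (fun t n => normc (phi n t.2 - picard k t.2) <= 2^-1 ^+ k * (2 * W t.2) + e / (2 * c))
  (fun t ts => IH t.2 (terms_good gs ts) _ ec).
exists (maxn n1 n2) => n; rewrite geq_max => /andP[/h1 k1 /h2 k2].
have -> : phi n s - picard k.+1 s =
  (phi n s - (cst s + lincomb (phi n) (terms s))) +
  \sum_(t <- terms s) t.1%:C * (phi n t.2 - picard k t.2).
  have -> : \sum_(t <- terms s) t.1%:C * (phi n t.2 - picard k t.2) =
      lincomb (phi n) (terms s) - lincomb (picard k) (terms s).
    by rewrite /lincomb -sumrB; apply: eq_bigr => t _; rewrite mulrBr.
  by rewrite /=; ring.
apply: le_trans (normcD _ _) _.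
have : normc (\sum_(t <- terms s) t.1%:C * (phi n t.2 - picard k t.2)) <=
    \sum_(t <- terms s) (2^-1 ^+ k * 2 * (`|t.1| * W t.2) + `|t.1| * (e / (2 * c))).
  apply: le_trans (normc_sum _ _ _) _; rewrite big_seq [leRHS]big_seq.
  apply: ler_sum => t ts; rewrite normcM normc_real.
  apply: le_trans (ler_wpM2l (normr_ge0 _) (k2 t ts)) _; lra.
rewrite big_split /= -mulr_sumr -mulr_suml => k3.
have hk : 0 <= 2^-1 ^+ k * 2 :> R by rewrite mulr_ge0 // exprn_ge0 // invr_ge0.
have k4 := ler_wpM2l hk (contraction gs).
have k5 : (\sum_(t <- terms s) `|t.1|) * (e / (2 * c)) <= e / 2.
  have -> : e / 2 = c * (e / (2 * c)) by field; lra.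
  by rewrite ler_wpM2r ?(ltW ec) // /c; lra.
rewrite exprS; lra.
Qed.

(** The Picard iterates are Cauchy because any approximate solution stays within
    2 ^ (- k) of the k-th iterate; two families share the iterates, hence the
    limit. *)
Theorem common_limit (phi psi : nat -> S -> R[i]) :
  approximate_solution phi -> (forall n s, normc (phi n s) <= 2) ->
  approximate_solution psi -> (forall n s, normc (psi n s) <= 2) ->
  forall s, good s -> exists w, forall e : R, 0 < e -> exists n0, forall n, (n0 <= n)%N ->
    normc (phi n s - w) <= e /\ normc (psi n s - w) <= e.
Proof.
move=> solphi phi2 solpsi psi2 s gs.
have [|w hw] := @complex_cauchy_limit R (fun k => picard k s).
  move=> e e0; have e4 : 0 < e / 4 by rewrite divr_gt0.
  have [k0 hk0] := half_pow_small (2 * W s) e4.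
  have hk k : (k0 <= k)%N -> 2^-1 ^+ k * (2 * W s) <= e / 4.
    move=> kk; apply: le_trans hk0; rewrite ler_wpM2r //; first by have := W_ge1 s; lra.
    by rewrite ler_wiXn2l // ?invr_ge0 // invf_le1 // ler1n.
  exists k0 => k l kk ll.
  have [n1 h1] := picard_approx solphi phi2 k gs e4.
  have [n2 h2] := picard_approx solphi phi2 l gs e4.
  have {}h1 := h1 _ (leq_maxl n1 n2); have {}h2 := h2 _ (leq_maxr n1 n2).
  set z := phi _ _ in h1 h2.
  have -> : picard k s - picard l s = (z - picard l s) - (z - picard k s) by ring.
  apply: le_trans (normcB _ _) _; have := hk _ kk; have := hk _ ll; lra.
exists w => e e0; have e3 : 0 < e / 3 by rewrite divr_gt0.
have [k1 h1] := hw _ e3; have [k2 hk2] := half_pow_small (2 * W s) e3.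
set k := maxn k1 k2; have {}h1 := h1 k (leq_maxl _ _).
have h2 : 2^-1 ^+ k * (2 * W s) <= e / 3.
  apply: le_trans hk2; rewrite ler_wpM2r //; first by have := W_ge1 s; lra.
  by rewrite ler_wiXn2l // ?invr_ge0 ?leq_maxr // invf_le1 // ler1n.
have [n1 hn1] := picard_approx solphi phi2 k gs e3.
have [n2 hn2] := picard_approx solpsi psi2 k gs e3.
exists (maxn n1 n2) => n; rewrite geq_max => /andP[/hn1 m1 /hn2 m2].
have E z : z - w = (z - picard k s) + (picard k s - w) by ring.
by split; rewrite E; apply: le_trans (normcD _ _) _; lra.
Qed.

End Contraction.

(** * Weights and convolution estimates *)

Section Weight.
Context {R : realType}.

(** The exponential beats the length changes in the plaquette terms and makes
    all weights at least 1; the inverse square makes the weight almost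
    submultiplicative under convolution.  Empty words have weight 1 because they
    may be inserted freely. *)
Definition wt (n : nat) : R := if n is m.+1 then 64 ^+ m / n%:R ^+ 2 else 1.

Let nat1 n : (n.+1%:R : R) = n%:R + 1.
Proof. by rewrite -natr1. Qed.

Let sq_gt0 n : 0 < n.+1%:R ^+ 2 :> R.
Proof. by rewrite exprn_gt0. Qed.

Lemma wt_ge1 n : 1 <= wt n.
Proof.
case: n => [|n] //=; rewrite ler_pdivlMr // mul1r -natrX -natrX ler_nat.
elim: n => // n IH; rewrite (expnS 64).
apply: (@leq_trans (64 * n.+1 ^ 2)); last by rewrite leq_mul2l IH.
by rewrite (_ : 64 = 8 ^ 2)%N // -expnMn leq_exp2r // mulnS -addn2 addnC leq_add // leq_pmull.
Qed.

Lemma wt_ge0 n : 0 <= wt n.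
Proof. exact: le_trans ler01 (wt_ge1 n). Qed.

Lemma sum_inv_sq m : \sum_(j < m) (j.+1%:R ^+ 2)^-1 <= 2 :> R.
Proof.
case: m => [|m]; first by rewrite big_ord0.
suff : \sum_(j < m.+1) (j.+1%:R ^+ 2)^-1 <= 2 - (m.+1%:R)^-1 :> R.
  by move=> H; apply: le_trans H _; rewrite gerBl.
elim: m => [|m IH]; first by rewrite big_ord1 expr1n invr1; lra.
rewrite big_ord_recr /=; apply: le_trans (lerD IH (lexx _)) _.
rewrite (nat1 m.+1); set x : R := m.+1%:R; have x1 : 1 <= x by rewrite /x ler1n.
rewrite -subr_ge0.
have -> : 2 - (x + 1)^-1 - (2 - x^-1 + ((x + 1) ^+ 2)^-1) = (x * (x + 1) ^+ 2)^-1.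
  by field; lra.
by rewrite invr_ge0 mulr_ge0 ?exprn_ge0 //; lra.
Qed.

(** From 1/(x y) = (1/x + 1/y)/(x + y) and the summability of inverse
    squares; the factor 64 gained by splitting off one word pays for the constant. *)
Lemma convolution_interior m :
  \sum_(j < m) wt j.+1 * wt (m - j) <= 8^-1 * wt m.+1.
Proof.
case: m => [|m]; first by rewrite big_ord0 mulr_ge0 ?wt_ge0 ?invr_ge0.
pose n : R := m.+2%:R; have n0 : 0 < n by rewrite ltr0n.
have term (j : 'I_m.+1) : wt j.+1 * wt (m.+1 - j) <=
    64 ^+ m * (2 / n ^+ 2) * ((j.+1%:R ^+ 2)^-1 + ((rev_ord j).+1%:R ^+ 2)^-1).
  have jm : (j <= m)%N by rewrite -ltnS.
  rewrite /= subSS subSn //= mulrACA -exprD subnKC // -mulrA ler_wpM2l ?exprn_ge0 //.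
  set x : R := j.+1%:R; set y : R := (m - j).+1%:R.
  have x0 : 0 < x by rewrite ltr0n.
  have y0 : 0 < y by rewrite ltr0n.
  have nE : n = x + y by rewrite /n /x /y -natrD addSn addnS subnKC.
  have -> : (x ^+ 2)^-1 / y ^+ 2 = n ^- 2 * (x^-1 + y^-1) ^+ 2.
    by rewrite nE; field; rewrite ?lt0r_neq0 //; lra.
  have h : (x^-1 + y^-1) ^+ 2 <= 2 * ((x ^+ 2)^-1 + (y ^+ 2)^-1).
    rewrite -!exprVn; move: (x^-1) (y^-1) => u v.
    by have := sqr_ge0 (u - v); rewrite sqrrB sqrrD; lra.
  by rewrite [2 / _]mulrC -mulrA ler_wpM2l // invr_ge0 exprn_ge0 // ltW.
apply: le_trans (ler_sum _ (fun j _ => term j)) _.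
rewrite -mulr_sumr big_split /=.
have -> : \sum_(j < m.+1) ((rev_ord j).+1%:R ^+ 2)^-1 = \sum_(j < m.+1) (j.+1%:R ^+ 2)^-1 :> R.
  by rewrite [RHS](reindex_inj rev_ord_inj).
have := sum_inv_sq m.+1; set s := \sum_(_ < _) _ => s2.
have -> : 8^-1 * (64 ^+ m.+1 / n ^+ 2) = 64 ^+ m * (2 / n ^+ 2) * (2 + 2) :> R.
  by rewrite exprS; field; rewrite lt0r_neq0.
apply: ler_wpM2l; last exact: lerD.
by rewrite !mulr_ge0 ?invr_ge0 ?exprn_ge0 // ltW.
Qed.

Lemma wt_add2 p : (0 < p)%N -> 24 * wt p <= wt p.+2.
Proof.
case: p => // p _; rewrite /wt mulrA ler_pdivrMr // mulrAC ler_pdivlMr //.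
rewrite !exprS; set x : R := p.+1%:R.
have x1 : 1 <= x by rewrite /x ler1n.
have -> : (p.+3%:R : R) = x + 2 by rewrite /x !nat1; ring.
rewrite expr0 !mulr1.
have P0 : 0 <= 64 ^+ p :> R by rewrite exprn_ge0.
have h : 24 * ((x + 2) * (x + 2)) <= 64 * 64 * (x * x) by nra.
have := ler_wpM2l P0 h; lra.
Qed.

Arguments wt : simpl never.

(** The pieces may now be empty, but two letters have been erased, so the
    factor 64 ^ 2 is available for the two extreme terms. *)
Lemma convolution_full m :
  \sum_(j < m) wt j * wt (m - j.+1) <= 8^-1 * wt m.+1.
Proof.
case: m => [|[|p]].
- by rewrite big_ord0 mulr_ge0 ?wt_ge0 ?invr_ge0.
- rewrite big_ord1 /wt subnn expr1 mulr1; have -> : 8^-1 * (64 / 2 ^+ 2) = 2 :> R by field.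
  by rewrite ler1n.
rewrite big_ord_recl big_ord_recr /= subn1 /= /bump /= add1n subnn.
have -> : wt 0 = 1 by []; rewrite mul1r mulr1.
have -> : \sum_(i < p) wt (1 + i) * wt (p.+2 - (1 + i).+1) =
    \sum_(i < p) wt i.+1 * wt (p - i).
  by apply: eq_bigr => i _; rewrite add1n !subSS.
have h1 := convolution_interior p; have h2 := wt_add2 (ltn0Sn p).
have h3 := wt_ge0 p.+1. lra.
Qed.

Lemma wt_add n k : (0 < n)%N -> (k <= 4)%N -> wt (n + k) <= 64 ^+ 4 * wt n.
Proof.
case: n => // n _ k4; rewrite /wt addSn mulrA ler_pdivrMr // mulrAC ler_pdivlMr //.
rewrite -exprD ler_pM ?exprn_ge0 //; first by rewrite ler_eXn2l ?ltr1n // addnC leq_add2r.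
by rewrite lerXn2r ?nnegrE // ler_nat ltnS leq_addr.
Qed.

Lemma wt4 : wt 4 <= 64 ^+ 4.
Proof. by rewrite /wt ler_pdivrMr ?exprn_gt0 // !exprS !expr0; lra. Qed.

End Weight.

Arguments wt : simpl never.

(** * Plaquettes through an edge *)

Section PlaquettesThrough.
Local Open Scope quotient_scope.
Context {d : nat}.
Implicit Types (x y : site d) (e f g : edge d) (s : seq (edge d)) (p : loop d).

(** A superset of the nearest neighbours, of size bounded in terms of d alone. *)
Definition neighbours x : seq (site d) :=
  [seq ([tuple tnth x i + (tnth delta i : nat)%:Z - 1 | i < d] : site d)
  | delta : d.-tuple 'I_3].

Lemma size_neighbours x : size (neighbours x) = (3 ^ d)%N.
Proof. by rewrite size_map -cardE card_tuple card_ord. Qed.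

Lemma is_edge_neighbours x y : is_edge (x, y) -> y \in neighbours x.
Proof.
rewrite /is_edge /= => /eqP H.
have le1 i : (`|tnth x i - tnth y i| <= 1)%N.
  by rewrite -H (bigD1 i) //= leq_addr.
pose delta : d.-tuple 'I_3 := [tuple inord `|tnth y i - tnth x i + 1| | i < d].
apply/mapP; exists delta; first by rewrite mem_enum.
apply: eq_from_tnth => i; rewrite !tnth_mktuple inordK; last first.
  move: (le1 i); move: (tnth x i) (tnth y i) => a b; lia.
move: (le1 i); move: (tnth x i) (tnth y i) => a b; lia.
Qed.

Lemma is_edge_rev e : is_edge (rev_edge e) = is_edge e.
Proof. by rewrite /is_edge; congr (_ == _); apply: eq_bigr => i _; rewrite distnC. Qed.

Lemma is_edge_neq e : is_edge e -> e.1 != e.2.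
Proof.
case: e => x y /=; apply: contraTneq => ->; rewrite /is_edge big1 // => i _.
by rewrite subrr.
Qed.

Definition squares g : seq (seq (edge d)) :=
  [seq [:: g; (g.2, y); (y, z); (z, g.1)] | y <- neighbours g.2, z <- neighbours y].

Lemma size_squares g : size (squares g) = (3 ^ d * 3 ^ d)%N.
Proof.
have H r : sumn [seq size (neighbours y) | y <- r] = (size r * 3 ^ d)%N.
  by elim: r => //= y r ->; rewrite mulSn size_neighbours.
by rewrite /squares size_allpairs_dep H size_neighbours.
Qed.

Definition positive_loop p : Prop :=
  exists q : cpath d, pos_plaquette_path (val q) /\ \pi_(loop d) q = p.

Definition squares_through f := squares f ++ squares (rev_edge f).

Definition plaquettes_through f : seq (loop d) :=
  [seq p <- undup [seq \pi_(loop d) (q : cpath d) | q <- pmap insub (squares_through f)]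
   | `[< positive_loop p >]].

(** Once these finitely many vertices belong to the volume, the plaquettes of the
    volume through f no longer depend on it. *)
Definition vertices_through f : seq (site d) :=
  [:: f.1, f.2 & flatten [seq [seq e.1 | e <- s] ++ [seq e.2 | e <- s] | s <- squares_through f]].

Lemma size_plaquettes_through f :
  (size (plaquettes_through f) <= 2 * (3 ^ d * 3 ^ d))%N.
Proof.
rewrite /plaquettes_through size_filter; apply: leq_trans (count_size _ _) _.
apply: leq_trans (size_undup _) _; rewrite size_map size_pmap.
apply: leq_trans (count_size _ _) _; rewrite size_cat !size_squares.
by rewrite mul2n addnn.
Qed.

Lemma pi_rot (q r : cpath d) : \pi_(loop d) q = \pi_(loop d) r ->
  exists k, rot k (val q) = val r.
Proof. by move=> /eqmodP/cyc_equivP. Qed.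

Lemma positive_loop_repr p : positive_loop p -> size (val (repr p)) = 4%N.
Proof.
move=> [q [/andP[/and3P[/eqP sq _ _] _] qp]].
have [k E] : exists k, rot k (val q) = val (repr p).
  by apply: pi_rot; rewrite reprK.
by rewrite -E size_rot.
Qed.

Lemma plaquettes_through_size f p : p \in plaquettes_through f ->
  size (val (repr p)) = 4%N.
Proof. by rewrite mem_filter => /andP[/asboolP h _]; exact: positive_loop_repr. Qed.

Lemma closed_square g s : closed_path (g :: s) -> size s = 3%N -> g :: s \in squares g.
Proof.
case: s => [|[x1 y1] [|[x2 y2] [|[x3 y3] []]]] // /andP[/= /and5P[_ h1 h2 h3 _]].
rewrite !andbT => /and4P[/eqP e1 /eqP e2 /eqP e3 /eqP e4] _.
subst x1 x2 x3 y3; apply/allpairsPdep; exists y1, y2; split => //.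
- exact: is_edge_neighbours.
- exact: is_edge_neighbours.
Qed.

Lemma mem_plaquettes_through L f p : p \in plaquettes L ->
  (f \in val (repr p)) || (rev_edge f \in val (repr p)) -> p \in plaquettes_through f.
Proof.
rewrite /plaquettes in_fset_set; last exact: finite_pos_plaquettes.
rewrite inE => -[q /= /andP[qpos _] qp] touch.
have pl : positive_loop p by exists q.
have sz := positive_loop_repr pl.
have [g gs gr] : exists2 g, g \in val (repr p) & (g = f) \/ (g = rev_edge f).
  by case/orP: touch => h; [exists f|exists (rev_edge f)] => //; [left|right].
have /rot_to[k s E] := gs.
have /andP[cl nb] : closed_path (val (repr p)) && no_backtrack (val (repr p)) := valP (repr p).
have cl' : closed_path (g :: s).
  move: cl; rewrite /closed_path -E rot_cycle => /andP[a ->]; rewrite andbT.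
  by apply/allP => e; rewrite mem_rot => /(allP a).
have nb' : no_backtrack (g :: s) by rewrite /no_backtrack -E rot_cycle.
have sq : g :: s \in squares_through f.
  have ss : size s = 3%N by have := size_rot k (val (repr p)); rewrite E sz /= => -[].
  rewrite mem_cat; have := closed_square cl' ss.
  by case: gr => -> ->; rewrite ?orbT.
have ok : closed_path (g :: s) && no_backtrack (g :: s) by rewrite cl'.
rewrite mem_filter; apply/andP; split; first exact/asboolP.
rewrite mem_undup; apply/mapP; exists (Sub (g :: s) ok : cpath d).
  by rewrite mem_pmap_sub SubK.
rewrite -[LHS](reprK p); apply/eqmodP/cyc_equivP; exists k; rewrite E.
by rewrite SubK.
Qed.

Lemma plaquettes_through_sub (L : {fset site d}) f p :
  (forall x, x \in vertices_through f -> x \in L) ->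
  p \in plaquettes_through f -> p \in plaquettes L.
Proof.
move=> VL; rewrite mem_filter => /andP[/asboolP [q [qpos qp]]].
rewrite mem_undup => /mapP[r rs pr].
rewrite /plaquettes in_fset_set; last exact: finite_pos_plaquettes.
rewrite inE; exists q => //=; apply/andP; split => //.
have [k E] : exists k, rot k (val q) = val r by apply: pi_rot; rewrite qp.
have rs' : val r \in squares_through f by move: rs; rewrite mem_pmap_sub.
apply/allP => e; rewrite -(mem_rot k) E => er.
have V12 x : x \in [seq e.1 | e <- val r] ++ [seq e.2 | e <- val r] -> x \in L.
  move=> xr; apply: VL; rewrite !inE; apply/orP; right; apply/orP; right.
  by apply/flattenP; exists ([seq e.1 | e <- val r] ++ [seq e.2 | e <- val r]) => //; exact: map_f.
apply/andP; split; apply: V12; rewrite mem_cat map_f ?orbT //.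
Qed.

Lemma link_in_volume (L : {fset site d}) f : is_edge f -> f.1 \in L -> f.2 \in L ->
  (if pos_edge f then f else rev_edge f) \in pos_edges L.
Proof.
move=> ef f1 f2; case: ifPn => pf; rewrite pos_edgesP /edge_in.
  by rewrite f1 f2 ef pf.
rewrite is_edge_rev ef f1 f2 /=; move: pf; rewrite /pos_edge /= -leNgt le_eqVlt.
by rewrite eq_sym (negbTE (is_edge_neq ef)).
Qed.

Lemma splits_mem (w : seq (edge d)) t : t \in splits w -> t.1.2 \in w.
Proof. by move=> /splitsP ->; rewrite mem_cat inE eqxx orbT. Qed.

Lemma mem_invw f (w : seq (edge d)) : (f \in invw w) = (rev_edge f \in w).
Proof. by rewrite mem_rev -{1}(rev_edgeK f) mem_map //; exact: (can_inj rev_edgeK). Qed.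

Lemma flatten_nil (T : eqType) (T' : Type) (r : seq T) (F : T -> seq T') :
  (forall t, t \in r -> F t = [::]) -> flatten [seq F t | t <- r] = [::].
Proof.
elim: r => //= a r IH H; rewrite H ?mem_head // IH // => t tr.
by apply: H; rewrite inE tr orbT.
Qed.

Lemma plaquette_terms_nil (R : realType) (beta : R) f b ws (q : seq (edge d)) :
  f \notin q -> rev_edge f \notin q -> plaquette_terms beta f b ws q = [::].
Proof.
move=> fq rq; apply: flatten_nil => t /splits_mem tq.
case: eqP => [E|_]; first by rewrite E (negbTE fq) in tq.
by case: eqP => // E; rewrite E (negbTE rq) in tq.
Qed.

(** Plaquettes avoiding f contribute no terms, and both lists contain the same
    plaquettes touching f. *)
Lemma lincomb_loop_terms (R : realType) (L : {fset site d}) (beta : R) f b ws phi :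
  (forall x, x \in vertices_through f -> x \in L) ->
  lincomb phi (loop_terms beta (plaquettes L) f b ws) =
  lincomb phi (loop_terms beta (plaquettes_through f) f b ws).
Proof.
move=> VL; rewrite !lincomb_cat; congr (_ + _); rewrite !lincomb_flatten.
pose touch p := (f \in val (repr p)) || (rev_edge f \in val (repr p)).
have cut (r : seq (loop d)) : \sum_(p <- r) lincomb phi
    (plaquette_terms beta f b ws (val (repr p)) ++
     plaquette_terms beta f b ws (invw (val (repr p)))) =
   \sum_(p <- r | touch p) lincomb phi
    (plaquette_terms beta f b ws (val (repr p)) ++
     plaquette_terms beta f b ws (invw (val (repr p)))).
  rewrite [RHS]big_mkcond; apply: eq_bigr => p _; case: ifPn => //.
  rewrite negb_or => /andP[h1 h2].
  by rewrite !plaquette_terms_nil ?mem_invw ?rev_edgeK // lincomb_nil.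
rewrite !cut -big_filter -[RHS]big_filter; apply: perm_big; apply: uniq_perm.
- exact/filter_uniq/fset_uniq.
- exact/filter_uniq/filter_uniq/undup_uniq.
move=> p; rewrite [LHS]mem_filter [RHS]mem_filter; case: (boolP (touch p)) => //= tp.
apply/idP/idP => [h|]; last exact: plaquettes_through_sub.
exact: (@mem_plaquettes_through L f p h tp).
Qed.

End PlaquettesThrough.

(** * The loop equation is a contraction *)

Section LoopContraction.
Context {R : realType} {d : nat}.
Implicit Types (ws : seq (seq (edge d))) (f : edge d) (b q : seq (edge d)).
Local Notation terms := (seq (R * seq (seq (edge d)))).

Definition weight ws : R := \prod_(w <- ws) wt (size w).

Lemma weight_cons w ws : weight (w :: ws) = wt (size w) * weight ws.
Proof. by rewrite /weight big_cons. Qed.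

Lemma weight_ge1 ws : 1 <= weight ws.
Proof.
rewrite /weight; elim: ws => [|w ws IH]; first by rewrite big_nil.
by rewrite big_cons -[leLHS]mulr1 ler_pM ?wt_ge1.
Qed.

Lemma weight_ge0 ws : 0 <= weight ws.
Proof. exact: le_trans ler01 (weight_ge1 ws). Qed.

(** The norm of a formal linear combination dual to the weighted sup norm. *)
Definition mass (ts : terms) : R := \sum_(t <- ts) `|t.1| * weight t.2.

Lemma mass_cat ts ts' : mass (ts ++ ts') = mass ts + mass ts'.
Proof. by rewrite /mass big_cat. Qed.

Lemma mass_flatten I (r : seq I) (F : I -> terms) :
  mass (flatten [seq F i | i <- r]) = \sum_(i <- r) mass (F i).
Proof. by rewrite /mass big_flatten big_map. Qed.

Lemma mass_cons t ts : mass (t :: ts) = `|t.1| * weight t.2 + mass ts.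
Proof. by rewrite /mass big_cons. Qed.

Lemma mass_nil : mass [::] = 0.
Proof. by rewrite /mass big_nil. Qed.

Lemma mass_split_terms f b ws :
  mass (split_terms f b ws) <= 4^-1 * (wt (size b).+1 * weight ws).
Proof.
rewrite mass_flatten.
have W0 := weight_ge0 ws.
have wt0 n : 0 <= wt n :> R := wt_ge0 n.
apply: (@le_trans _ _ (\sum_(x <- splits b)
   (wt (size x.1.1).+1 * wt (size x.2).+1 + wt (size x.1.1) * wt (size x.2)) * weight ws)).
  apply: ler_sum => x _; case: ifP => _; last case: ifP => _.
  - rewrite mass_cons mass_nil /= !weight_cons normrN normr1 addr0 mul1r mulrA.
    by rewrite ler_wpM2r // lerDl mulr_ge0.
  - rewrite mass_cons mass_nil /= !weight_cons normr1 addr0 mul1r mulrA.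
    by rewrite ler_wpM2r // lerDr mulr_ge0.
  - by rewrite mass_nil mulr_ge0 // addr_ge0 // mulr_ge0.
rewrite -mulr_suml big_split /= mulrA ler_wpM2r //.
rewrite (sum_splits_size b (fun j k => wt j.+1 * wt k.+1)).
rewrite (sum_splits_size b (fun j k => wt j * wt k)).
have -> : \sum_(j < size b) wt j.+1 * wt (size b - j.+1).+1 =
    \sum_(j < size b) wt j.+1 * wt (size b - j) :> R.
  by apply: eq_bigr => j _; rewrite -subSn.
have -> : 4^-1 = 8^-1 + 8^-1 :> R by lra.
by rewrite mulrDl; apply: lerD; [exact: convolution_interior|exact: convolution_full].
Qed.

Lemma mass_plaquette_terms (beta : R) f b ws q : size q = 4%N ->
  mass (plaquette_terms beta f b ws q) <=
  `|beta| * (8 * 64 ^+ 4) * (wt (size b).+1 * weight ws).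
Proof.
move=> sq; rewrite mass_flatten.
have W0 := weight_ge0 ws; have wt0 n : 0 <= wt n :> R := wt_ge0 n.
set V := wt _ * _; have V0 : 0 <= V by exact: mulr_ge0.
have P4 := @wt4 R; have Padd := @wt_add R.
have P0 : 0 <= 64 ^+ 4 :> R by rewrite exprn_ge0.
move: (64 ^+ 4) P4 Padd P0 => P P4 Padd P0.
apply: (@le_trans _ _ (\sum_(x <- splits q) `|beta| * (2 * P) * V)); last first.
  by rewrite big_const_seq count_predT size_splits sq iter_addr_0; lra.
rewrite big_seq [leRHS]big_seq; apply: ler_sum => x /splitsP qE.
have sx : (size x.1.1 + (size x.2).+1)%N = 4%N by rewrite -sq qE size_cat.
have e1 : wt (size q) * V <= P * V by rewrite sq ler_wpM2r.
have bnd k : (k <= 4)%N -> wt ((size b).+1 + k) * weight ws <= P * V.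
  by move=> k4; rewrite /V mulrA ler_wpM2r // Padd.
have b0 := normr_ge0 beta.
case: ifP => _; last case: ifP => _.
- rewrite !mass_cons mass_nil /= !weight_cons normrN /= addr0.
  have -> : (size (b ++ f :: x.2 ++ x.1.1)).+1 = ((size b).+1 + 4)%N.
    by rewrite size_cat /= size_cat addSn -sx; congr (_ + _).+1; rewrite addnS addnC.
  have := ler_wpM2l b0 (bnd 4%N isT); have := ler_wpM2l b0 e1; rewrite /V; lra.
- rewrite !mass_cons mass_nil /= !weight_cons normrN /= addr0.
  have -> : size (b ++ x.2 ++ x.1.1) = ((size b).+1 + 2)%N.
    have sx3 : (size x.2 + size x.1.1)%N = 3%N by move: sx; rewrite addnS addnC => -[].
    by rewrite !size_cat sx3 addSnnS.
  have := ler_wpM2l b0 (bnd 2%N isT); have := ler_wpM2l b0 e1; rewrite /V; lra.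
- by rewrite mass_nil !mulr_ge0.
Qed.

(** At most 2 * 9 ^ d plaquettes through the edge, two orientations and four
    letters each, and weight at most 2 * 64 ^ 4 per letter: the plaquette terms
    then have mass at most a quarter. *)
Definition beta_max : R := (64 * 64 ^+ 4 * (2 * (3 ^ d * 3 ^ d))%N%:R)^-1.

Let K_gt0 : 0 < (2 * (3 ^ d * 3 ^ d))%N%:R :> R.
Proof. by rewrite ltr0n !muln_gt0 !expn_gt0. Qed.

Lemma beta_max_gt0 : 0 < beta_max.
Proof. by rewrite invr_gt0 mulr_gt0 // mulr_gt0 // exprn_gt0. Qed.

(** A quarter for the splittings and a quarter for the plaquettes. *)
Lemma mass_loop_terms (beta : R) f b ws : `|beta| <= beta_max ->
  mass (loop_terms beta (plaquettes_through f) f b ws) <= 2^-1 * weight ((f :: b) :: ws).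
Proof.
move=> bm; rewrite mass_cat mass_flatten weight_cons [size (f :: b)]/=.
set V := wt _ * _; have V0 : 0 <= V by rewrite mulr_ge0 ?wt_ge0 ?weight_ge0.
have h1 : mass (split_terms f b ws) <= 4^-1 * V := mass_split_terms f b ws.
suff : \sum_(p <- plaquettes_through f) mass (plaquette_terms beta f b ws (val (repr p)) ++
    plaquette_terms beta f b ws (invw (val (repr p)))) <= 4^-1 * V by lra.
have P0 : 0 <= 64 ^+ 4 :> R by rewrite exprn_ge0.
apply: (@le_trans _ _ (\sum_(p <- plaquettes_through f) `|beta| * (16 * 64 ^+ 4) * V)).
  rewrite big_seq [leRHS]big_seq; apply: ler_sum => p /plaquettes_through_size sp.
  rewrite mass_cat.
  have := @mass_plaquette_terms beta f b ws _ sp.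
  have := @mass_plaquette_terms beta f b ws (invw (val (repr p))).
  by rewrite size_invw => /(_ sp); rewrite -/V; lra.
rewrite big_const_seq count_predT iter_addr_0 -[X in X <= _]mulr_natl mulrA ler_wpM2r //.
set n : R := (size _)%:R.
have nK : n <= (2 * (3 ^ d * 3 ^ d))%N%:R by rewrite ler_nat size_plaquettes_through.
set K : R := _%:R in nK; have K0 : 0 < K := K_gt0.
apply: (@le_trans _ _ (K * (beta_max * (16 * 64 ^+ 4)))).
  by apply: ler_pM => //; rewrite ?mulr_ge0 // ler_wpM2r // mulr_ge0.
rewrite /beta_max -/K; rewrite le_eqVlt; apply/orP; left; apply/eqP.
have : 64 ^+ 4 != 0 :> R by rewrite expf_neq0.
move: (64 ^+ 4) => z z0; field; by rewrite lt0r_neq0.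
Qed.

(** The equation always cuts the first word that is not empty: empty words have
    normalized trace 1 and can be dropped. *)
Definition nonnull ws := [seq w <- ws | w != [::]].

Definition seq_terms (beta : R) ws : terms :=
  if nonnull ws is (f :: b) :: ws' then
    loop_terms beta (plaquettes_through f) f b ws'
  else [::].

Definition seq_const ws : R[i] := if nonnull ws is [::] then 1 else 0.

Definition edge_seq ws : bool := all (all (@is_edge d)) ws.

Arguments edge_seq : simpl never.

Lemma edge_seq_cons w ws : edge_seq (w :: ws) = all (@is_edge d) w && edge_seq ws.
Proof. by []. Qed.

Lemma weight_nonnull ws : weight (nonnull ws) = weight ws.
Proof.
rewrite /weight /nonnull big_filter big_mkcond; apply: eq_bigr => w _.
by case: w.
Qed.

Lemma edge_seq_nonnull ws : edge_seq ws -> edge_seq (nonnull ws).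
Proof.
move=> /allP h; apply/allP => w; rewrite mem_filter => /andP[_]; exact: h.
Qed.

Lemma seq_contraction beta ws : `|beta| <= beta_max ->
  \sum_(t <- seq_terms beta ws) `|t.1| * weight t.2 <= 2^-1 * weight ws.
Proof.
move=> bm; rewrite -(weight_nonnull ws) /seq_terms.
case: (nonnull ws) => [|[|f b] ws']; try by rewrite big_nil mulr_ge0 ?weight_ge0 ?invr_ge0.
exact: mass_loop_terms.
Qed.

Lemma is_edge_invw q : all (@is_edge d) (invw q) = all (@is_edge d) q.
Proof.
rewrite /invw all_rev all_map; apply: eq_all => e /=; exact: is_edge_rev.
Qed.

Lemma seq_terms_edges beta ws : edge_seq ws ->
  forall t, t \in seq_terms beta ws -> edge_seq t.2.
Proof.
move=> /edge_seq_nonnull; rewrite /seq_terms.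
case: (nonnull ws) => [|[|f b] ws'] //; rewrite edge_seq_cons => /andP[/= /andP[ef eb] ews] t.
have sub (q : seq (edge d)) x : all (@is_edge d) q -> x \in splits q ->
    all (@is_edge d) x.1.1 && all (@is_edge d) x.2.
  move=> + /splitsP E; rewrite E all_cat /= => /andP[-> /andP[_ ->]].
  by [].
rewrite mem_cat => /orP[|].
  move=> /flattenP[ts /mapP[x xs ->]]; have /andP[e1 e2] := sub _ _ eb xs.
  case: ifP => _; last case: ifP => _ //; rewrite inE => /eqP -> /=;
    by rewrite !edge_seq_cons /= ?ef e1 e2 ews.
move=> /flattenP[ts /mapP[p pl ->]].
have eq : all (@is_edge d) (val (repr p)).
  by have /andP[/andP[]] := valP (repr p).
have H q : all (@is_edge d) q -> t \in plaquette_terms beta f b ws' q -> edge_seq t.2.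
  move=> eqq /flattenP[ts' /mapP[x xs ->]]; have /andP[e1 e2] := sub _ _ eqq xs.
  case: ifP => _; last case: ifP => _ //; rewrite !inE => /orP[] /eqP -> /=;
    by rewrite !edge_seq_cons /= ?all_cat /= ?all_cat ?ef ?eb ?e1 ?e2 ?ews ?eqq.
by rewrite mem_cat => /orP[]; apply: H => //; rewrite is_edge_invw.
Qed.

End LoopContraction.

Arguments edge_seq : simpl never.

(** * The large N limit *)

Section LoopLimits.
Context {R : realType} {d : nat}.
Variable L : nat -> {fset site d}.
Hypothesis L_incr : forall m n : nat, (m <= n)%N -> (L m `<=` L n)%fset.
Hypothesis L_exhaust : forall x : site d, exists n : nat, x \in L n.

Lemma volumes_contain (s : seq (site d)) :
  exists n0, forall n, (n0 <= n)%N -> forall x, x \in s -> x \in L n.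
Proof.
apply: (@eventually_all _ s (fun x n => x \in L n)) => x _.
have [n0 h] := L_exhaust x; exists n0 => n nn.
exact: (fsubsetP (L_incr nn)).
Qed.

Section Family.
Variables (G : forall N, unitary_group R N)
  (sigma : forall N, probability (uelt (G N)) R) (B beta : R).

Definition family_phi N ws : R[i] := phi (sigma N) (L N) B ws.

Hypothesis loop_equation : forall N f b ws, (0 < N)%N ->
  (if pos_edge f then f else rev_edge f) \in pos_edges (L N) ->
  normc (family_phi N ((f :: b) :: ws) -
    lincomb (family_phi N) (loop_terms beta (plaquettes (L N)) f b ws)) <=
  2 * (1 + (size b)%:R + 2 * (\sum_(w <- ws) size w)%N%:R) / N%:R.

Lemma phi_nonnull N ws : (0 < N)%N -> family_phi N ws = family_phi N (nonnull ws).
Proof.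
move=> N0; rewrite /family_phi /phi; congr gauge_expect; apply/funext => Q.
rewrite /uprod /nonnull big_filter [RHS]big_mkcond; apply: eq_bigr => w _.
case: w => //=; rewrite mxtrace1 divff // pnatr_eq0; by rewrite -lt0n.
Qed.

Lemma phi_nil N : family_phi N [::] = 1.
Proof.
have Z0 := partition_function_gt0 (sigma N) (L N) B.
rewrite /family_phi /phi; have -> : (fun Q : config (G N) (L N) => uprod Q [::]) = fun=> 1.
  by apply/funext => Q; rewrite /uprod big_nil.
rewrite /gauge_expect /=.
have -> : \int[config_haar (sigma N) (L N)]_Q (1 * gauge_weight B Q) =
    partition_function (sigma N) (L N) B.
  by apply: eq_Rintegral => Q _; rewrite mul1r.
have -> : \int[config_haar (sigma N) (L N)]_Q (0 * gauge_weight B Q) = 0.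
  under eq_Rintegral do rewrite mul0r.
  by rewrite Rintegral_cst // mul0r.
by rewrite mulVf ?lt0r_neq0 // mulr0.
Qed.

(** For a fixed sequence of words, the volume eventually contains every vertex
    involved; from then on only the O(1/N) error is left. *)
Lemma family_approximate :
  approximate_solution (fun ws => edge_seq ws) seq_const (seq_terms beta) family_phi.
Proof.
move=> ws ews e e0.
have := edge_seq_nonnull ews; have Enn N N0 := @phi_nonnull N ws N0.
have null_notin : [::] \notin nonnull ws by rewrite mem_filter.
rewrite /seq_const /seq_terms; move: null_notin; case E : (nonnull ws) => [|[|f b] ws'] //= _.
  move=> _; exists 1%N => N N0.
  by rewrite Enn // E phi_nil lincomb_nil addr0 subrr normc0 ltW.
rewrite edge_seq_cons => /andP[/= /andP[ef _] _].
pose C := 2 * (1 + (size b)%:R + 2 * (\sum_(w <- ws') size w)%N%:R) : R.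
have [n1 h1] := volumes_contain (vertices_through f).
have C0 : 0 <= C / e by rewrite divr_ge0 ?(ltW e0) // mulr_ge0 // !addr_ge0 // mulr_ge0.
exists (maxn n1 (Num.bound (C / e)).+1) => N; rewrite geq_max => /andP[/h1 VL Ne].
have N0 : (0 < N)%N by exact: leq_trans Ne.
have fL : (if pos_edge f then f else rev_edge f) \in pos_edges (L N).
  by apply: link_in_volume => //; apply: VL; rewrite !inE eqxx ?orbT.
rewrite add0r Enn // E -(lincomb_loop_terms _ _ _ _ VL).
apply: le_trans (loop_equation _ _ N0 fL) _; rewrite -/C.
rewrite ler_pdivrMr ?ltr0n // mulrC -ler_pdivrMr //.
apply: le_trans (ltW (archi_boundP C0)) _; rewrite ler_nat.
exact: ltnW.
Qed.

End Family.

Lemma SO_loop_equation (sigma : forall N, probability (uelt (SO R N)) R) (beta : R) :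
  (forall N, is_haar (sigma N)) ->
  forall N f b ws, (0 < N)%N ->
  (if pos_edge f then f else rev_edge f) \in pos_edges (L N) ->
  normc (family_phi sigma beta N ((f :: b) :: ws) -
    lincomb (family_phi sigma beta N) (loop_terms beta (plaquettes (L N)) f b ws)) <=
  2 * (1 + (size b)%:R + 2 * (\sum_(w <- ws) size w)%N%:R) / N%:R.
Proof.
move=> haar N f b ws N0 fL.
have c1 := casimir_square (@so_casimir R N).
apply: (approximate_loop_equation N0 fL c1 (@so_casimir R N) (@so_gen_adj R N)
  (@so_square_one R N) _ (@so_square_bound R N) (@so_form_bound R N) _ (haar N)
  (g := fun k t => so_curve k t)).
- by rewrite normc1.
- by move=> Q b' p; apply: so_plaquette_rule; exact: rev_edge_neq fL.
- by move=> k; exact: mexpands_curve.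
Qed.

Lemma SU_loop_equation (sigma : forall N, probability (uelt (SU R N)) R) (beta : R) :
  (forall N, is_haar (sigma N)) ->
  forall N f b ws, (0 < N)%N ->
  (if pos_edge f then f else rev_edge f) \in pos_edges (L N) ->
  normc (family_phi sigma (2 * beta) N ((f :: b) :: ws) -
    lincomb (family_phi sigma (2 * beta) N) (loop_terms beta (plaquettes (L N)) f b ws)) <=
  2 * (1 + (size b)%:R + 2 * (\sum_(w <- ws) size w)%N%:R) / N%:R.
Proof.
move=> haar N f b ws N0 fL.
have c1 := casimir_square (@su_casimir R N N0).
apply: (approximate_loop_equation N0 fL c1 (@su_casimir R N N0) (@su_gen_adj R N)
  (@su_square_one R N) _ (@su_square_bound R N N0) (@su_form_bound R N N0) _ (haar N)
  (g := fun k t => su_curve k t)).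
- exact: su_square_one_le1.
- by move=> Q b' p; exact: su_plaquette_rule.
- by move=> k; exact: mexpands_curve.
Qed.

Lemma gauge_expect_wilson N (G : unitary_group R N) (sigma : probability (uelt G) R)
    (V : {fset site d}) (B : R) (ls : seq (loop d)) :
  gauge_expect sigma B (fun Q : config G V => \prod_(l <- ls) wilson Q l)
    / (N%:R : R[i]) ^+ size ls =
  phi sigma V B [seq \val (repr l) | l <- ls].
Proof.
pose P (Q : config G V) : R[i] := \prod_(l <- ls) wilson Q l.
have nP : bmeas P.
  apply: bmeas_prod => l _; rewrite (_ : (fun _ => _) = fun Q => \tr (hol (mlink Q) (\val (repr l)))).
    exact: bmeas_tr_hol.
  by apply/funext => Q; rewrite wilson_hol.
rewrite mulrC -gauge_expectZ // /phi; congr gauge_expect; apply/funext => Q.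
rewrite /P /uprod; elim: ls {P nP} => [|l ls IH]; first by rewrite !big_nil expr0 invr1 mulr1.
rewrite !big_cons -IH wilson_hol exprS invfM; ring.
Qed.

Lemma edge_seq_loops (ls : seq (loop d)) :
  edge_seq [seq \val (repr l) | l <- ls].
Proof.
by apply/allP => _ /mapP[l _ ->]; have /andP[/andP[]] := valP (repr l).
Qed.

Lemma complex_cvg (u : nat -> R[i]) (w : R[i]) :
  (forall e : R, 0 < e -> exists n0, forall n, (n0 <= n)%N -> normc (u n - w) <= e) ->
  u @ \oo --> w.
Proof.
move=> H A /nbhs_ballP[e /= e0 sA].
move: e0; rewrite ltcE /= => /andP[/eqP Ie Re].
have e2 : 0 < complex.Re e / 2 by rewrite divr_gt0.
have [n0 h] := H _ e2; exists n0 => // n /= nn; apply: sA.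
rewrite /ball /= distrC normcEn ltcE /= Ie eqxx /=.
by apply: le_lt_trans (h n nn) _; rewrite ltr_pdivrMr // ltr_pMr // ltr1n.
Qed.

End LoopLimits.

Theorem corollary4p4 (R : realType) (d : nat) (hd : (2 <= d)%N) :
  exists beta' : R, 0 < beta' /\
  forall (sigmaSU : forall N : nat, probability (uelt (SU R N)) R)
         (sigmaSO : forall N : nat, probability (uelt (SO R N)) R),
    (forall N, is_haar (sigmaSU N)) ->
    (forall N, is_haar (sigmaSO N)) ->
  forall beta : R, `|beta| <= beta' ->
  forall L : nat -> {fset site d},
    (forall m n : nat, (m <= n)%N -> (L m `<=` L n)%fset) ->
    (forall x : site d, exists n : nat, x \in L n) ->
  forall ls : seq (loop d),
  exists w : R[i],
    (fun N : nat =>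
       gauge_expect (sigmaSU N) (2 * beta)
         (fun Q : config (SU R N) (L N) => \prod_(l <- ls) wilson Q l)
       / (N%:R : R[i]) ^+ size ls) @ \oo --> w /\
    (fun N : nat =>
       gauge_expect (sigmaSO N) beta
         (fun Q : config (SO R N) (L N) => \prod_(l <- ls) wilson Q l)
       / (N%:R : R[i]) ^+ size ls) @ \oo --> w.
Proof.
exists (@beta_max R d); split; first exact: beta_max_gt0.
move=> sigmaSU sigmaSO haarSU haarSO beta betaM L L_incr L_exhaust ls.
have [w hw] := common_limit (@weight_ge1 R d) (@seq_terms_edges R d beta)
  (fun ws _ => seq_contraction ws betaM)
  (family_approximate L_incr L_exhaust (SU_loop_equation beta haarSU))
  (fun n s => phi_bound _ _ _ s)
  (family_approximate L_incr L_exhaust (SO_loop_equation beta haarSO))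
  (fun n s => phi_bound _ _ _ s) (edge_seq_loops ls).
exists w; split; apply: complex_cvg => e /hw[n0 h]; exists n0 => n /h[h1 h2];
  by rewrite gauge_expect_wilson.
Qed.
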